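(* Let $0<q<\infty$, $0<t\le\infty$, $\sigma>d/t>d/q$, $0<\gamma<1$ and $\mu\in\mathbb{Z}$. Let $A>0$ and let $\{f_k\}_{k\in\mathbb{Z}}$ be a sequence with $f_k\in\mathcal{E}(A2^k)$ for each $k\in\mathbb{Z}$. Then for every $Q\in\mathcal{D}$ there exists a proper measurable subset $S_Q\subset Q$ (depending on $\gamma,q,\sigma,t,\{f_k\}$) with $|S_Q|>(1-\gamma)|Q|$ such that $$\sup_{P\in \mathcal{D},\,l(P)\leq 2^{-\mu}}\Big(\frac{1}{|P|}\int_P\sum_{k=-\log_2 l(P)}^{\infty}|f_k(x)|^q\,dx \Big)^{1/q}\approx \Big\Vert \Big\{ \sum_{Q\in\mathcal{D}_k}\Big( \inf_{y\in Q}\mathfrak{M}_{\sigma,2^k}^tf_k(y)\Big)\chi_{S_Q} \Big\}_{k\geq \mu} \Big\Vert_{L^{\infty}(l^q)},$$ where the implicit constants in $\approx$ do not depend on $\mu$ or on $\{f_k\}$ (they depend only on $d,A,q,t,\sigma,\gamma$).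
   Context: Work on $\mathbb{R}^d$. For $r>0$, $\mathcal{E}(r)$ denotes the set of tempered distributions whose Fourier transform is supported in $\{\xi\in\mathbb{R}^d:|\xi|\le 2r\}$. $\mathcal{D}$ is the set of all dyadic cubes $\prod_{i=1}^d[2^{-k}m_i,2^{-k}(m_i+1))$ ($k\in\mathbb{Z}$, $m\in\mathbb{Z}^d$); $l(Q)$ is the side length of $Q$ and $\mathcal{D}_k$ is the set of dyadic cubes with $l(Q)=2^{-k}$. For $k\in\mathbb{Z}$, $\sigma>0$, $0<t\le\infty$ and a function $g$, $\mathfrak{M}^t_{\sigma,2^k}g(x):=2^{kd/t}\big\Vert g(x-\cdot)\,(1+2^k|\cdot|)^{-\sigma}\big\Vert_{L^t(\mathbb{R}^d)}$ (with $2^{kd/\infty}=1$). For a sequence of functions $\{g_k\}$, $\Vert\{g_k\}\Vert_{L^p(l^q)}:=\big\Vert(\sum_k|g_k|^q)^{1/q}\big\Vert_{L^p}$ (supremum in $k$ if $q=\infty$). $\chi_S$ is the indicator function of $S$. *)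

(* Defs.v *)
From HB Require Import structures.
From mathcomp Require Import all_boot all_order all_algebra.
From mathcomp Require Import all_classical all_reals all_analysis.
From mathcomp Require Import complex.
Set Implicit Arguments. Unset Strict Implicit. Unset Printing Implicit Defensive.
Import Order.TTheory GRing.Theory Num.Theory.
Import numFieldNormedType.Exports.
Local Open Scope classical_set_scope.
Local Open Scope ring_scope.

Definition rcoord {R : realType} {d : nat} (x : 'rV[R]_d) (i : 'I_d) : R := x ord0 i.

(* Euclidean norm |x| (the library norm on 'rV is the sup norm, so we define it) *)
Definition enorm {R : realType} {d : nat} (x : 'rV[R]_d) : R :=
  Num.sqrt (\sum_(i < d) rcoord x i ^+ 2).

Definition dotp {R : realType} {d : nat} (x y : 'rV[R]_d) : R :=
  \sum_(i < d) rcoord x i * rcoord y i.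

Definition cabs {R : realType} (z : R[i]) : R := Num.sqrt (complex.Re z ^+ 2 + complex.Im z ^+ 2).

Definition box {R : realType} {d : nat} (a b : 'rV[R]_d) : set 'rV[R]_d :=
  [set x | forall i, rcoord a i <= rcoord x i < rcoord b i].

Definition boxvol {R : realType} {d : nat} (a b : 'rV[R]_d) : R :=
  \prod_(i < d) Num.max (rcoord b i - rcoord a i) 0.

Definition lebo {R : realType} {d : nat} (A : set 'rV[R]_d) : \bar R :=
  ereal_inf [set s | exists a b : nat -> 'rV[R]_d,
     A `<=` \bigcup_n box (a n) (b n) /\
     s = (\sum_(n <oo) (boxvol (a n) (b n))%:E)%E].

Definition lebo_measurable {R : realType} {d : nat} (A : set 'rV[R]_d) : Prop :=
  forall E : set 'rV[R]_d, lebo E = (lebo (E `&` A) + lebo (E `&` ~` A))%E.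

(* Lebesgue integral on R^d of a nonnegative (extended) function, by the
   layer-cake formula  \int g = \int_0^oo |{g > s}| ds  *)
Definition lint {R : realType} {d : nat} (g : 'rV[R]_d -> \bar R) : \bar R :=
  (\int[lebesgue_measure]_(s in [set s : R | (0 <= s)%R]) lebo [set x | s%:E < g x])%E.

Definition rint {R : realType} {d : nat} (h : 'rV[R]_d -> R) : R :=
  fine (lint (fun x => (Num.max (h x) 0)%:E)) -
  fine (lint (fun x => (Num.max (- h x) 0)%:E)).

Definition esssup {R : realType} {d : nat} (g : 'rV[R]_d -> \bar R) : \bar R :=
  ereal_inf [set s : \bar R | lebo [set x | (s < g x)%E] = 0%E].

Fixpoint iterDer {R : realType} {d : nat} (vs : seq 'rV[R]_d) (g : 'rV[R]_d -> R)
  : 'rV[R]_d -> R :=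
  match vs with
  | [::] => g
  | v :: vs' => fun x => derive (iterDer vs' g) x v
  end.

Definition smooth {R : realType} {d : nat} (g : 'rV[R]_d -> R) : Prop :=
  forall (vs : seq 'rV[R]_d) (x : 'rV[R]_d), differentiable (iterDer vs g) x.

Definition test_outside {R : realType} {d : nat} (r : R) (phi : 'rV[R]_d -> R[i]) : Prop :=
  smooth (fun x => complex.Re (phi x)) /\ smooth (fun x => complex.Im (phi x)) /\
  exists K : set 'rV[R]_d, compact K /\ K `<=` [set xi | 2 * r < enorm xi] /\
    (forall xi, ~ K xi -> phi xi = Complex 0 0).

(* Fourier transform  phi^(x) = \int phi(xi) e^{-2 pi i x.xi} dxi *)
Definition fourier {R : realType} {d : nat} (phi : 'rV[R]_d -> R[i]) (x : 'rV[R]_d) : R[i] :=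
  Complex
    (rint (fun xi => complex.Re (phi xi) * cos (2 * pi * dotp x xi) + complex.Im (phi xi) * sin (2 * pi * dotp x xi)))
    (rint (fun xi => complex.Im (phi xi) * cos (2 * pi * dotp x xi) - complex.Re (phi xi) * sin (2 * pi * dotp x xi))).

Definition pairing {R : realType} {d : nat} (f g : 'rV[R]_d -> R[i]) : R[i] :=
  Complex (rint (fun x => complex.Re (f x) * complex.Re (g x) - complex.Im (f x) * complex.Im (g x)))
          (rint (fun x => complex.Re (f x) * complex.Im (g x) + complex.Im (f x) * complex.Re (g x))).

(* E(r): tempered distributions whose Fourier transform is supported in
   {|xi| <= 2r}.  Such a distribution is (given by) a continuous function of
   polynomial growth f, and supp f^ is in the closed ball iff <f^, phi> =
   <f, phi^> = 0 for every test function phi supported outside the ball. *)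
Definition inEr {R : realType} {d : nat} (r : R) (f : 'rV[R]_d -> R[i]) : Prop :=
  continuous (fun x => complex.Re (f x)) /\ continuous (fun x => complex.Im (f x)) /\
  (exists (C : R) (N : nat), forall x, cabs (f x) <= C * (1 + enorm x) ^+ N) /\
  (forall phi, test_outside r phi -> pairing f (fourier phi) = Complex 0 0).

Definition dcube {R : realType} {d : nat} (k : int) (m : 'rV[int]_d) : set 'rV[R]_d :=
  [set x | forall i, (2 : R) ^ (- k) * (m ord0 i)%:~R <= rcoord x i
                     < (2 : R) ^ (- k) * ((m ord0 i)%:~R + 1)].

Definition dlen {R : realType} (k : int) : R := (2 : R) ^ (- k).

Definition dover {R : realType} (d : nat) (t : \bar R) : R :=
  match t with EFin t' => d%:R / t' | _ => 0 end.

Definition peetre {R : realType} {d : nat} (t : \bar R) (sigma : R) (k : int)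
  (g : 'rV[R]_d -> R[i]) (x : 'rV[R]_d) : \bar R :=
  let h := fun y => cabs (g (x - y)) * ((1 + (2 : R) ^ k * enorm y) `^ (- sigma)) in
  match t with
  | EFin t' => ((2 : R) `^ (k%:~R * d%:R / t'))%:E *
               (lint (fun y => (h y `^ t')%:E) `^ (1 / t'))%E
  | _ => esssup (fun y => (h y)%:E)
  end.

(* Main.v *)
(* Write [r = 2^k], [s = sigma t] and [M_k = r^d int |f_k(y)|^t (1 + r|x - y|)^(-s) dy], so that the maximal
   function in the theorem is [M_k^(1/t)].  The hypotheses give [d/s < 1] and [t < q < oo].  Testing the support
   condition against dilated cutoffs bounds [|f_k|] by its convolution with a rapidly decreasing kernel at scale
   [1/r]; a bootstrap then gives [|f_k|^t <= C M_k], hence [|f_k| <= C a_k] where [a_k] is the infimum of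
   [M_k^(1/t)] over the cube of level [k].  Conversely [a_k^q] is at most a weighted average of [|f_k|^q] at scale
   [1/r], so the integral of [sum_(k >= j) a_k^q] over a cube [P] of level [j] is at most [C |P| X^q], where [X] is
   the Carleson supremum over cubes of level at least [j].  Let [S_Q] be the part of [Q] (level [k]) on which
   [sum_(i >= k) a_i^q <= B X^q]; by Chebyshev's inequality it fills most of [Q] when [B] is large.  At a point, the
   first level at which it is selected bounds the selected sum by [B X^q]; and as [a_k] is constant on the cubes
   of level [k], restricting it to the sets [S_Q] costs at most a factor [1 - gamma] in the integrals over [P]. *)

Require Import Defs.
From HB Require Import structures.
From mathcomp Require Import all_boot all_order all_algebra.
From mathcomp Require Import all_classical all_reals all_analysis.
From mathcomp Require Import complex measurable_realfun.
From mathcomp Require Import ring lra.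
Set Implicit Arguments. Unset Strict Implicit. Unset Printing Implicit Defensive.
Import Order.TTheory GRing.Theory Num.Theory.
Import numFieldNormedType.Exports.
Local Open Scope classical_set_scope.
Local Open Scope ring_scope.

(** * Lebesgue measure on Euclidean space *)

(** The support condition speaks only of test functions that are smooth, compactly supported and
    vanish near the closed ball, so the reproducing inequality is reached without Fourier inversion.
    Dilates [Phi (eps k xi)] of one cutoff are split: the condition kills the high part, and the low
    part has a transform whose decay is uniform in [k]. As [k] grows, the transforms of the dilates
    concentrate at a point with total mass [PhiC]. Inversion would give [PhiC = 1]; an upper bound
    for [|f_k|] only asks for [PhiC > 0], which is proved by averaging over lattice points. The sets
    [S_Q] have to serve every [mu]. The threshold for a cube of level [k] therefore uses the
    Carleson supremum over levels at least [k], which is at most [X] as soon as [mu <= k]. That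
    supremum may be 0 or infinite, and Chebyshev's inequality is replaced by other arguments in
    these two cases. *)

Section lebo_outer_measure.
Context {R : realType} {n : nat}.
Implicit Types (a b : 'rV[R]_n.+1) (A E : set 'rV[R]_n.+1).

Lemma boxvol_ge0 a b : 0 <= boxvol a b.
Proof. by apply: prodr_ge0 => i _; rewrite le_max lexx orbT. Qed.

Lemma lebo_ge0 A : (0 <= lebo A)%E.
Proof.
apply: le_ereal_inf_tmp => _ [a [b [_ ->]]].
by apply: nneseries_ge0 => i _ _; rewrite lee_fin boxvol_ge0.
Qed.

Lemma lebo0 : lebo (set0 : set 'rV[R]_n.+1) = 0%E.
Proof.
apply/eqP; rewrite eq_le lebo_ge0 andbT; apply: ereal_inf_lbound.
exists (fun=> 0), (fun=> 0); split => //.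
rewrite eseries0// => i _ _; rewrite /boxvol (bigD1 ord0)//= subrr maxxx.
by rewrite mul0r.
Qed.

Lemma le_lebo : {homo @lebo R n.+1 : A B / A `<=` B >-> (A <= B)%E}.
Proof.
move=> A B AB; apply: ereal_inf_le_tmp => _ [a [b [Bab ->]]].
by exists a, b; split=> //; exact: subset_trans Bab.
Qed.

Lemma lebo_sigma_subadditive : sigma_subadditive (@lebo R n.+1).
Proof.
move=> A; have [[i ioo]|] := pselect (exists i, lebo (A i) = +oo%E).
  rewrite (eseries_pinfty _ _ ioo) ?leey// => m _.
  by rewrite -ltNye (lt_le_trans _ (lebo_ge0 _)).
rewrite -forallNE => Aoo.
apply/lee_addgt0Pr => _/posnumP[e].
apply: le_trans (epsilon_trick _ (fun m => lebo_ge0 (A m)) (ge0 e)).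
pose P k (c : (nat -> 'rV[R]_n.+1) * (nat -> 'rV[R]_n.+1)) :=
  A k `<=` \bigcup_m box (c.1 m) (c.2 m) /\
  (\sum_(m <oo) (boxvol (c.1 m) (c.2 m))%:E <=
     lebo (A k) + (e%:num / (2 ^ k.+1)%:R)%:E)%E.
have [G PG] : {G & forall k, P k (G k)}.
  apply: (@choice _ _ P) => k.
  have fA : lebo (A k) \is a fin_num.
    by rewrite ge0_fin_numE ?lebo_ge0// ltey; apply/eqP; exact: Aoo.
  have ek : (0 < e%:num / (2 ^ k.+1)%:R :> R) by [].
  have [x [a [b [Aab ->]]] xl] := lb_ereal_inf_adherent ek fA.
  by exists (a, b); split => //; exact: ltW.
pose v (p : nat * nat) : \bar R := (boxvol ((G p.1).1 p.2) ((G p.1).2 p.2))%:E.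
have v0 p : (0 <= v p)%E by rewrite lee_fin boxvol_ge0.
(* The covers of all the [A k] are merged into one sequence along a bijection of [nat] with
   [nat * nat]. *)
have [f bf] : exists f : nat -> nat * nat, bijective f.
  have /card_esym/ppcard_eqP[f] := card_nat2.
  by exists f; rewrite -setTT_bijective; exact: bij.
apply: (@le_trans _ _ (\esum_(p in setT) v p)).
  have [g fK gK] := bf.
  apply: ereal_inf_lbound.
  exists (fun k => (G (f k).1).1 (f k).2), (fun k => (G (f k).1).2 (f k).2).
  split.
    move=> x [k _ /(PG k).1[m _ xm]]; exists (g (k, m)) => //=.
    by rewrite gK.
  rewrite nneseries_esumT//; last by move=> k; rewrite lee_fin boxvol_ge0.
  by apply: reindex_esum; rewrite setTT_bijective.
have -> : (\esum_(p in setT) v p = \esum_(k in setT) \esum_(m in setT) v (k, m))%E.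
  rewrite esum_esum// (_ : setT `*`` _ = setT); last by apply/seteqP; split.
  by apply: eq_esum => -[].
rewrite nneseries_esumT; last by move=> k; rewrite adde_ge0 ?lebo_ge0.
apply: le_esum => k _; rewrite -nneseries_esumT//; exact: (PG k).2.
Qed.

HB.instance Definition _ := isOuterMeasure.Build R 'rV[R]_n.+1 (@lebo R n.+1)
  lebo0 lebo_ge0 le_lebo lebo_sigma_subadditive.

(** The same function, on the type that carries the Caratheodory sigma-algebra. It has a name of its
    own so that a measure structure can be attached to it beside the outer-measure structure of
    [lebo]. *)
Definition lebV : set (caratheodory_type (@lebo R n.+1)) -> \bar R := @lebo R n.+1.

HB.instance Definition _ := isMeasure.Build _ _ _ lebV
  lebo0 lebo_ge0 (@caratheodory_measure_sigma_additive _ _ (@lebo R n.+1)).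

End lebo_outer_measure.

(* [R^(n+1)] with the sigma-algebra of the Caratheodory-measurable sets of [lebo]. *)
Notation vec R n := (caratheodory_type (@lebo R n.+1)).

Lemma measurable_nneseries d (T : measurableType d) (R : realType) (D : set T)
    (h : nat -> T -> \bar R) :
  (forall k x, D x -> (0 <= h k x)%E) -> (forall k, measurable_fun D (h k)) ->
  measurable_fun D (fun x => \sum_(k <oo) h k x)%E.
Proof.
move=> h0 mh; have := @ge0_emeasurable_sum _ T R D h xpredT.
by apply => // k x Dx _; exact: h0.
Qed.

Section lebo_box.
Context {R : realType} {n : nat}.
Implicit Types (a b c x : 'rV[R]_n.+1) (A E : set 'rV[R]_n.+1).

Definition upd x (i : 'I_n.+1) (y : R) : 'rV[R]_n.+1 :=
  \row_j (if j == i then y else rcoord x j).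

Lemma rcoord_upd x i y j : rcoord (upd x i y) j = if j == i then y else rcoord x j.
Proof. by rewrite /rcoord mxE. Qed.

(** A hyperplane cuts every box of a cover into two boxes whose volumes add up, so the two halves of
    a cover of [E] cover the two parts of [E] at no extra cost. Boxes are intersections of such
    half-spaces and of their complements. *)
Lemma measurable_coord_lt (i : 'I_n.+1) (r : R) :
  measurable ([set x | rcoord x i < r] : set (vec R n)).
Proof.
apply: le_caratheodory_measurable => E.
apply: le_ereal_inf_tmp => _ [a [b [Eab ->]]].
pose b' k := upd (b k) i (Num.min (rcoord (b k) i) r).
pose a' k := upd (a k) i (Num.max (rcoord (a k) i) r).
have v k : (boxvol (a k) (b k))%:E =
    ((boxvol (a k) (b' k))%:E + (boxvol (a' k) (b k))%:E)%E.
  have V a1 b1 : boxvol a1 b1 = Num.max (rcoord b1 i - rcoord a1 i) 0 *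
    \prod_(j | j != i) Num.max (rcoord b1 j - rcoord a1 j) 0 by rewrite /boxvol (bigD1 i).
  rewrite -EFinD !V !rcoord_upd eqxx; congr EFin.
  have a'E j : j != i -> rcoord (a' k) j = rcoord (a k) j.
    by move=> /negbTE ij; rewrite rcoord_upd ij.
  have b'E j : j != i -> rcoord (b' k) j = rcoord (b k) j.
    by move=> /negbTE ij; rewrite rcoord_upd ij.
  under [X in _ = _ * X + _]eq_bigr do rewrite b'E//.
  under [X in _ = _ + _ * X]eq_bigr do rewrite a'E//.
  rewrite -mulrDl; congr (_ * _).
  by rewrite !maxEle !minEle; repeat case: ifPn; rewrite -?ltNge; lra.
rewrite (eq_eseriesr (fun k _ => v k)) nneseriesD; last 2 first.
- by move=> k _ _; rewrite lee_fin boxvol_ge0.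
- by move=> k _ _; rewrite lee_fin boxvol_ge0.
apply: leeD; apply: ereal_inf_lbound.
- exists a, b'; split => // x [/Eab[k _ xab]] /= xi; exists k => // j.
  rewrite rcoord_upd; case: ifPn => [/eqP ->|_]; last exact: xab.
  by rewrite lt_min xi andbT; exact: xab.
- exists a', b; split => // x [/Eab[k _ xab]] /= /negP; rewrite -leNgt => xi; exists k => // j.
  rewrite rcoord_upd; case: ifPn => [/eqP ->|_]; last exact: xab.
  by rewrite ge_max xi andbT; exact: xab.
Qed.

Lemma measurable_box a b : measurable (box a b : set (vec R n)).
Proof.
rewrite (_ : box a b = \bigcap_(i in [set: 'I_n.+1])
  ([set x | rcoord x i < rcoord b i] `&` ~` [set x | rcoord x i < rcoord a i])).
  apply: fin_bigcap_measurable => // i _; apply: measurableI; first exact: measurable_coord_lt.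
  by apply: measurableC; exact: measurable_coord_lt.
apply/seteqP; split => x /= h i; first by move=> _; have /andP[? ?] := h i; split => //=; apply/negP; rewrite -leNgt.
by have [/= -> /negP] := h i I; rewrite -leNgt => ->.
Qed.

Let len (a b : 'rV[R]_n.+1) (i : 'I_n.+1) : R := Num.max (rcoord b i - rcoord a i) 0.
Let ind (a b c : 'rV[R]_n.+1) (i : 'I_n.+1) : R := \1_`[rcoord a i, rcoord b i[ (rcoord c i).

(* Induction on the coordinates, integrating out one of them at each step. *)
Lemma cover_prod a0 b0 (a b : nat -> 'rV[R]_n.+1) :
  (forall i, rcoord a0 i < rcoord b0 i) ->
  box a0 b0 `<=` \bigcup_k box (a k) (b k) ->
  forall s : seq 'I_n.+1, uniq s -> forall c, box a0 b0 c ->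
  ((\prod_(i <- s) (rcoord b0 i - rcoord a0 i))%:E <=
   \sum_(k <oo) ((\prod_(i <- s) len (a k) (b k) i) *
                  \prod_(i | i \notin s) ind (a k) (b k) c i)%:E)%E.
Proof.
move=> ab0 cov.
have len0 a1 b1 i : 0 <= len a1 b1 i by rewrite le_max lexx orbT.
have ind0 a1 b1 c i : 0 <= ind a1 b1 c i by [].
have pos k s c : 0 <= (\prod_(i <- s) len (a k) (b k) i) *
                  \prod_(i | i \notin s) ind (a k) (b k) c i.
  by apply: mulr_ge0; apply: prodr_ge0.
elim=> [_ c c0|i s IH /= /andP[si us] c c0].
  (* With no coordinate integrated, the sum counts the boxes that contain [c], so it is at least
     1. *)
  have [k _ ck] := cov c c0.
  rewrite big_nil.
  apply: (@le_trans _ _ ((\prod_(i <- [::]) len (a k) (b k) i) *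
                  \prod_(i | i \notin [::]) ind (a k) (b k) c i)%:E).
    rewrite lee_fin big_nil mul1r big1// => i _.
    by rewrite /ind indicE mem_set//= in_itv /=; exact: ck.
  rewrite (nneseriesD1 (n := k))//; last by move=> *; rewrite lee_fin.
  by rewrite leeDl// nneseries_ge0// => *; rewrite lee_fin.
pose K : R := \prod_(j <- s) (rcoord b0 j - rcoord a0 j).
pose f k (y : R) : \bar R := ((\prod_(j <- s) len (a k) (b k) j) *
                  \prod_(j | j \notin s) ind (a k) (b k) (upd c i y) j)%:E.
pose Q k := \prod_(j | j \notin i :: s) ind (a k) (b k) c j.
have fE k y : f k y = (((\prod_(j <- s) len (a k) (b k) j) * Q k)%:E *
   (\1_`[rcoord (a k) i, rcoord (b k) i[ y)%:E)%E.
  rewrite /f -EFinM (bigD1 i)//= /ind rcoord_upd eqxx.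
  rewrite [in LHS]mulrCA [in RHS]mulrC; congr (_ * (_ * _))%:E.
  apply: eq_big => [j|j /andP[_ /negbTE ij]]; first by rewrite inE negb_or andbC.
  by rewrite rcoord_upd ij.
have -> : (\prod_(j <- i :: s) (rcoord b0 j - rcoord a0 j))%:E =
   (\int[lebesgue_measure]_(y in `[rcoord a0 i, rcoord b0 i[) K%:E)%E.
  rewrite integral_cst//= lebesgue_measure_itv/= lte_fin ab0 big_cons mulrC.
  by rewrite EFinM EFinB.
apply: (@le_trans _ _ (\int[lebesgue_measure]_(y in `[rcoord a0 i, rcoord b0 i[)
    \sum_(k <oo) f k y)%E).
  apply: ge0_le_integral => //.
  - by move=> y _; rewrite lee_fin prodr_ge0// => j _; rewrite subr_ge0 ltW.
  - apply: measurable_nneseries => k *; first by rewrite lee_fin.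
    rewrite (_ : f k = fun y => (((\prod_(j <- s) len (a k) (b k) j) * Q k)%:E *
      (\1_`[rcoord (a k) i, rcoord (b k) i[ y)%:E)%E); last by apply/funext => y.
    apply: measurable_funeM; apply/measurable_EFinP.
    exact: measurable_indic.
  - move=> y; rewrite /= in_itv/= => yi; apply: IH => // j.
    by rewrite rcoord_upd; case: eqP => [->|_]; [exact: yi|exact: c0].
rewrite integral_nneseries//; last first.
- by move=> k y _; rewrite lee_fin.
- move=> k; rewrite (_ : f k = fun y => (((\prod_(j <- s) len (a k) (b k) j) * Q k)%:E *
      (\1_`[rcoord (a k) i, rcoord (b k) i[ y)%:E)%E); last by apply/funext => y.
  apply: measurable_funeM; apply/measurable_EFinP.
  exact: measurable_indic.
apply: lee_nneseries => k _; first by move=> _; apply: integral_ge0 => y _; rewrite lee_fin.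
under eq_integral do rewrite fE.
have LQ : 0 <= \prod_(j <- s) len (a k) (b k) j * Q k.
  by apply: mulr_ge0; apply: prodr_ge0.
rewrite ge0_integralZl//; last by apply/measurable_EFinP; exact: measurable_indic.
rewrite big_cons -mulrA [X in (_ <= X%:E)%E]mulrC [X in (_ <= X)%E]EFinM; apply: lee_wpmul2l; first by rewrite lee_fin.
rewrite integral_indic//; apply: (@le_trans _ _ (lebesgue_measure `[rcoord (a k) i, rcoord (b k) i[%classic)).
  by apply: le_measure; rewrite ?inE//; exact: measurableI.
rewrite lebesgue_measure_itv/= lte_fin /len; case: ifPn => [ab|].
  by rewrite -EFinB lee_fin le_max lexx.
by rewrite lee_fin le_max lexx orbT.
Qed.

Lemma lebo_box a b : lebo (box a b) = (boxvol a b)%:E.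
Proof.
apply/eqP; rewrite eq_le; apply/andP; split.
  apply: ereal_inf_lbound; exists (fun k => if k == 0%N then a else 0), (fun k => if k == 0%N then b else 0).
  split; first by move=> x xab; exists 0%N.
  rewrite (nneseriesD1 (n := 0%N))//; last by move=> *; rewrite lee_fin boxvol_ge0.
  rewrite eseries0 ?adde0// => -[|k] _ // _.
  by rewrite /boxvol (bigD1 ord0)//= subrr maxxx mul0r.
have [ab|] := pselect (forall i, rcoord a i < rcoord b i); last first.
  move=> /existsNP[i /negP]; rewrite -leNgt => ba.
  rewrite {1}/boxvol (bigD1 i)//= max_r; last by rewrite subr_le0.
  by rewrite mul0r; exact: lebo_ge0.
apply: le_ereal_inf_tmp => _ [a' [b' [cov ->]]].
have aab : box a b a by move=> i; rewrite lexx ab.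
have := cover_prod ab cov (index_enum_uniq _) aab.
rewrite (_ : \prod_(i <- _) _ = boxvol a b); last first.
  by apply: eq_bigr => i _; rewrite max_l// subr_ge0 ltW.
move=> /le_trans; apply; apply: lee_nneseries => k _.
  by move=> _; rewrite lee_fin mulr_ge0//; apply: prodr_ge0 => // i _; rewrite le_max lexx orbT.
by rewrite lee_fin [X in _ * X]big1 ?mulr1// => i; rewrite mem_index_enum.
Qed.

End lebo_box.

Section lebo_affine.
Context {R : realType} {n : nat}.
Implicit Types (a b x : 'rV[R]_n.+1) (A : set 'rV[R]_n.+1).

(** Outer measure is an infimum over covers by boxes, so an estimate for preimages of boxes extends
    to arbitrary sets. *)
Lemma lebo_preimage_le (T : 'rV[R]_n.+1 -> 'rV[R]_n.+1) (k : R) A : 0 < k ->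
  (forall a b, (lebo (T @^-1` box a b) <= (k * boxvol a b)%:E)%E) ->
  (lebo (T @^-1` A) <= k%:E * lebo A)%E.
Proof.
move=> k0 Tk; rewrite muleC -lee_pdivrMr//.
apply: le_ereal_inf_tmp => _ [a [b [Aab ->]]]; rewrite lee_pdivrMr// muleC.
apply: (@le_trans _ _ (lebo (\bigcup_m (T @^-1` box (a m) (b m))))).
  by apply: le_lebo => x /Aab[m _ ?]; exists m.
apply: le_trans; first exact: lebo_sigma_subadditive.
rewrite -nneseriesZl//; last by move=> *; rewrite lee_fin boxvol_ge0.
by apply: lee_nneseries => m *; [exact: lebo_ge0|rewrite -EFinM; exact: Tk].
Qed.

(** Equality comes from the inequality for the map and for its inverse. *)
Lemma lebo_preimage_scale (c : R) v A : 0 < c ->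
  lebo [set x | A (c *: x + v)] = ((c^-1 ^+ n.+1)%:E * lebo A)%E.
Proof.
have le (c' : R) v' A' : 0 < c' ->
    (lebo ((fun x => (c' *: x + v')%R) @^-1` A') <= (c'^-1 ^+ n.+1)%:E * lebo A')%E.
  move=> c0; apply: lebo_preimage_le => [|a b]; first by rewrite exprn_gt0// invr_gt0.
  rewrite (_ : _ @^-1` _ = box (c'^-1 *: (a - v')) (c'^-1 *: (b - v'))).
    have -> : c'^-1 ^+ n.+1 = \prod_(i < n.+1) c'^-1 by rewrite prodr_const card_ord.
    rewrite lebo_box lee_fin /boxvol -big_split/=.
    apply: ler_prod => i _; rewrite le_max lexx orbT/= /rcoord !mxE -mulrBr.
    by rewrite [leRHS]maxr_pMr ?invr_ge0 ?(ltW c0)// mulr0 opprB addrA subrK.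
  apply/seteqP; split => x /= h i; have := h i; rewrite /rcoord !mxE.
    by rewrite ler_pdivrMl// ltr_pdivlMl// lerBlDr ltrBrDr.
  by rewrite ler_pdivrMl// ltr_pdivlMl// lerBlDr ltrBrDr.
move=> c0; apply/eqP; rewrite eq_le le//=.
have := @le c^-1 (- c^-1 *: v) [set x | A (c *: x + v)].
rewrite invr_gt0 invrK => /(_ c0) h.
rewrite -lee_pdivlMl ?exprn_gt0 ?invr_gt0//.
rewrite -exprVn invrK; apply: le_trans h; apply: le_lebo => x Ax /=.
by rewrite scalerDr !scalerA mulfV ?gt_eqF// mulrN mulfV ?gt_eqF// !scale1r scaleN1r subrK.
Qed.

(** The reflection of a half-open box is half open on the opposite side, hence not a [box]. It is
    enclosed in a box whose upper faces are moved out by [1 / (m + 1)], and [m] tends to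
    infinity. *)
Lemma lebo_preimage_opp A : lebo [set x | A (- x)] = lebo A.
Proof.
have le A' : (lebo (-%R @^-1` A') <= lebo A')%E.
  rewrite -[leRHS]mul1e; apply: lebo_preimage_le => // a b; rewrite mul1r.
  pose u m : R := boxvol (- b) (- a + const_mx m.+1%:R^-1).
  have uc : u @ \oo --> boxvol a b.
    apply: cvg_big => [|i _]; first exact: mul_continuous.
    apply: (@continuous_cvg _ _ _ _ _ _ (fun z : R => Num.max z 0)); first by apply: continuous_max; [exact: cvg_id|exact: cvg_cst].
    rewrite [X in _ --> X](_ : _ = rcoord b i - rcoord a i + 0)%R; last by rewrite addr0.
    under eq_fun do rewrite /rcoord !mxE opprK addrAC [- _ + _]addrC.
    by apply: cvgD; [exact: cvg_cst|exact: cvg_harmonic].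
  have uE : EFin \o u @ \oo --> (boxvol a b)%:E by apply/cvg_EFin => //; near=> m.
  rewrite -(cvg_lim _ uE)//; apply: lime_ge; first by apply/cvg_ex; exists (boxvol a b)%:E.
  near=> m; rewrite /= -lebo_box; apply: le_lebo => x /= xab i.
  have /andP[] := xab i; rewrite /rcoord !mxE => h1 h2.
  have : 0 < m.+1%:R^-1 :> R by rewrite invr_gt0.
  move: (m.+1%:R^-1) => e' e0; apply/andP; split; first by lra.
      by move: h1 h2 e0; lra.
apply/eqP; rewrite eq_le le/=; apply: le_trans (le [set x | A (- x)]).
by apply: le_lebo => x /=; rewrite opprK.
Unshelve. all: by end_near. Qed.

End lebo_affine.

(** * Dyadic cubes, measurability and the layer-cake integral *)

Section dyadic_floor.
Context {R : realType} {n : nat}.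
Implicit Types (x : 'rV[R]_n.+1).

(** The index of the unique dyadic cube of level [k] that contains [x] (see [dcubeE]). Functions
    constant on the cubes of level [k] are written [G (flo k x)]. *)
Definition flo (k : int) x : 'rV[int]_n.+1 := \row_i Num.floor ((2 : R) ^ k * rcoord x i).

Definition corner (k : int) (m : 'rV[int]_n.+1) : 'rV[R]_n.+1 :=
  \row_i ((2 : R) ^ (- k) * (m ord0 i)%:~R).

Lemma two_gt0 (k : int) : 0 < (2 : R) ^ k.
Proof. by rewrite exprz_gt0. Qed.

Lemma dcubeE k m x : dcube k m x <-> flo k x = m.
Proof.
split => [xm|<-].
  apply/rowP => i; rewrite mxE; apply: floor_def.
  have := xm i; rewrite -invr_expz ler_pdivrMl ?two_gt0// ltr_pdivlMl ?two_gt0//.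
  by rewrite -intrD1.
move=> i; rewrite mxE -invr_expz ler_pdivrMl ?two_gt0// ltr_pdivlMl ?two_gt0//.
by rewrite floor_le /= -intrD1 floorD1_gt.
Qed.

Lemma dcube_box k m : dcube k m = box (corner k m) (corner k m + const_mx ((2 : R) ^ (- k))).
Proof.
by apply/seteqP; split => x xm i; have := xm i; rewrite /rcoord !mxE mulrDr mulr1.
Qed.

Lemma measurable_dcube k m : measurable (dcube k m : set (vec R n)).
Proof. by rewrite dcube_box; exact: measurable_box. Qed.

Lemma lebo_dcube k m : lebo (dcube k m : set 'rV[R]_n.+1) = (dlen k ^+ n.+1)%:E.
Proof.
rewrite dcube_box lebo_box /boxvol; congr EFin.
under eq_bigr do rewrite /rcoord !mxE addrAC subrr add0r max_l ?ltW ?two_gt0//.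
by rewrite prodr_const card_ord.
Qed.

(** The indices are countable, so every preimage is a countable union of dyadic cubes, for arbitrary
    [G]. *)
Lemma measurable_flo k d (T : measurableType d) (G : 'rV[int]_n.+1 -> T) :
  measurable_fun [set: vec R n] (fun x => G (flo k x)).
Proof.
move=> _ B mB; rewrite setTI.
rewrite (_ : _ @^-1` B = \bigcup_m (if `[< B (G m) >] then dcube k m : set (vec R n) else set0)).
  apply: countable_bigcupT_measurable; first exact: countableP.
  by move=> m; case: ifP => _ //; exact: measurable_dcube.
apply/seteqP; split => x /=.
  move=> Bx; exists (flo k x) => //; rewrite ifT; last exact/asboolP.
  exact/dcubeE.
by move=> [m _]; case: ifPn => // /asboolP BG /dcubeE ->.
Qed.

Lemma rcoord_corner_flo k x i :
  rcoord x i - (2 : R) ^ (- k) < rcoord (corner k (flo k x)) i <= rcoord x i.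
Proof.
have /(_ i) := (dcubeE k _ x).2 erefl.
by rewrite /rcoord !mxE mulrDr mulr1 ltrBlDr => /andP[-> ->].
Qed.

Lemma rV_norm_coord x i : `|x ord0 i| <= `|x|.
Proof.
rewrite [leRHS]mx_normrE.
exact: (le_bigmax _ (fun ij : 'I_1 * 'I_n.+1 => `|x ij.1 ij.2|) (ord0, i)).
Qed.

Lemma rV_norm_lt x e : 0 < e -> (forall i, `|x ord0 i| < e) -> `|x| < e.
Proof.
move=> e0 h; rewrite [ltLHS]mx_normrE; apply/bigmax_ltP; split => // -[i j] _.
by rewrite (ord1 i); exact: h.
Qed.

Lemma corner_flo_cvg x : (fun k : nat => corner k%:Z (flo k%:Z x)) @ \oo --> x.
Proof.
apply/cvgrPdist_lt => e e0.
have c0 : ((2 : R)^-1 ^+ k) @[k --> \oo] --> 0 by apply: cvg_expr; rewrite ger0_norm ?invr_ge0// invf_lt1// ltr1n.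
have /cvgrPdist_lt/(_ _ e0) := c0; apply: filterS => k.
rewrite sub0r normrN ger0_norm ?exprn_ge0 ?invr_ge0// => ke.
apply: rV_norm_lt => // j; rewrite !mxE.
have := rcoord_corner_flo k x j; rewrite /rcoord !mxE -invr_expz -exprnP -exprVn => /andP[h1 h2].
by rewrite ger0_norm ?subr_ge0//; lra.
Qed.

(** The sigma-algebra is Caratheodory's and not defined from open sets, so [f] is exhibited as the
    pointwise limit of functions constant on dyadic cubes. *)
Lemma measurable_continuous (f : 'rV[R]_n.+1 -> R) : continuous f ->
  measurable_fun [set: vec R n] f.
Proof.
move=> cf; apply: (@measurable_fun_cvg _ (vec R n) R setT (fun (k : nat) x => f (corner k%:Z (flo k%:Z x))) f).
  by move=> k; exact: (@measurable_flo k _ (measurableTypeR R) (fun m => f (corner k m))).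
move=> x _; apply: continuous_cvg; first exact: cf.
exact: corner_flo_cvg.
Qed.

Lemma lebV_sigma_finite : sigma_finite [set: vec R n] lebV.
Proof.
exists (fun k : nat => box (const_mx (- k%:R)) (const_mx k%:R)).
  apply/seteqP; split => // x _.
  exists (Num.trunc (`|x|)).+1 => // i; rewrite /rcoord !mxE.
  have h : `|x ord0 i| < (Num.trunc (`|x|)).+1%:R.
    by apply: le_lt_trans (truncnS_gt _); exact: rV_norm_coord.
  by move: h; rewrite ltr_norml => /andP[/ltW -> ->].
move=> k; split; first exact: measurable_box.
by rewrite /lebV lebo_box ltry.
Qed.

HB.instance Definition _ := Measure_isSigmaFinite.Build _ _ _ (@lebV R n) lebV_sigma_finite.

(** Tonelli's theorem for the region [0 <= s < g x] under the graph: integrating over [x] first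
    gives [lint g], integrating over [s] first gives the integral of [g]. *)
Lemma lintE (g : 'rV[R]_n.+1 -> \bar R) : measurable_fun [set: vec R n] g ->
  (forall x, 0 <= g x)%E -> lint g = (\int[lebV]_x g x)%E.
Proof.
move=> mg g0.
pose h (p : vec R n * measurableTypeR R) : \bar R :=
  ((\1_[set p : vec R n * measurableTypeR R | (0 <= p.2)%R && (p.2%:E < g p.1)%E] p)%:E).
have mh : measurable_fun setT h.
  apply/measurable_EFinP/measurable_indic.
  have m1 : measurable_fun setT (fun p : vec R n * measurableTypeR R => (0 <= p.2)%R).
    apply: measurable_fun_ler; [exact: measurable_cst|exact: measurable_snd].
  have m2 : measurable_fun setT (fun p : vec R n * measurableTypeR R => (p.2%:E < g p.1)%E).
    apply: measurable_fun_lte; first by apply/measurable_EFinP; exact: measurable_snd.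
    exact: (measurableT_comp mg measurable_fst).
  have := measurable_and m1 m2; move=> /(_ measurableT [set true]).
  by rewrite setTI; apply.
have h0 p : (0 <= h p)%E by rewrite lee_fin.
have := fubini_tonelli (m1 := @lebV R n) (m2 := lebesgue_measure) h mh h0.
rewrite (eq_integral (g : vec R n -> \bar R)); last first.
  move=> x _; rewrite (_ : (fun y => _) = (fun y => (\1_[set y : R | (0 <= y)%R && (y%:E < g x)%E] y)%:E)); last first.
    by apply/funext => y; rewrite /h !indicE /=; congr (_%:R%:E); apply: asbool_equiv_eq.
  move: (g0 x); case: (g x) => [r||]//= r0.
    rewrite (_ : [set y : R | _] = `[0, r[%classic); last first.
      by apply/seteqP; split => y; rewrite /= in_itv/= lte_fin.
    rewrite integral_indic// setIT [LHS](_ : _ = lebesgue_measure (`[0, r[%classic : set R))// lebesgue_measure_itv/= lte_fin.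
    by move: r0; rewrite lee_fin; case: ltgtP => // [_|<-]; rewrite ?sube0.
  rewrite (_ : [set y : R | _] = `[0, +oo[%classic); last first.
    by apply/seteqP; split => y; rewrite /= in_itv/= ltry andbT.
  by rewrite integral_indic// setIT [LHS](_ : _ = lebesgue_measure (`[0, +oo[%classic : set R))// lebesgue_measure_itv/= ltry.
move=> ->; rewrite /lint [LHS]integral_mkcond; apply: eq_integral => s _.
rewrite patchE; case: ifPn; rewrite ?inE ?notin_setE /= => s0.
  rewrite (_ : (fun x => _) = (fun x => (\1_[set x | (s%:E < g x)%E] x)%:E)); last first.
    by apply/funext => y; rewrite /h !indicE /=; congr (nat_of_bool _)%:R%:E; apply/idP/idP; rewrite !inE /= s0.
  rewrite integral_indic ?setIT//.
  have := measurable_fun_lte (measurable_cst s%:E) mg; move=> /(_ measurableT [set true]).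
  by rewrite setTI; apply.
rewrite integral0_eq// => x _; rewrite /h indicE memNset//=.
by apply/negP; rewrite negb_and; apply/orP; left; apply/negP.
Qed.

End dyadic_floor.

(** * Affine changes of variables and the signed integral *)

Section change_of_variables.
Context {R : realType} {n : nat}.
Implicit Types (x v : 'rV[R]_n.+1).
Local Notation V := (vec R n).
Local Notation mu := (@lebV R n).

Lemma lebV_box a b : (mu : {measure set V -> \bar R}) (box a b) = (boxvol a b)%:E.
Proof. exact: lebo_box. Qed.

(** Caratheodory's condition for the preimage of [A] at the test set [E] is the condition for [A] at
    the image [E'] of [E], up to the scaling factor of [lebo]. *)
Lemma measurable_affine (c : R) v : 0 < c ->
  measurable_fun [set: V] (fun x => c *: x + v : V).
Proof.
move=> c0 _ A mA; rewrite setTI; apply: le_caratheodory_measurable => E.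
pose E' : set 'rV[R]_n.+1 := [set y | E (c^-1 *: (y - v))].
have TE (X : set 'rV[R]_n.+1) : E `&` [set x | X (c *: x + v)] = [set x | (E' `&` X) (c *: x + v)].
  by apply/seteqP; split => x; rewrite /E' /= addrK scalerA mulVf ?gt_eqF// scale1r.
have /= := TE A; rewrite /preimage => ->; have /= -> := TE (~` A).
have EE : E = [set x | E' (c *: x + v)].
  by apply/seteqP; split => x; rewrite /E' /= addrK scalerA mulVf ?gt_eqF// scale1r.
have /= -> := lebo_preimage_scale v (E' `&` A) c0.
have /= -> := lebo_preimage_scale v (E' `&` ~` A) c0.
rewrite [in leRHS]EE (lebo_preimage_scale v E' c0) -ge0_muleDr ?lebo_ge0//.
rewrite lee_pmul2l ?lte_fin ?exprn_gt0 ?invr_gt0//.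
by rewrite (mA E').
Qed.

Lemma measurable_oppV : measurable_fun [set: V] (fun x => - x : V).
Proof.
move=> _ A mA; rewrite setTI; apply: le_caratheodory_measurable => E.
pose E' : set 'rV[R]_n.+1 := [set y | E (- y)].
have TE (X : set 'rV[R]_n.+1) : E `&` [set x | X (- x)] = [set x | (E' `&` X) (- x)].
  by apply/seteqP; split => x; rewrite /E' /= opprK.
have /= := TE A; rewrite /preimage => ->; have /= -> := TE (~` A).
have EE : E = [set x | E' (- x)].
  by apply/seteqP; split => x; rewrite /E' /= opprK.
have /= -> := lebo_preimage_opp (E' `&` A).
have /= -> := lebo_preimage_opp (E' `&` ~` A).
by rewrite [in leRHS]EE (lebo_preimage_opp E') (mA E').
Qed.

Lemma ge0_integral_affine (c : R) v (g : V -> \bar R) : 0 < c ->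
  measurable_fun [set: V] g -> (forall x, 0 <= g x)%E ->
  (\int[mu]_x g (c *: x + v)%R = (c^-1 ^+ n.+1)%:E * \int[mu]_x g x)%E.
Proof.
move=> c0 mg g0.
have mT := measurable_affine v c0.
have := ge0_integral_pushforward mT mu measurableT mg (fun x _ => g0 x).
rewrite preimage_setT => <-.
have k0 : 0 <= c^-1 ^+ n.+1 by rewrite exprn_ge0// invr_ge0 ltW.
rewrite -(ge0_integral_mscale mu measurableT (NngNum k0))//.
apply: eq_measure_integral => A mA _; rewrite /pushforward /mscale /=.
exact: lebo_preimage_scale.
Qed.

Lemma ge0_integral_opp (g : V -> \bar R) :
  measurable_fun [set: V] g -> (forall x, 0 <= g x)%E ->
  (\int[mu]_x g (- x)%R = \int[mu]_x g x)%E.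
Proof.
move=> mg g0.
have mT := measurable_oppV.
have := ge0_integral_pushforward mT mu measurableT mg (fun x _ => g0 x).
rewrite preimage_setT => <-.
apply: eq_measure_integral => A mA _; rewrite /pushforward /=.
exact: lebo_preimage_opp.
Qed.

Lemma integrable_affine (c : R) v (g : V -> \bar R) : 0 < c ->
  mu.-integrable setT g -> mu.-integrable setT (fun x => g (c *: x + v)%R).
Proof.
move=> c0 /integrableP[mg fg]; apply/integrableP; split.
  exact: measurableT_comp mg (measurable_affine v c0).
rewrite (ge0_integral_affine v c0 (g := fun x => `|g x|%E))//; last exact: measurableT_comp.
by rewrite lte_mul_pinfty// lee_fin exprn_ge0// invr_ge0 ltW.
Qed.

Lemma Rintegral_affine (c : R) v (g : V -> R) : 0 < c ->
  mu.-integrable setT (EFin \o g) ->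
  \int[mu]_x g (c *: x + v) = c^-1 ^+ n.+1 * \int[mu]_x g x.
Proof.
move=> c0 ig; have ig' := integrable_affine v c0 ig.
have mg := measurable_int mu ig.
rewrite /Rintegral integralE [X in _ * fine X]integralE.
have E1 : (\int[mu]_x ((fun x => (g (c *: x + v))%:E)^\+ x) =
   (c^-1 ^+ n.+1)%:E * \int[mu]_x ((EFin \o g)^\+ x))%E.
  rewrite -(ge0_integral_affine v c0 (g := (EFin \o g)^\+%E))//.
    by apply: eq_integral => x _; rewrite !funeposE.
  exact: measurable_funepos.
have E2 : (\int[mu]_x ((fun x => (g (c *: x + v))%:E)^\- x) =
   (c^-1 ^+ n.+1)%:E * \int[mu]_x ((EFin \o g)^\- x))%E.
  rewrite -(ge0_integral_affine v c0 (g := (EFin \o g)^\-%E))//.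
    by apply: eq_integral => x _; rewrite !funenegE.
  exact: measurable_funeneg.
rewrite E1 E2.
have /fineK <- := integrable_pos_fin_num measurableT ig.
have /fineK <- := integrable_neg_fin_num measurableT ig.
by rewrite -!EFinM -!EFinB /= mulrBr.
Qed.

Lemma rintE (h : 'rV[R]_n.+1 -> R) : mu.-integrable setT (EFin \o h : V -> _) ->
  rint h = \int[mu]_x (h : V -> R) x.
Proof.
move=> ih; have mh := measurable_int mu ih.
have mh' : measurable_fun [set: V] h by apply/measurable_EFinP.
have mp : measurable_fun [set: V] (fun x => Num.max (h x) 0).
  by apply: measurable_maxr => //; exact: measurable_cst.
have mn : measurable_fun [set: V] (fun x => Num.max (- h x) 0).
  by apply: measurable_maxr; [exact: measurableT_comp|exact: measurable_cst].
have E1 : lint (fun x => (Num.max (h x) 0)%:E) = (\int[mu]_x ((EFin \o h)^\+ x))%E.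
  rewrite lintE; [|exact/measurable_EFinP|by move=> x; rewrite lee_fin le_max lexx orbT].
  by apply: eq_integral => x _; rewrite funeposE EFin_max.
have E2 : lint (fun x => (Num.max (- h x) 0)%:E) = (\int[mu]_x ((EFin \o h)^\- x))%E.
  rewrite lintE; [|exact/measurable_EFinP|by move=> x; rewrite lee_fin le_max lexx orbT].
  by apply: eq_integral => x _; rewrite funenegE EFin_max.
rewrite /rint E1 E2 /Rintegral [X in _ = fine X](_ : _ =
  (\int[mu]_x ((EFin \o h)^\+ x) - \int[mu]_x ((EFin \o h)^\- x))%E); last exact: integralE.
rewrite [RHS]fineB//; first exact: integrable_pos_fin_num.
exact: integrable_neg_fin_num.
Qed.

End change_of_variables.

(** * Continuity, the Euclidean norm and polynomial weights *)

Section continuity_pointwise.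
Context {K : realType} {T : topologicalType}.
Implicit Types (f g : T -> K).

Lemma continuous_sumr (I : Type) (r : seq I)
  (F : I -> T -> K) : (forall i, continuous (F i)) -> continuous (fun x => \sum_(i <- r) F i x).
Proof.
move=> cF x; apply: cvg_big => [|i _]; first exact: add_continuous.
exact: cF.
Qed.

Lemma continuous_add f g : continuous f -> continuous g -> continuous (fun x => f x + g x).
Proof. by move=> cf cg x; apply: cvgD; [exact: cf|exact: cg]. Qed.

Lemma continuous_mul f g : continuous f -> continuous g -> continuous (fun x => f x * g x).
Proof. by move=> cf cg x; apply: cvgM; [exact: cf|exact: cg]. Qed.

Lemma continuous_cst (c : K) : continuous (fun _ : T => c).
Proof. by move=> x; exact: cvg_cst. Qed.

Lemma continuous_opp f : continuous f -> continuous (fun x => - f x).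
Proof. by move=> cf x; apply: cvgN; exact: cf. Qed.

Lemma continuous_le_dist f (b : T -> T -> K) :
  (forall x y, `|f x - f y| <= b x y) -> (forall x, b x y @[y --> x] --> 0) -> continuous f.
Proof.
move=> fb b0 x; apply/cvgrPdist_lt => e e0.
have /cvgrPdist_lt/(_ _ e0) := b0 x; apply: filterS => y /=.
by rewrite sub0r normrN => /(le_lt_trans (ler_norm _)); exact: le_lt_trans.
Qed.

Lemma continuous_exprn f m : continuous f -> continuous (fun x => f x ^+ m).
Proof.
move=> cf; elim: m => [|m IH]; first exact: continuous_cst.
by under eq_fun do rewrite exprS; exact: continuous_mul.
Qed.

Lemma continuous_o (S : topologicalType) (g : K -> S) f :
  continuous f -> (forall x, {for f x, continuous g}) -> continuous (fun x => g (f x)).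
Proof. by move=> cf cg x; apply: (continuous_comp (g := g)); [exact: cf|exact: cg]. Qed.

End continuity_pointwise.

Lemma continuous_affine (K : realType) (W : normedModType K) (c : K) (v : W) :
  continuous (fun x : W => c *: x + v).
Proof. by move=> x; apply: cvgD; [apply: cvgZr; exact: cvg_id|exact: cvg_cst]. Qed.

Lemma continuous_powR (K : realType) (s r : K) : 0 < r -> {for r, continuous (fun x => x `^ s)}.
Proof.
by move=> r0; apply: differentiable_continuous; apply/derivable1_diffP; have [] := is_derive1_powR s r0.
Qed.

Lemma lee_geometric_eseries (K : realType) (c a : K) : 0 <= c -> 0 < a -> a < 1 ->
  (\sum_(j <oo) (c * a ^+ j)%:E <= (c / (1 - a))%:E)%E.
Proof.
move=> c0 a0 a1; apply: lime_le.
  by apply: is_cvg_nneseries => j _ _; rewrite lee_fin mulr_ge0// exprn_ge0// ltW.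
near=> m; rewrite sumEFin lee_fin.
by apply: geometric_le_lim => //; rewrite ger0_norm// ltW.
Unshelve. all: by end_near. Qed.

Section enorm.
Context {R : realType} {n : nat}.
Implicit Types (x y : 'rV[R]_n.+1).

Lemma enorm_ge0 x : 0 <= enorm x. Proof. exact: sqrtr_ge0. Qed.

Lemma enorm_sqr x : enorm x ^+ 2 = \sum_i rcoord x i ^+ 2.
Proof. by rewrite sqr_sqrtr// sumr_ge0// => i _; exact: sqr_ge0. Qed.

Lemma enorm_coord x i : `|rcoord x i| <= enorm x.
Proof.
rewrite -sqrtr_sqr; apply: ler_wsqrtr; rewrite (bigD1 i)//= lerDl.
by apply: sumr_ge0 => j _; exact: sqr_ge0.
Qed.

Lemma dotp_le x y : dotp x y <= enorm x * enorm y.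
Proof.
have [x0|x0] := eqVneq (enorm x) 0.
  rewrite /dotp big1 ?x0 ?mul0r// => i _.
  have := enorm_coord x i; rewrite x0 normr_le0 => /eqP ->; exact: mul0r.
have [y0|y0] := eqVneq (enorm y) 0.
  rewrite /dotp big1 ?y0 ?mulr0// => i _.
  have := enorm_coord y i; rewrite y0 normr_le0 => /eqP ->; exact: mulr0.
have xp : 0 < enorm x by rewrite lt_def x0 enorm_ge0.
have yp : 0 < enorm y by rewrite lt_def y0 enorm_ge0.
have : 0 <= \sum_i (rcoord x i * enorm y - rcoord y i * enorm x) ^+ 2.
  by apply: sumr_ge0 => i _; exact: sqr_ge0.
under eq_bigr do rewrite sqrrB !exprMn.
rewrite big_split/= sumrB -!mulr_suml -!enorm_sqr.
have -> : \sum_(i < n.+1) rcoord x i * enorm y * (rcoord y i * enorm x) *+ 2 =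
   dotp x y * (enorm x * enorm y) *+ 2.
  by rewrite sumrMnl /dotp mulr_suml; congr (_ *+ 2); apply: eq_bigr => i _; ring.
move=> h; rewrite -(ler_pM2r (mulr_gt0 xp yp)).
by move: h; rewrite mulr2n; nra.
Qed.

Lemma enormD x y : enorm (x + y) <= enorm x + enorm y.
Proof.
rewrite -(@ler_pXn2r _ 2)// ?nnegrE ?enorm_ge0 ?addr_ge0 ?enorm_ge0//.
rewrite enorm_sqr (eq_bigr (fun i => rcoord x i ^+ 2 + 2 * (rcoord x i * rcoord y i) + rcoord y i ^+ 2)); last first.
  by move=> i _; rewrite /rcoord mxE sqrrD mulr_natl.
rewrite !big_split/= -!enorm_sqr -mulr_sumr -/(dotp x y) sqrrD.
by have := dotp_le x y; lra.
Qed.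

Lemma enormN x : enorm (- x) = enorm x.
Proof. by congr Num.sqrt; apply: eq_bigr => i _; rewrite /rcoord mxE sqrrN. Qed.

Lemma enormZ (c : R) x : 0 <= c -> enorm (c *: x) = c * enorm x.
Proof.
move=> c0; rewrite /enorm; under eq_bigr do rewrite /rcoord mxE exprMn.
by rewrite -mulr_sumr sqrtrM ?sqr_ge0// sqrtr_sqr ger0_norm.
Qed.

Lemma enorm_le_sum x : enorm x <= \sum_i `|rcoord x i|.
Proof.
have s0 : 0 <= \sum_i `|rcoord x i| by apply: sumr_ge0.
rewrite -(@ler_pXn2r _ 2)// ?nnegrE ?enorm_ge0//.
rewrite enorm_sqr expr2 mulr_suml; apply: ler_sum => i _.
rewrite -[leLHS]real_normK ?num_real// expr2; apply: ler_wpM2l => //.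
by rewrite (bigD1 i)//= lerDl sumr_ge0.
Qed.

Lemma enorm_le_coord x (r : R) : (forall i, `|rcoord x i| <= r) -> enorm x <= n.+1%:R * r.
Proof.
move=> h; apply: (le_trans (enorm_le_sum x)).
apply: (le_trans (ler_sum _ (fun i _ => h i))).
by rewrite sumr_const card_ord mulr_natl.
Qed.

Lemma continuous_rcoord i : continuous (fun x => rcoord x i).
Proof. exact: coord_continuous. Qed.

Lemma continuous_enorm : continuous (fun x : 'rV[R]_n.+1 => enorm x).
Proof.
apply: (@continuous_o _ _ _ Num.sqrt (fun x : 'rV[R]_n.+1 => \sum_i rcoord x i ^+ 2)).
  by apply: continuous_sumr => i; apply: continuous_exprn; exact: continuous_rcoord.
by move=> x; exact: sqrt_continuous.
Qed.

Lemma continuous_enorm_affine (c : R) v : continuous (fun x : 'rV[R]_n.+1 => enorm (c *: x + v)).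
Proof.
move=> x; apply: (@continuous_comp _ _ _ (fun x => c *: x + v) (fun x => enorm x)).
  exact: continuous_affine.
exact: continuous_enorm.
Qed.

End enorm.

Section weights.
Context {R : realType} {n : nat}.
Implicit Types (x y : 'rV[R]_n.+1).
Local Notation V := (vec R n).
Local Notation mu := (@lebV R n).

(** The exponent may be negative: [wgt (- s)] is the inverse of [wgt s] and serves as a growth
    factor. *)
Definition wgt (s : R) x : R := (1 + enorm x) `^ (- s).

Lemma wgt_base x : 1 <= 1 + enorm x.
Proof. by rewrite lerDl enorm_ge0. Qed.

Lemma wgt_base_gt0 x : 0 < 1 + enorm x.
Proof. exact: lt_le_trans (wgt_base x). Qed.

Lemma wgt_ge0 s x : 0 <= wgt s x. Proof. exact: powR_ge0. Qed.

Lemma wgt_gt0 s x : 0 < wgt s x. Proof. by rewrite powR_gt0// wgt_base_gt0. Qed.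

Lemma wgt_le s s' x : s' <= s -> wgt s x <= wgt s' x.
Proof. by move=> ss; rewrite /wgt ler_powR ?wgt_base// lerN2. Qed.

Lemma wgtN s x : wgt s (- x) = wgt s x.
Proof. by rewrite /wgt enormN. Qed.

(** Since [1 + |x + y| <= (1 + |x|) (1 + |y|)]. The comparison of weights with different centres
    rests on this. *)
Lemma wgtD_le s x y : 0 <= s -> wgt s x * wgt s y <= wgt s (x + y).
Proof.
move=> s0; rewrite /wgt -powRM ?(ltW (wgt_base_gt0 _))// !powRN lef_pV2 ?posrE; last 2 first.
- by rewrite powR_gt0// mulr_gt0// wgt_base_gt0.
- by rewrite powR_gt0// wgt_base_gt0.
apply: ge0_ler_powR => //; rewrite ?nnegrE ?mulr_ge0 ?(ltW (wgt_base_gt0 _))//.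
have := enormD x y; have := enorm_ge0 x; have := enorm_ge0 y; nra.
Qed.

Lemma continuous_wgt s (c : R) v : continuous (fun x : 'rV[R]_n.+1 => wgt s (c *: x + v)).
Proof.
apply: (@continuous_o _ _ _ (fun r => r `^ (- s)) (fun x : 'rV[R]_n.+1 => 1 + enorm (c *: x + v))).
  by apply: continuous_add; [exact: continuous_cst|exact: continuous_enorm_affine].
by move=> x; apply: continuous_powR; exact: wgt_base_gt0.
Qed.

(** On the shell [2^j <= 1 + |x| < 2^(j + 1)] the weight is at most [2^(- s j)], and the shell lies
    in the cube of index [j]. The majorant integrates to a geometric series. *)
Lemma wgt_dyadic (s : R) x : 0 <= s ->
  ((wgt s x)%:E <= \sum_(j <oo) ((2 `^ (- s)) ^+ j *
      \1_(box (const_mx (- 2 ^+ j.+1)) (const_mx (2 ^+ j.+1))) x)%:E)%E.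
Proof.
move=> s0.
pose j := trunc_log 2 (Num.trunc (1 + enorm x)).
have t1 : (0 < Num.trunc (1 + enorm x))%N by rewrite truncn_gt0 wgt_base.
have [tl th] := (truncn_itv (ltW (wgt_base_gt0 x)), trunc_log_bounds (ltnSn 1) t1).
rewrite (nneseriesD1 (n := j))//.
rewrite -[leLHS]adde0; apply: leeD; last first.
  by apply: nneseries_ge0 => k *; rewrite lee_fin mulr_ge0// exprn_ge0// powR_ge0.
have jl : 2 ^+ j <= 1 + enorm x.
  case/andP: tl => tl _; apply: le_trans tl; case/andP: th => th _.
  by rewrite -natrX ler_nat.
have ju : 1 + enorm x < 2 ^+ j.+1.
  case/andP: tl => _ tl; apply: (lt_le_trans tl); case/andP: th => _ th.
  by rewrite -natrX ler_nat.
rewrite lee_fin indicE mem_set; last first.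
  move=> i; have := enorm_coord x i; rewrite ler_norml /rcoord !mxE => /andP[h1 h2].
  move: (2 ^+ j.+1) ju h1 h2 => a ju; rewrite /rcoord => h1 h2.
  by clear - ju h1 h2; apply/andP; split; lra.
rewrite mulr1 -powR_mulrn ?powR_ge0// -powRrM mulrC powRrM powR_mulrn// /wgt !powRN.
rewrite lef_pV2 ?posrE ?powR_gt0 ?exprn_gt0 ?wgt_base_gt0//.
by apply: ge0_ler_powR => //; rewrite nnegrE ?exprn_ge0 ?(ltW (wgt_base_gt0 x)).
Qed.

Lemma integral_wgt_lty s : n.+1%:R < s -> (\int[mu]_x (wgt s x)%:E < +oo)%E.
Proof.
move=> ds; have s0 : 0 <= s by apply: ltW (le_lt_trans _ ds).
have mb j : measurable (box (const_mx (- 2 ^+ j.+1)) (const_mx (2 ^+ j.+1)) : set V) by exact: measurable_box.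
pose u j x : \bar R := ((2 `^ (- s)) ^+ j *
      \1_(box (const_mx (- 2 ^+ j.+1)) (const_mx (2 ^+ j.+1))) x)%:E.
have mu_ j : measurable_fun [set: V] (u j).
  by apply/measurable_EFinP; apply: measurable_funM => //; exact: measurable_indic.
have u0 j x : (0 <= u j x)%E by rewrite lee_fin mulr_ge0// exprn_ge0// powR_ge0.
apply: (@le_lt_trans _ _ (\int[mu]_x (\sum_(j <oo) u j x)%E)%E).
  apply: ge0_le_integral; first exact: measurableT.
  - by move=> x _; rewrite lee_fin wgt_ge0.
  - apply/measurable_EFinP/measurable_continuous => x.
    by have := @continuous_wgt s 1 0 x; under eq_fun do rewrite scale1r addr0.
  - exact: measurable_nneseries.
  - by move=> x _; exact: wgt_dyadic.
rewrite integral_nneseries//.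
(* The cube of index [j] has volume [4^d 2^(d j)] with [d = n.+1], so [a] is the ratio of the
   series; it is below 1 because [s] exceeds the dimension. *)
pose a : R := 2 `^ (n.+1%:R - s).
have a0 : 0 <= a by exact: powR_ge0.
have a1 : a < 1.
  rewrite /a -opprB powRN invf_lt1 ?powR_gt0//.
  have : 1 `^ (s - n.+1%:R) < 2 `^ (s - n.+1%:R) :> R.
    by apply: gt0_ltr_powR; rewrite ?subr_gt0 ?nnegrE// ltr1n.
  by rewrite powR1.
have uE j : (\int[mu]_x u j x = (4 ^+ n.+1 * a ^+ j)%:E)%E.
  rewrite /u; under eq_integral do rewrite EFinM.
  rewrite ge0_integralZl//; last by apply/measurable_EFinP; exact: measurable_indic.
  rewrite integral_indic// setIT lebV_box -EFinM /boxvol; congr EFin.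
  have -> : \prod_(i < n.+1) Num.max (rcoord (const_mx (2 ^+ j.+1)) i -
      rcoord (const_mx (- 2 ^+ j.+1) : 'rV[R]_n.+1) i) 0 = 4 ^+ n.+1 * (2 ^+ n.+1) ^+ j :> R.
    have E (i : 'I_n.+1) : Num.max (rcoord (const_mx (2 ^+ j.+1) : 'rV[R]_n.+1) i -
      rcoord (const_mx (- 2 ^+ j.+1) : 'rV[R]_n.+1) i) 0 = 4 * 2 ^+ j.
      rewrite /rcoord !mxE opprK max_l ?addr_ge0 ?exprn_ge0// exprS; ring.
    by under eq_bigr do rewrite E; rewrite prodr_const card_ord exprMn exprAC.
  rewrite /a powRD ?pnatr_eq0 ?implybT// powR_mulrn// [in RHS]exprMn; ring.
rewrite (eq_eseriesr (fun j _ => uE j)).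
apply: le_lt_trans (ltry _); apply: lee_geometric_eseries => //.
by rewrite powR_gt0.
Qed.

End weights.

(** * Smooth cutoffs *)

Section flat.
Context {R : realType}.

Definition flat (k : nat) (s : R) : R := if 0 < s then s^-1 ^+ k * expR (- s^-1) else 0.

Lemma flat_ge0 k s : 0 <= flat k s.
Proof.
rewrite /flat; case: ifP => // s0.
by rewrite mulr_ge0 ?expR_ge0// exprn_ge0// invr_ge0 ltW.
Qed.

Lemma flat_le0 k s : s <= 0 -> flat k s = 0.
Proof. by move=> s0; rewrite /flat ltNge s0. Qed.

(** Comes from [e^u >= (u / (k + 1))^(k + 1)] at [u = 1 / s]. It makes every [flat k] tend to 0 at
    0, whatever power of [1 / s] it carries. *)
Lemma flat_le k s : flat k s <= k.+1%:R ^+ k.+1 * `|s|.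
Proof.
rewrite /flat; case: ifPn => [s0|_]; last by rewrite mulr_ge0// exprn_ge0.
rewrite gtr0_norm// -[leRHS]mulrC -ler_pdivrMl// mulrA -exprS expRN.
rewrite ler_pdivrMr ?expR_gt0//.
have -> : s^-1 = k.+1%:R * (s^-1 / k.+1%:R) by rewrite mulrCA mulfV ?mulr1 ?pnatr_eq0.
rewrite expRM_natl exprMn ler_pM2l ?exprn_gt0//; apply: lerXn2r.
- by rewrite nnegrE divr_ge0// invr_ge0 ltW.
- by rewrite nnegrE expR_ge0.
by apply: le_trans (expR_ge1Dx _); rewrite lerDr.
Qed.

Lemma is_derive_flat k (s : R) :
  is_derive s (1 : R) (flat k) (- k%:R * flat k.+1 s + flat k.+2 s).
Proof.
have [s0|s0|<-] := ltgtP 0 s.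
- apply: (@near_eq_is_derive R R R (fun s : R => s^-1 ^+ k * expR (- s^-1)) (flat k)).
    by near=> z; rewrite /flat ifT//; near: z; exact: lt_nbhsr.
  have sn : s != 0 by rewrite gt_eqF.
  have d1 : is_derive s 1 (fun s : R => s^-1) (- s ^- 2) by have := is_deriveV sn (is_derive_id s 1); rewrite scaler1.
  have dk : is_derive s (1 : R) (fun s : R => s^-1 ^+ k) (- k%:R * s^-1 ^+ k.+1).
    elim: k => [|k IH].
      under eq_fun do rewrite expr0; rewrite oppr0 mul0r; exact: is_derive_cst.
    under eq_fun do rewrite exprS.
    have dm : is_derive s (1 : R) (fun s : R => s^-1 * s^-1 ^+ k) _ := is_deriveM d1 IH.
    apply: (is_derive_eq dm).
    rewrite -![_ *: _]/(_ * _) /= -exprVn -[k.+1%:R]natr1 !exprS; ring.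
  have de : is_derive s (1 : R) (fun s : R => expR (- s^-1)) (expR (- s^-1) * s^-1 ^+ 2).
    rewrite exprVn -[s ^- 2]opprK; apply: is_derive1_comp.
  have dm : is_derive s (1 : R) (fun s : R => s^-1 ^+ k * expR (- s^-1)) _ := is_deriveM dk de.
  apply: (is_derive_eq dm).
  by rewrite /flat s0 -![_ *: _]/(_ * _) /= !exprS; ring.
- rewrite !flat_le0 ?ltW// mulr0 addr0.
  apply: (@near_eq_is_derive R R R (fun=> 0) (flat k)).
    by near=> z; rewrite flat_le0//; apply: ltW; near: z; exact: lt_nbhsl.
rewrite !flat_le0// mulr0 addr0.
have c0 : h^-1 *: (flat k (h + 0) - flat k 0) @[h --> 0^'] --> (0 : R).
  apply/cvgr0Pnorm_lt => e e0.
  have C0 : 0 < k.+2%:R ^+ k.+2 :> R by rewrite exprn_gt0.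
  near=> h; rewrite addr0 (flat_le0 k (lexx 0)) subr0.
  (* At 0 the difference quotient of [flat k] is [flat k.+1], so the derivative there is a limit
     that [flat_le] shows to be 0. *)
  have -> : h^-1 *: flat k h = flat k.+1 h.
    rewrite /flat; case: ifPn => [h0|_]; last exact: scaler0.
    by rewrite exprS -mulrA.
  rewrite ger0_norm ?flat_ge0//; apply: le_lt_trans (flat_le _ _) _.
  rewrite -ltr_pdivlMl//; near: h; apply: dnbhs0_lt.
  by rewrite mulr_gt0// invr_gt0.
apply: DeriveDef.
  by apply/cvg_ex; exists 0; under eq_fun do rewrite [_ *: 1]mulr1.
by apply/cvg_lim => //; under eq_fun do rewrite [_ *: 1]mulr1.
Unshelve. all: by end_near. Qed.

End flat.

Section smooth1.
Context {R : realType}.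

(* Closed under differentiation because [(flat k)' = - k flat (k+1) + flat (k+2)]. *)
Inductive smooth1 : (R -> R) -> Prop :=
| Smooth1_flat k : smooth1 (flat k)
| Smooth1_cos : smooth1 cos
| Smooth1_sin : smooth1 sin
| Smooth1_add u v : smooth1 u -> smooth1 v -> smooth1 (fun s => u s + v s)
| Smooth1_scale c u : smooth1 u -> smooth1 (fun s => c * u s).

Lemma smooth1_derive u : smooth1 u ->
  exists2 u', smooth1 u' & forall s : R, is_derive s (1 : R) u (u' s).
Proof.
elim=> {u} [k||| u v _ [u' su du] _ [v' sv dv]|c u _ [u' su du]].
- exists (fun s => (- k%:R) * flat k.+1 s + flat k.+2 s); last exact: is_derive_flat.
  by apply: Smooth1_add; [apply: Smooth1_scale|]; exact: Smooth1_flat.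
- exists (fun s => -1 * sin s); first by apply: Smooth1_scale; exact: Smooth1_sin.
  by move=> s; rewrite mulN1r; exact: is_derive_cos.
- exists cos; first exact: Smooth1_cos.
  exact: is_derive_sin.
- by exists (fun s => u' s + v' s); [exact: Smooth1_add|move=> s; exact: is_deriveD].
- by exists (fun s => c * u' s); [exact: Smooth1_scale|move=> s; exact: is_deriveZ].
Qed.

Lemma smooth1_continuous u : smooth1 u -> continuous u.
Proof.
move=> /smooth1_derive[u' _ du] s; apply: differentiable_continuous.
by apply/derivable1_diffP; have [] := du s.
Qed.

Lemma smooth1_bounded u (B : R) : smooth1 u -> exists C : R, forall s : R, `|s| <= B -> `|u s| <= C.
Proof.
move=> su; have [B0|B0] := leP 0 B; last first.
  by exists 0 => s sB; have := le_lt_trans (le_trans (normr_ge0 s) sB) B0; rewrite ltxx.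
have cu : {within `[- B, B], continuous (fun s => `|u s|)}.
  apply: continuous_subspaceT => s; apply: cvg_norm.
  exact: smooth1_continuous.
have [c _ h] := EVT_max (ge0_cp B0).2 cu.
exists `|u c| => s sB; apply: h; rewrite in_itv/=.
by rewrite -ler_norml.
Qed.

End smooth1.

Section alg.
Context {R : realType} {n : nat}.
Local Notation W := 'rV[R]_n.+1.

(* Sequences of smooth functions whose derivatives are bounded on bounded sets uniformly in the index. *)
Inductive Alg : (nat -> W -> R) -> Prop :=
| Alg_cst (c : nat -> R) M : (forall k, `|c k| <= M) -> Alg (fun k _ => c k)
| Alg_coord i : Alg (fun _ x => rcoord x i)
| Alg_add F G : Alg F -> Alg G -> Alg (fun k x => F k x + G k x)
| Alg_mul F G : Alg F -> Alg G -> Alg (fun k x => F k x * G k x)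
| Alg_comp u F : smooth1 u -> Alg F -> Alg (fun k x => u (F k x)).

Lemma Alg_const (c : R) : Alg (fun _ _ => c).
Proof. exact: (@Alg_cst (fun=> c) `|c|). Qed.

Lemma Alg_sum (I : Type) (r : seq I) (F : I -> nat -> W -> R) :
  (forall i, Alg (F i)) -> Alg (fun k x => \sum_(i <- r) F i k x).
Proof.
move=> AF; elim: r => [|i r IH].
  by under eq_fun do under eq_fun do rewrite big_nil; exact: Alg_const.
by under eq_fun do under eq_fun do rewrite big_cons; exact: Alg_add.
Qed.

Lemma Alg_scale (a : R) F : Alg F -> Alg (fun k x => F k (a *: x)).
Proof.
elim=> {F} [c M cM|i|F G _ IF _ IG|F G _ IF _ IG|u F su _ IF].
- exact: Alg_cst cM.
- under eq_fun do under eq_fun do rewrite /rcoord mxE.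
  by apply: Alg_mul; [exact: Alg_const|exact: Alg_coord].
- exact: (Alg_add IF IG).
- exact: (Alg_mul IF IG).
- exact: (Alg_comp su IF).
Qed.

Lemma Alg_differentiable F : Alg F -> forall k x, differentiable (F k) x.
Proof.
elim=> {F} [c M cM|i|F G _ IF _ IG|F G _ IF _ IG|u F su _ IF] k x.
- exact: differentiable_cst.
- exact: differentiable_coord.
- exact: differentiableD.
- exact: differentiableM.
- apply: (differentiable_comp (g := u)); first exact: IF.
  have [u' _ du] := smooth1_derive su.
  by apply/derivable1_diffP; have [] := du (F k x).
Qed.

Lemma Alg_derive F (v : W) : Alg F ->
  exists2 F', Alg F' & forall k x, is_derive x v (F k) (F' k x).
Proof.
elim=> {F} [c M cM|i|F G AF [F' AF' dF] AG [G' AG' dG]|F G AF [F' AF' dF] AG [G' AG' dG]|u F su AF [F' AF' dF]].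
- exists (fun _ _ => 0); first exact: Alg_const.
  by move=> k x; exact: is_derive_cst.
- exists (fun _ _ => rcoord v i); first exact: Alg_const.
  move=> k x; apply: DeriveDef.
    by apply: diff_derivable; exact: differentiable_coord.
  apply: lim_near_cst => //; near=> h.
  have h0 : h != 0 by near: h; exact: nbhs_dnbhs_neq.
  by rewrite /rcoord /= !mxE addrK -[_ *: _]/(_ * _) mulrA mulVf ?mul1r.
- exists (fun k x => F' k x + G' k x); first exact: Alg_add.
  by move=> k x; exact: is_deriveD.
- exists (fun k x => F k x * G' k x + G k x * F' k x).
    by apply: Alg_add; exact: Alg_mul.
  by move=> k x; exact: is_deriveM.
- have [u' su' du] := smooth1_derive su.
  exists (fun k x => F' k x * u' (F k x)).
    by apply: Alg_mul => //; exact: Alg_comp.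
  move=> k x.
  have dFx := Alg_differentiable AF k x.
  have dux : differentiable u (F k x) by apply/derivable1_diffP; have [] := du (F k x).
  have dc : differentiable (u \o F k) x by exact: differentiable_comp.
  apply: DeriveDef; first exact: diff_derivable.
  rewrite deriveE// diff_comp//=.
  have -> : 'd (F k) x v = F' k x by rewrite -deriveE//; exact: derive_val.
  rewrite -[F' k x in LHS]mulr1 -[F' k x * 1]/(F' k x *: (1 : R)) linearZ/=.
  by congr (_ * _); rewrite -deriveE//; exact: derive_val.
Unshelve. all: by end_near. Qed.

Lemma Alg_bounded F (B : R) : Alg F -> exists C : R, forall k x, (forall i, `|rcoord x i| <= B) -> `|F k x| <= C.
Proof.
elim=> {F} [c M cM|i|F G _ [C1 h1] _ [C2 h2]|F G _ [C1 h1] _ [C2 h2]|u F su _ [C1 h1]].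
- by exists M.
- by exists B => k x; exact.
- by exists (C1 + C2) => k x xB; apply: le_trans (ler_normD _ _) _; apply: lerD; [exact: h1|exact: h2].
- by exists (C1 * C2) => k x xB; rewrite normrM; apply: ler_pM => //; [exact: h1|exact: h2].
- by have [C h] := smooth1_bounded C1 su; exists C => k x xB; apply: h; exact: h1.
Qed.

Lemma Alg_smooth F k : Alg F -> smooth (F k).
Proof.
move=> AF vs x.
suff [G AG ->] : exists2 G, Alg G & iterDer vs (F k) = G k by exact: Alg_differentiable.
elim: vs => [|v vs [G AG /= ->]]; first by exists F.
have [G' AG' dG] := Alg_derive v AG; exists G' => //.
by apply/funext => y; have [] := dG k y.
Qed.

Lemma Alg_continuous F k : Alg F -> continuous (F k).
Proof. by move=> AF x; apply: differentiable_continuous; exact: Alg_differentiable. Qed.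

End alg.

Section cutoff.
Context {R : realType}.

(** For [s > 0] the inner term [expR 1 * flat 0 s] is [e^(1 - 1 / s)], which reaches 1 at [s = 1];
    hence the value 1 for [s <= 0] and 0 for [s >= 1]. A composition replaces the usual quotient of
    flat functions because [Alg] has no rule for division. *)
Definition cutoff (s : R) : R := expR 1 * flat 0 (1 - expR 1 * flat 0 s).

Lemma cutoff_ge0 s : 0 <= cutoff s.
Proof. by rewrite mulr_ge0 ?expR_ge0 ?flat_ge0. Qed.

Lemma cutoff1 s : s <= 0 -> cutoff s = 1.
Proof.
move=> s0; rewrite /cutoff (flat_le0 0 s0) mulr0 subr0 /flat ltr01 expr0 mul1r invr1.
by rewrite -expRD subrr expR0.
Qed.

Lemma cutoff0 s : 1 <= s -> cutoff s = 0.
Proof.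
move=> s1; rewrite /cutoff flat_le0 ?mulr0// subr_le0 /flat (lt_le_trans ltr01 s1).
rewrite expr0 mul1r -expRD -[leLHS]expR0 ler_expR subr_ge0 invf_le1//.
exact: lt_le_trans s1.
Qed.

Lemma Alg_cutoff {n : nat} (F : nat -> 'rV[R]_n.+1 -> R) :
  Alg F -> Alg (fun k x => cutoff (F k x)).
Proof.
move=> AF; apply: Alg_mul; first exact: Alg_const.
apply: (Alg_comp (Smooth1_flat 0)); apply: Alg_add; first exact: Alg_const.
under eq_fun do under eq_fun do rewrite -mulNr.
apply: Alg_mul; first exact: Alg_const.
exact: (Alg_comp (Smooth1_flat 0)).
Qed.

End cutoff.

(** * Decay of Fourier transforms of cutoffs *)

Section trig_transform.
Context {R : realType} {n : nat}.
Local Notation W := 'rV[R]_n.+1.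
Local Notation V := (vec R n).
Local Notation mu := (@lebV R n).
Implicit Types (x y xi h : W) (G : W -> R) (c : R -> R).

Lemma integrableP_bound (g : W -> R) (b : W -> R) :
  measurable_fun [set: V] g -> (forall x, `|g x| <= b x) ->
  mu.-integrable setT (EFin \o b : V -> \bar R) -> mu.-integrable setT (EFin \o g : V -> \bar R).
Proof.
move=> mg gb; apply: (le_integrable measurableT); first exact/measurable_EFinP.
by move=> x _ /=; rewrite lee_fin (le_trans (gb x))// ler_norm.
Qed.

Definition istrig c := c = cos \/ c = sin.

Lemma istrig_continuous c : istrig c -> continuous c.
Proof. by case=> ->; [exact: continuous_cos|exact: continuous_sin]. Qed.

Lemma istrig_le1 c s : istrig c -> `|c s| <= 1.
Proof. by case=> ->; rewrite ler_norml ?cos_geN1 ?cos_le1 ?sin_geN1 ?sin_le1. Qed.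

Lemma istrig_pi c s : istrig c -> c (s + pi) = - c s.
Proof. by case=> ->; [exact: cosDpi|exact: sinDpi]. Qed.

Lemma istrig_derive c : istrig c -> exists2 c' : R -> R, (forall s : R, `|c' s| <= 1) & forall s : R, is_derive s (1 : R) c (c' s).
Proof.
case=> ->.
  exists (fun s => - sin s); last by move=> t; exact: is_derive_cos.
  by move=> t; rewrite normrN istrig_le1//; right.
exists cos; last by move=> t; exact: is_derive_sin.
by move=> t; rewrite istrig_le1//; left.
Qed.

Lemma istrig_lip c s t : istrig c -> `|c s - c t| <= `|s - t|.
Proof.
move=> tc; wlog st : s t / t <= s.
  by move=> h; case: (leP t s) => [/h//|/ltW/h]; rewrite distrC [leRHS]distrC.
have [c' c'1 dc] := istrig_derive tc.
have [z _ ->] := @MVT_segment R c c' t s st (fun z _ => dc z)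
  (continuous_subspaceT (istrig_continuous tc)).
by rewrite normrM ler_piMl.
Qed.

Lemma dotpDr x y h : dotp x (y + h) = dotp x y + dotp x h.
Proof. by rewrite /dotp -big_split; apply: eq_bigr => i _; rewrite /rcoord mxE mulrDr. Qed.

Lemma dotpC x y : dotp x y = dotp y x.
Proof. by apply: eq_bigr => i _; rewrite mulrC. Qed.

Lemma dotpZr (a : R) x y : dotp x (a *: y) = a * dotp x y.
Proof. by rewrite /dotp mulr_sumr; apply: eq_bigr => i _; rewrite /rcoord mxE mulrCA. Qed.

Lemma dotpBl x y h : dotp (x - y) h = dotp x h - dotp y h.
Proof. by rewrite dotpC dotpDr -[- y]scaleN1r dotpZr mulN1r !(dotpC h). Qed.

Lemma normr_dotp_le x y : `|dotp x y| <= enorm x * enorm y.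
Proof.
rewrite ler_norml dotp_le andbT lerNl.
by rewrite -mulN1r -dotpZr scaleN1r (le_trans (dotp_le _ _))// enormN.
Qed.

Lemma continuous_dotp y : continuous (dotp y).
Proof.
apply: continuous_sumr => i; apply: continuous_mul; first exact: continuous_cst.
exact: continuous_rcoord.
Qed.

Record nice (M C : R) (G : W -> R) : Prop := Nice {
  nice_M : 0 <= M;
  nice_continuous : continuous G;
  nice_supp : forall xi i, M < `|rcoord xi i| -> G xi = 0;
  nice_le : forall xi, `|G xi| <= C }.

Definition cube (M : R) : set W := box (const_mx (- M)) (const_mx M).

Lemma measurable_cube M : measurable (cube M : set V).
Proof. exact: measurable_box. Qed.

Lemma lebV_cube M : 0 <= M -> (mu : {measure set V -> \bar R}) (cube M) = ((2 * M) ^+ n.+1)%:E.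
Proof.
move=> M0; rewrite lebV_box /boxvol; congr EFin.
under eq_bigr do rewrite /rcoord !mxE opprK max_l ?addr_ge0//.
by rewrite prodr_const card_ord mulrDl mul1r.
Qed.

Lemma integrable_cube M a : 0 <= M -> mu.-integrable setT (fun x : V => (a * \1_(cube M) x)%:E).
Proof.
move=> M0.
have : mu.-integrable setT (fun x : V => (\1_(cube M) x)%:E).
  apply/integrableP; split.
    by apply/measurable_EFinP/measurable_indic/measurable_cube.
  under eq_integral do rewrite /= ger0_norm//.
  by rewrite integral_indic ?setIT ?lebV_cube ?ltry//; exact: measurable_cube.
by move=> /(integrableZl measurableT a); apply: eq_integrable => // x _ ; rewrite EFinM.
Qed.

Lemma integral_cube M a : 0 <= M -> \int[mu]_(x in setT) (a * \1_(cube M) x) = a * (2 * M) ^+ n.+1.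
Proof.
move=> M0; rewrite RintegralZl//; last first.
  have := integrable_cube 1 M0; apply: eq_integrable => // x _.
  by rewrite mul1r.
rewrite /Rintegral integral_indic//; last exact: measurable_cube.
by rewrite setIT lebV_cube.
Qed.

(** For real [G], [KT cos G] and [- KT sin G] are the real and imaginary parts of the Fourier
    transform of [G]; the parameter [c] lets one estimate serve both. *)
Definition KT c G y : R := \int[mu]_xi (G xi * c (2 * pi * dotp y xi)).

Lemma KT_continuous_arg c G y : continuous G -> istrig c ->
  continuous (fun xi => G xi * c (2 * pi * dotp y xi)).
Proof.
move=> cG tc; apply: continuous_mul => //.
apply: (@continuous_o _ _ _ c (fun xi : W => 2 * pi * dotp y xi)).
  by apply: continuous_mul; [exact: continuous_cst|exact: continuous_dotp].
by move=> x; exact: istrig_continuous.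
Qed.

(** The margin 1 is there because [cube] is half open while the support may touch its faces. *)
Lemma nice_le_cube M C G c y xi : nice M C G -> istrig c ->
  `|G xi * c (2 * pi * dotp y xi)| <= C * \1_(cube (M + 1)) xi.
Proof.
move=> [M0 cG sG GC] tc.
have C0 : 0 <= C := le_trans (normr_ge0 _) (GC 0).
have [xM|] := pselect (forall i, `|rcoord xi i| <= M).
  rewrite indicE mem_set ?mulr1; last first.
    move=> i; have := xM i; rewrite ler_norml => /andP[h1 h2].
    by apply/andP; split; rewrite [rcoord (const_mx _) _]mxE; lra.
  rewrite normrM -[leRHS]mulr1; apply: ler_pM => //.
  exact: istrig_le1.
by move=> /existsNP[i /negP]; rewrite -ltNge => /sG ->; rewrite mul0r normr0 mulr_ge0.
Qed.

Lemma nice_integrable M C G c y : nice M C G -> istrig c ->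
  mu.-integrable setT (fun xi : V => (G xi * c (2 * pi * dotp y xi))%:E).
Proof.
move=> nG tc; apply: (@integrableP_bound _ (fun xi => C * \1_(cube (M + 1)) xi)).
- by apply: measurable_continuous; apply: KT_continuous_arg => //; exact: nice_continuous nG.
- by move=> x; exact: nice_le_cube nG _.
- by apply: integrable_cube; rewrite addr_ge0 ?(nice_M nG).
Qed.

Lemma KT_le M C G c y : nice M C G -> istrig c -> `|KT c G y| <= C * (2 * (M + 1)) ^+ n.+1.
Proof.
move=> nG tc; have M1 : 0 <= M + 1 by rewrite addr_ge0 ?(nice_M nG).
have iG := nice_integrable y nG tc.
rewrite -integral_cube//; apply: le_trans (le_normr_Rintegral _ iG) _ => //.
apply: le_Rintegral => //.
- exact: integrable_norm iG.
- exact: integrable_cube.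
- by move=> x _; exact: nice_le_cube nG _.
Qed.

Lemma KT_lip M C G c y y' : nice M C G -> istrig c ->
  `|KT c G y - KT c G y'| <= C * (2 * (M + 1)) ^+ n.+1 * (2 * pi * enorm (y - y') * (n.+1%:R * M)).
Proof.
move=> nG tc; have M1 : 0 <= M + 1 by rewrite addr_ge0 ?(nice_M nG).
have iG := nice_integrable y nG tc; have iG' := nice_integrable y' nG tc.
rewrite /KT -RintegralB//.
have iB : mu.-integrable setT
    (fun x : V => (G x * c (2 * pi * dotp y x) - G x * c (2 * pi * dotp y' x))%:E).
  by apply: eq_integrable (integrableB measurableT iG iG') => // x _; rewrite EFinB.
apply: le_trans (le_normr_Rintegral measurableT iB) _.
set a := 2 * pi * _ * _.
rewrite mulrAC -integral_cube//; apply: le_Rintegral => //.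
- exact: integrable_norm iB.
- exact: integrable_cube.
move=> x _; rewrite -mulrBr.
have [M0 cG sG GC] := nG.
have C0 : 0 <= C := le_trans (normr_ge0 _) (GC 0).
have a0 : 0 <= a by rewrite !mulr_ge0 ?pi_ge0 ?enorm_ge0.
have [xM|] := pselect (forall i, `|rcoord x i| <= M).
  rewrite indicE mem_set ?mulr1; last first.
    move=> i; have := xM i; rewrite ler_norml => /andP[h1 h2].
    by apply/andP; split; rewrite [rcoord (const_mx _) _]mxE; lra.
  rewrite normrM; apply: ler_pM => //.
  apply: le_trans (istrig_lip _ _ tc) _.
  rewrite -mulrBr -dotpBl normrM ger0_norm ?mulr_ge0 ?pi_ge0// /a -mulrA.
  apply: ler_wpM2l; first by rewrite mulr_ge0 ?pi_ge0.
  apply: le_trans (normr_dotp_le _ _) _; apply: ler_wpM2l; first exact: enorm_ge0.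
  exact: enorm_le_coord.
by move=> /existsNP[i /negP]; rewrite -ltNge => /sG ->; rewrite mul0r normr0; apply: mulr_ge0 => //; exact: mulr_ge0.
Qed.

Lemma KT_continuous M C G c : nice M C G -> istrig c -> continuous (KT c G).
Proof.
move=> nG tc; apply: continuous_le_dist (fun y y' => KT_lip y y' nG tc) _ => y.
have cL : continuous (fun y' => C * (2 * (M + 1)) ^+ n.+1 * (2 * pi * enorm ((-1) *: y' + y) * (n.+1%:R * M))).
  apply: continuous_mul; first exact: continuous_cst.
  apply: continuous_mul; last exact: continuous_cst.
  apply: continuous_mul; first exact: continuous_cst.
  exact: continuous_enorm_affine.
have := cL y; rewrite /continuous_at [X in _ --> X -> _](_ : _ = 0); last first.
  by rewrite scaleN1r addNr -(scale0r 0) enormZ// mul0r mulr0 mul0r mulr0.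
by under eq_fun do rewrite scaleN1r [- _ + y]addrC.
Qed.

Definition Dl h G xi := G (xi + h) - G xi.

Lemma nice_Dl M C G h : nice M C G -> (forall i, `|rcoord h i| <= 1) -> nice (M + 1) (C + C) (Dl h G).
Proof.
move=> [M0 cG sG GC] h1; split.
- exact: addr_ge0.
- apply: continuous_add; last exact: continuous_opp.
  move=> x; apply: (@continuous_comp _ _ _ (fun x : W => x + h) G); last exact: cG.
  by have := @continuous_affine R W 1 h x; under eq_fun do rewrite scale1r.
- move=> xi i xiM; rewrite /Dl (sG xi i) ?(sG (xi + h) i) ?subrr//; last first.
    by apply: le_lt_trans xiM; rewrite lerDl.
  have := h1 i; have : `|rcoord xi i| <= `|rcoord (xi + h) i| + `|rcoord h i|.
    by rewrite -[X in `|X| <= _](addrK (rcoord h i)) {1}/rcoord; apply: le_trans (ler_normB _ _) _; rewrite /rcoord mxE.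
  lra.
- by move=> xi; apply: le_trans (ler_normB _ _) _; exact: lerD.
Qed.

(* Moving [xi] by [e_i / (2 y_i)] moves the phase [2 pi y.xi] by [pi], which changes the sign of [c]. *)
Lemma KT_Dl M C G c y i : nice M C G -> istrig c -> rcoord y i != 0 ->
  KT c (Dl ((2 * rcoord y i)^-1 *: delta_mx 0 i) G) y = - 2 * KT c G y.
Proof.
move=> nG tc y0; set h := _ *: _.
have iG := nice_integrable y nG tc.
have yh : 2 * pi * dotp y h = pi.
  rewrite /h dotpZr /dotp (bigD1 i)//= big1 ?addr0.
    by rewrite /rcoord mxE !eqxx mulr1; field.
  by move=> j /negbTE ji; rewrite /rcoord mxE eqxx ji mulr0.
have := Rintegral_affine h ltr01 iG; rewrite invr1 expr1n mul1r => E.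
have E' : \int[mu]_xi (- (G (xi + h) * c (2 * pi * dotp y xi))) = KT c G y.
  rewrite /KT -E; apply: eq_Rintegral => xi _.
  rewrite (_ : 2 * pi * dotp y (1 *: xi + h) = 2 * pi * dotp y xi + pi).
    by rewrite scale1r istrig_pi// mulrN.
  by rewrite scale1r dotpDr mulrDr yh.
have i1 : mu.-integrable setT (fun xi : V => (- (G (xi + h) * c (2 * pi * dotp y xi)))%:E).
  apply: eq_integrable (integrable_affine h ltr01 iG) => // xi _.
  rewrite (_ : 2 * pi * dotp y (1 *: xi + h) = 2 * pi * dotp y xi + pi).
    by rewrite scale1r istrig_pi// mulrN.
  by rewrite scale1r dotpDr mulrDr yh.
have -> : KT c (Dl h G) y = \int[mu]_xi (- 1 * (- (G (xi + h) * c (2 * pi * dotp y xi)) +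
    G xi * c (2 * pi * dotp y xi))).
  by apply: eq_Rintegral => xi _; rewrite /Dl; ring.
rewrite RintegralZl//; last first.
  by apply: eq_integrable (integrableD measurableT i1 iG) => // x _; rewrite EFinD.
rewrite RintegralD// E' -/(KT c G y); ring.
Qed.

Lemma is_derive_shift (H : W -> R) h x v l :
  is_derive (x + h) v H l -> is_derive x v (fun z => H (z + h)) l.
Proof.
have E : (fun t : R => t^-1 *: (((fun z => H (z + h)) \o shift x) (t *: v) - H (x + h))) =
   (fun t : R => t^-1 *: ((H \o shift (x + h)) (t *: v) - H (x + h))).
  by apply/funext => t /=; rewrite addrA.
move=> [dH <-]; apply: DeriveDef; first by rewrite /derivable E.
by rewrite /derive E.
Qed.

Lemma is_derive_line (H : W -> R) xi v (t : R) l :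
  is_derive (xi + t *: v) v H l -> is_derive t (1 : R) (fun t : R => H (xi + t *: v)) l.
Proof.
have E : (fun a : R => a^-1 *: (((fun t : R => H (xi + t *: v)) \o shift t) (a *: (1 : R)) - H (xi + t *: v))) =
   (fun a : R => a^-1 *: ((H \o shift (xi + t *: v)) (a *: v) - H (xi + t *: v))).
  by apply/funext => a /=; rewrite [a *: 1]mulr1 scalerDl addrCA.
move=> [dH <-]; apply: DeriveDef; first by rewrite /derivable E.
by rewrite /derive E.
Qed.

Lemma is_derive_Dl h (F F' : W -> R) v N : (forall x, is_derive x v F (F' x)) ->
  forall x, is_derive x v (iter N (Dl h) F) (iter N (Dl h) F' x).
Proof.
move=> dF; elim: N => [//|N IH] x /=.
by apply: is_deriveB; exact: (is_derive_shift (IH (x + h))).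
Qed.

Lemma diff_le_derive (g g' : R -> R) (s K : R) : (forall t : R, is_derive t (1 : R) g (g' t)) ->
  (forall t, `|t| <= `|s| -> `|g' t| <= K) -> `|g s - g 0| <= K * `|s|.
Proof.
move=> dg gK.
have cg : continuous g.
  by move=> t; apply: differentiable_continuous; apply/derivable1_diffP; have [] := dg t.
have [s0|/ltW s0] := leP 0 s.
  have [z zs ->] := @MVT_segment R g g' 0 s s0 (fun t _ => dg t) (continuous_subspaceT cg).
  rewrite normrM subr0; apply: ler_wpM2r => //; apply: gK.
  by move: zs; rewrite in_itv/= => /andP[z0 zs]; rewrite !ger0_norm.
have [z zs E] := @MVT_segment R g g' s 0 s0 (fun t _ => dg t) (continuous_subspaceT cg).
rewrite distrC E normrM sub0r normrN; apply: ler_wpM2r => //; apply: gK.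
by move: zs; rewrite in_itv/= => /andP[z0 zs]; rewrite !ler0_norm// lerN2.
Qed.

(** By the mean value theorem each difference costs one derivative along the step and gains a factor
    [|s|]. The derivatives form a sequence of [Alg] again, whence a constant uniform in [k]; the
    cube grows by 1 each time since [|s| <= 1]. *)
Lemma Dl_bound i N (F : nat -> W -> R) (B : R) : Alg F ->
  exists2 C : R, 0 <= C & forall k s xi, `|s| <= 1 -> (forall j, `|rcoord xi j| <= B) ->
    `|iter N (Dl (s *: delta_mx 0 i)) (F k) xi| <= C * `|s| ^+ N.
Proof.
elim: N F B => [|N IH] F B AF.
  have [C hC] := Alg_bounded B AF; exists `|C| => // k s xi _ xiB.
  by rewrite expr0 mulr1 (le_trans (hC k xi xiB))// ler_norm.
have [F' AF' dF] := Alg_derive (delta_mx 0 i) AF.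
have [C C0 hC] := IH F' (B + 1) AF'; exists C => // k s xi s1 xiB.
set v : W := delta_mx 0 i; set h := s *: v.
pose H := iter N (Dl h) (F k); pose H' := iter N (Dl h) (F' k).
have dH (t : R) : is_derive t (1 : R) (fun t : R => H (xi + t *: v)) (H' (xi + t *: v)).
  by apply: is_derive_line; apply: is_derive_Dl => x; exact: dF.
have -> : iter N.+1 (Dl h) (F k) xi = H (xi + s *: v) - H (xi + 0 *: v).
  by rewrite scale0r addr0.
rewrite exprSr mulrA.
apply: (@diff_le_derive (fun t => H (xi + t *: v)) (fun t => H' (xi + t *: v)) s _ dH) => t ts.
apply: hC => // j; rewrite /rcoord !mxE.
apply: le_trans (ler_normD _ _) _; apply: lerD; first exact: xiB.
rewrite normrM; apply: le_trans (le_trans ts s1).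
by rewrite ler_piMr// eqxx/=; case: (_ == _); rewrite ?normr1 ?normr0.
Qed.

Lemma nice_iter N M C G h : nice M C G -> (forall i, `|rcoord h i| <= 1) ->
  exists C', nice (M + N%:R) C' (iter N (Dl h) G).
Proof.
move=> nG h1; elim: N => [|N [C' IH]]; first by exists C; rewrite addr0.
by exists (C' + C'); rewrite -natr1 addrA; exact: nice_Dl.
Qed.

Lemma normr_inv2_le1 (r : R) : 2^-1 <= `|r| -> `|(2 * r)^-1| <= 1.
Proof.
move=> h; have r0 : 0 < `|r| by apply: lt_le_trans h; rewrite invr_gt0.
by rewrite normfV normrM normr_nat invf_le1 ?mulr_gt0// -ler_pdivrMl// mulr1.
Qed.

Lemma normr_rcoord_delta_le1 (s : R) (i j : 'I_n.+1) : `|s| <= 1 -> `|rcoord (s *: delta_mx 0 i : W) j| <= 1.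
Proof.
move=> s1; rewrite /rcoord !mxE normrM eqxx/=.
by case: (_ == _); rewrite ?normr1 ?normr0 ?mulr1 ?mulr0.
Qed.

Lemma KT_iter N M C c G y i : nice M C G -> istrig c -> 2^-1 <= `|rcoord y i| ->
  KT c (iter N (Dl ((2 * rcoord y i)^-1 *: delta_mx 0 i)) G) y = (- 2) ^+ N * KT c G y.
Proof.
move=> nG tc yi; set h := _ *: _.
have y0 : rcoord y i != 0.
  by apply: contraTneq yi => ->; rewrite normr0 -ltNge invr_gt0.
have h1 j : `|rcoord h j| <= 1.
  by apply: normr_rcoord_delta_le1; exact: normr_inv2_le1.
elim: N => [|N IH]; first by rewrite mul1r.
have [C' nG'] := nice_iter N nG h1.
by rewrite iterS (KT_Dl nG' tc y0) IH mulrA -exprS.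
Qed.

Lemma wgt_nat N y : wgt N%:R y = (1 + enorm y) ^- N.
Proof. by rewrite /wgt powRN powR_mulrn// ltW// wgt_base_gt0. Qed.

(** Differences replace integration by parts. For the largest coordinate [y_i], each difference with
    step [s = 1 / (2 y_i)] multiplies the transform by [- 2], while [N] of them make the integrand
    at most a constant times [|s|^N] on a fixed cube. As [|s|] is at most a constant times
    [1 / |y|], the decay has order [N], uniformly in [k]. *)
Lemma KT_decay (F : nat -> W -> R) M N : Alg F -> 0 <= M ->
  (forall k xi i, M < `|rcoord xi i| -> F k xi = 0) ->
  exists2 C : R, 0 < C & forall k c y, istrig c -> `|KT c (F k) y| <= C * wgt N%:R y.
Proof.
move=> AF M0 FM.
have nF : exists2 C, 0 <= C & forall k, nice M C (F k).
  have [C hC] := Alg_bounded M AF; exists `|C| => // k; split => //.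
  - exact: Alg_continuous.
  - by move=> xi i; exact: FM.
  - move=> xi; have [xM|] := pselect (forall i, `|rcoord xi i| <= M).
      by rewrite (le_trans (hC k xi xM))// ler_norm.
    by move=> /existsNP[i /negP]; rewrite -ltNge => /FM ->; rewrite normr0.
have [C nC0 nC] := nF.
have /choice[D hD] : forall i, exists D : R, 0 <= D /\ forall k s xi, `|s| <= 1 -> (forall j, `|rcoord xi j| <= M + N%:R) ->
    `|iter N (Dl (s *: delta_mx 0 i)) (F k) xi| <= D * `|s| ^+ N.
  by move=> i; have [D D0 hD] := Dl_bound i N (M + N%:R) AF; exists D.
have D0 i := (hD i).1.
pose vol : R := (2 * (M + N%:R + 1)) ^+ n.+1.
have vol0 : 0 <= vol by rewrite exprn_ge0// mulr_ge0// !addr_ge0.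
pose K1 := (\sum_i D i) * vol * (3 + n%:R) ^+ N.
pose K2 := C * (2 * (M + 1)) ^+ n.+1 * (2 + n%:R) ^+ N.
have K10 : 0 <= K1 by rewrite !mulr_ge0 ?sumr_ge0// exprn_ge0// addr_ge0.
have K20 : 0 <= K2 by rewrite !mulr_ge0// exprn_ge0// ?mulr_ge0 ?addr_ge0.
exists (1 + K1 + K2); first by rewrite -addrA ltr_pwDl// addr_ge0.
move=> k c y tc; rewrite wgt_nat ler_pdivlMr ?exprn_gt0 ?wgt_base_gt0//.
suff : `|KT c (F k) y| * (1 + enorm y) ^+ N <= K1 \/ `|KT c (F k) y| * (1 + enorm y) ^+ N <= K2.
  by case=> h; apply: le_trans h _; rewrite -?addrA ?lerDr ?lerDl; lra.
have [i _ ymax] := @Order.TotalTheory.arg_maxP _ _ _ (ord0 : 'I_n.+1) xpredT (fun i => `|rcoord y i|) isT.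
have yle : enorm y <= n.+1%:R * `|rcoord y i| by apply: enorm_le_coord => j; exact: ymax.
(* The threshold [1 / 2] keeps the step at most 1, as [Dl_bound] and [nice_iter] ask. Below it [|y|]
   is bounded and [KT_le] is enough. *)
have [yi|yi] := leP 2^-1 `|rcoord y i|; [left|right]; last first.
  apply: ler_pM => //; first by rewrite exprn_ge0// addr_ge0 ?enorm_ge0.
    exact: KT_le.
  apply: lerXn2r; rewrite ?nnegrE ?addr_ge0 ?enorm_ge0//.
  rewrite -[2]/(1 + 1) -addrA lerD2l (le_trans yle)// -nat1r.
  by rewrite ler_piMr// ltW// (lt_trans yi)// invf_lt1// ltr1n.
set s := (2 * rcoord y i)^-1.
have ri0 : 0 < `|rcoord y i| by apply: lt_le_trans yi; rewrite invr_gt0.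
have s1 : `|s| <= 1 by exact: normr_inv2_le1.
have h1 j := normr_rcoord_delta_le1 i j s1.
have [C' nC'] := nice_iter N (nC k) h1.
have nD : nice (M + N%:R) (D i * `|s| ^+ N) (iter N (Dl (s *: delta_mx 0 i)) (F k)).
  split; [exact: nice_M nC'|exact: nice_continuous nC'|exact: nice_supp nC'|].
  move=> xi; have [xM|] := pselect (forall j, `|rcoord xi j| <= M + N%:R).
    exact: (hD i).2.
  move=> /existsNP[j /negP]; rewrite -ltNge => /(nice_supp nC') ->.
  by rewrite normr0 mulr_ge0// exprn_ge0.
have := KT_le y nD tc; rewrite (KT_iter N (nC k) tc yi) normrM normrX normrN normr_nat -/vol => h.
have -> : `|KT c (F k) y| * (1 + enorm y) ^+ N = (2 ^+ N * `|KT c (F k) y|) * ((1 + enorm y) / 2) ^+ N.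
  by rewrite expr_div_n; field; rewrite expf_neq0.
apply: (@le_trans _ _ (D i * `|s| ^+ N * vol * ((1 + enorm y) / 2) ^+ N)).
  by apply: ler_wpM2r => //; rewrite exprn_ge0// divr_ge0// addr_ge0 ?enorm_ge0.
have -> : D i * `|s| ^+ N * vol * ((1 + enorm y) / 2) ^+ N = D i * vol * (`|s| * ((1 + enorm y) / 2)) ^+ N.
  by rewrite [(`|s| * _) ^+ N]exprMn; ring.
rewrite /K1; apply: ler_pM; rewrite ?mulr_ge0 ?exprn_ge0 ?mulr_ge0 ?invr_ge0 ?addr_ge0 ?enorm_ge0//.
  by apply: ler_wpM2r => //; rewrite (bigD1 i)//= lerDl sumr_ge0.
apply: lerXn2r; rewrite ?nnegrE ?mulr_ge0 ?invr_ge0 ?addr_ge0 ?enorm_ge0//.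
rewrite normfV normrM normr_nat ler_pdivrMl ?mulr_gt0//.
move: yle yi; rewrite -nat1r; set r := `|_|; set e := enorm y => yle yi.
have n0 : 0 <= n%:R :> R by [].
nra.
Qed.

End trig_transform.

(** * Positivity of the total mass of the transform of a cutoff *)

Section lattice_positivity.
Context {R : realType} {n : nat}.
Local Notation W := 'rV[R]_n.+1.
Local Notation V := (vec R n).
Local Notation mu := (@lebV R n).

Lemma Rintegral_dominated (f_ : nat -> W -> R) (f g : W -> R) :
  (forall k, measurable_fun [set: V] (f_ k)) ->
  (forall x, f_ k x @[k --> \oo] --> f x) ->
  mu.-integrable setT (EFin \o g : V -> \bar R) ->
  (forall k x, `|f_ k x| <= g x) ->
  \int[mu]_x (f_ k x) @[k --> \oo] --> \int[mu]_x (f x).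
Proof.
move=> mf_ f_f ig fg.
have mf : measurable_fun [set: V] f.
  by apply: (measurable_fun_cvg mf_) => x _; exact: f_f.
have [] := @dominated_convergence _ V R mu setT measurableT (fun k x => (f_ k x)%:E)
  (fun x => (f x)%:E) (EFin \o g).
- by move=> k; exact/measurable_EFinP.
- exact/measurable_EFinP.
- by apply: aeW => x _; apply/cvg_EFin; [exact: nearW|exact: f_f].
- exact: ig.
- by apply: aeW => x k _; rewrite lee_fin.
move=> if_ _ cv; rewrite /Rintegral.
by apply: fine_cvg; rewrite fineK//; exact: integrable_fin_num if_.
Qed.

Lemma Rintegral_sum (I : Type) (r : seq I) (F : I -> W -> R) :
  (forall i, mu.-integrable setT (EFin \o F i : V -> \bar R)) ->
  mu.-integrable setT (fun x : V => (\sum_(i <- r) F i x)%:E) /\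
  \int[mu]_x (\sum_(i <- r) F i x) = \sum_(i <- r) \int[mu]_x F i x.
Proof.
move=> iF; elim: r => [|i r [IH1 IH2]].
  split; first by under eq_fun do rewrite big_nil; exact: integrable0.
  under eq_Rintegral do rewrite big_nil.
  by rewrite big_nil /Rintegral integral0.
split.
  by apply: eq_integrable (integrableD measurableT (iF i) IH1) => // x _; rewrite /= big_cons EFinD.
under eq_Rintegral do rewrite big_cons.
by rewrite RintegralD// IH2 big_cons.
Qed.

(** Both sides are the real part of [e^(i s)] times the squared modulus of the sum of the
    [e^(i a_j)]. *)
Lemma sum_cos_lattice (T : finType) (a : T -> R) (s : R) :
  \sum_i \sum_j cos (s + a i - a j) =
  cos s * ((\sum_i cos (a i)) ^+ 2 + (\sum_i sin (a i)) ^+ 2).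
Proof.
set A := \sum_i cos _; set B := \sum_i sin _.
have inner i : \sum_j cos (s + a i - a j) =
   cos s * (cos (a i) * A + sin (a i) * B) - sin s * (sin (a i) * A - cos (a i) * B).
  rewrite /A /B !mulr_sumr -big_split -sumrB/= !mulr_sumr -sumrB; apply: eq_bigr => j _.
  by rewrite cosB cosD sinD; ring.
rewrite (eq_bigr _ (fun i _ => inner i)) sumrB -!mulr_sumr sumrB big_split/= -!mulr_suml -/A -/B.
ring.
Qed.

Lemma cos_ge_half (s : R) : `|s| <= 1 -> 2^-1 <= cos s.
Proof.
move=> s1; have -> : s = s / 2 + s / 2 by field.
rewrite cosD.
have h1 := cos2Dsin2 (s / 2).
have : `|sin (s / 2)| <= `|s / 2|.
  have := istrig_lip (s / 2) 0 (or_intror erefl : istrig (@sin R)).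
  by rewrite sin0 !subr0.
move=> h2; have h3 : `|sin (s / 2)| <= 2^-1.
  by apply: le_trans h2 _; rewrite normrM [X in _ * X]ger0_norm// ler_piMl.
have : sin (s / 2) ^+ 2 <= 2^-1 ^+ 2.
  by rewrite -real_normK ?num_real// lerXn2r// nnegrE.
nra.
Qed.

Definition pt N (m : {ffun 'I_n.+1 -> 'I_N}) : W := \row_i (m i)%:R.

Definition unit_cube : set W := box 0 (const_mx 1).

(** A weight of Fejer type: the indicator of the unit cube convolved with the autocorrelation of a
    grid of [N^(n + 1)] lattice points. *)
Definition overlap N (x : W) : R :=
  \sum_(m : {ffun 'I_n.+1 -> 'I_N}) \sum_(m' : {ffun 'I_n.+1 -> 'I_N})
    \1_unit_cube (x - pt m + pt m').

Definition overlap1 N (s : R) : R := \sum_(a < N) \sum_(b < N) \1_`[0, 1[ (s - a%:R + b%:R).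

Lemma overlapE N x : overlap N x = \prod_i overlap1 N (rcoord x i).
Proof.
rewrite /overlap1 bigA_distr_bigA /overlap; apply: eq_bigr => m _.
rewrite bigA_distr_bigA; apply: eq_bigr => m' _.
have [xQ|xQ] := pselect (unit_cube (x - pt m + pt m')).
  rewrite indicE mem_set// big1// => i _; rewrite indicE mem_set//= in_itv/=.
  by have := xQ i; rewrite /rcoord !mxE.
rewrite indicE memNset//=; move: xQ => /existsNP[i xi].
rewrite (bigD1 i)//= indicE memNset ?mul0r// /= in_itv/=.
by move: xi; rewrite /rcoord !mxE.
Qed.

Lemma measurable_indic_shift v : measurable_fun [set: V] (fun x : V => \1_unit_cube (x + v) : R).
Proof.
have mQ : measurable_fun [set: V] (\1_unit_cube : V -> R) by apply: measurable_indic; exact: measurable_box.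
have := measurableT_comp mQ (measurable_affine v ltr01).
by apply: eq_measurable_fun => x _ /=; rewrite scale1r.
Qed.

Lemma measurable_overlap N : measurable_fun [set: V] (overlap N).
Proof.
apply: measurable_sum => m; apply: measurable_sum => m'.
by under eq_fun do rewrite -addrA; exact: measurable_indic_shift.
Qed.

Lemma overlap1_le N s : overlap1 N s <= N%:R.
Proof.
have -> : N%:R = \sum_(a < N) (1 : R) by rewrite sumr_const card_ord.
apply: ler_sum => a _.
have [h|h] := pselect (exists b : 'I_N, 0 <= s - a%:R + b%:R < 1); last first.
  by rewrite big1// => b _; rewrite indicE memNset//= in_itv/= => hb; apply: h; exists b.
move: h => [b hb]; rewrite (bigD1 b)//= big1 ?addr0//.
move=> b' bb'; rewrite indicE memNset//= in_itv/= => hb'.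
have h1 : (b' < b.+1)%N by rewrite -(ltr_nat R) -natr1; move: hb hb' => /andP[? ?] /andP[? ?]; lra.
have h2 : (b < b'.+1)%N by rewrite -(ltr_nat R) -natr1; move: hb hb' => /andP[? ?] /andP[? ?]; lra.
by move: bb' => /negP; apply; apply/eqP/val_inj/eqP; rewrite eqn_leq -ltnS h1 -ltnS h2.
Qed.

Lemma sum_shift_ge N p (F : 'I_N -> 'I_N -> R) : (forall a b, 0 <= F a b) ->
  (forall a b : 'I_N, b = (a + p)%N :> nat -> 1 <= F a b) ->
  N%:R - p%:R <= \sum_a \sum_b F a b.
Proof.
move=> F0 F1; have [Np|pN] := leqP N p.
  apply: (@le_trans _ _ 0); first by rewrite subr_le0 ler_nat.
  by apply: sumr_ge0 => a _; exact: sumr_ge0.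
rewrite -natrB; last exact: ltnW.
rewrite (bigID (fun a : 'I_N => (a < N - p)%N))/= -[leLHS]addr0; apply: lerD; last first.
  by apply: sumr_ge0 => a _; exact: sumr_ge0.
have -> : (N - p)%:R = \sum_(a < N | (a < N - p)%N) (1 : R).
  by rewrite -(big_ord_widen N (fun=> 1 : R) (leq_subr p N)) sumr_const card_ord.
apply: ler_sum => a aN.
have apN : (a + p < N)%N by rewrite addnC -ltn_subRL.
rewrite (bigD1 (Ordinal apN))//= -[leLHS]addr0; apply: lerD; first exact: F1.
exact: sumr_ge0.
Qed.

(** With [p] the absolute value of the floor of [s], every pair on the diagonal at offset [p] (above
    or below, by the sign) counts. At least [N - p] such pairs fit in the grid, and [p <= L + 1]. *)
Lemma overlap1_ge N s (L : nat) : `|s| <= L%:R -> N%:R - L.+1%:R <= overlap1 N s.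
Proof.
move=> sL.
have [p pL ps] : exists2 p : nat, (p <= L.+1)%N & 0 <= s - p%:R < 1 \/ 0 <= s + p%:R < 1.
  have /andP[f1 f2] := floor_itv s.
  move: f1 f2 sL; case: (Num.floor s) => p f1 f2; rewrite ler_norml => /andP[sL1 sL2].
    exists p; last by left; move: f1 f2; rewrite intrD -pmulrn; lra.
    by rewrite -(ler_nat R) -natr1; move: f1; rewrite -pmulrn; lra.
  exists p.+1; last by right; move: f1 f2; rewrite intrD NegzE mulrNz -pmulrn; lra.
  by rewrite ltnS ltnW// -(ltr_nat R); move: f1 f2; rewrite intrD NegzE mulrNz -pmulrn -natr1; lra.
apply: (@le_trans _ _ (N%:R - p%:R)); first by rewrite lerD2l lerN2 ler_nat.
case: ps => /andP[p1 p2]; last first.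
  apply: sum_shift_ge => // a b -> ; rewrite indicE mem_set// /= in_itv/= natrD.
  by apply/andP; split; lra.
rewrite /overlap1 exchange_big/=.
apply: sum_shift_ge => // a b -> ; rewrite indicE mem_set// /= in_itv/= natrD.
by apply/andP; split; lra.
Qed.

Lemma overlap_ge0 N x : 0 <= overlap N x.
Proof. by apply: sumr_ge0 => m _; apply: sumr_ge0. Qed.

Lemma overlap_le N x : overlap N x <= N%:R ^+ n.+1.
Proof.
rewrite overlapE -[X in _ ^+ X](card_ord n.+1) -prodr_const; apply: ler_prod => i _.
by rewrite overlap1_le andbT; apply: sumr_ge0 => a _; apply: sumr_ge0.
Qed.

Lemma overlap_cvg x : overlap N x / N%:R ^+ n.+1 @[N --> \oo] --> (1 : R).
Proof.
have -> : (fun N => overlap N x / N%:R ^+ n.+1) =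
  (fun N => \prod_(i < n.+1) (overlap1 N (rcoord x i) / N%:R)).
  apply/funext => N; rewrite big_split/= prodr_const card_ord overlapE exprVn.
  by [].
rewrite [X in _ --> X](_ : _ = \prod_(i < n.+1) (1 : R)); last by rewrite big1.
apply: cvg_big => [|i _]; first exact: mul_continuous.
have [L sL] : exists L : nat, `|rcoord x i| <= L%:R.
  by exists (Num.trunc `|rcoord x i|).+1; apply: ltW; exact: truncnS_gt.
apply: (@squeeze_cvgr _ _ _ _ (fun N : nat => 1 - L.+1%:R * N%:R^-1) (fun=> 1)).
- near=> N; have N0 : 0 < N%:R :> R by rewrite ltr0n; near: N; exact: nbhs_infty_gt.
  apply/andP; split; last by rewrite ler_pdivrMr// mul1r overlap1_le.
  rewrite ler_pdivlMr// mulrBl mul1r mulfVK ?gt_eqF//.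
  exact: overlap1_ge.
- rewrite [X in _ --> X](_ : _ = 1 - L.+1%:R * 0); last by rewrite mulr0 subr0.
  apply: cvgB; first exact: cvg_cst.
  apply: cvgM; first exact: cvg_cst.
  apply/gtr0_cvgV0; last exact: cvgr_idn.
  by near=> N; rewrite ltr0n; near: N; exact: nbhs_infty_gt.
- exact: cvg_cst.
Unshelve. all: by end_near. Qed.

Lemma pi_le4 : pi <= 4 :> R.
Proof. by have := pihalf_lt2 R; rewrite ltr_pdivrMr// => /ltW; rewrite -natrM. Qed.

Lemma dotp_unit_le (x y : W) (r t : R) : 0 <= r -> 0 <= t ->
  (forall i, `|rcoord x i| <= r) -> (forall i, `|rcoord y i| <= t) ->
  `|dotp x y| <= n.+1%:R * (r * t).
Proof.
move=> r0 t0 xr yt; apply: le_trans (ler_norm_sum _ _ _) _.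
apply: (@le_trans _ _ (\sum_(i < n.+1) r * t)).
  by apply: ler_sum => i _; rewrite normrM; apply: ler_pM.
by rewrite sumr_const card_ord mulr_natl.
Qed.

Let d : R := n.+1%:R.
Let rho : R := (16 * d ^+ 2)^-1.

(* The weight [overlap N x / N^d] tends to [1], and it turns the cosine in [KT cos Phi] into a nonnegative factor
   containing the squared modulus of an exponential sum. *)
Lemma integral_KT_gt0 (Phi : W -> R) C :
  nice (8 * d)^-1 C Phi -> (forall xi, 0 <= Phi xi) ->
  (forall xi, (forall i, `|rcoord xi i| <= rho) -> Phi xi = 1) ->
  mu.-integrable setT (EFin \o KT cos Phi : V -> \bar R) ->
  0 < \int[mu]_x KT cos Phi x.
Proof.
move=> nP P0 P1 iK.
have d1 : 1 <= d by rewrite ler1n.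
have d0 : 0 < d := lt_le_trans ltr01 d1.
have rho0 : 0 < rho by rewrite invr_gt0 mulr_gt0// exprn_gt0.
pose c0 := 8^-1 * (2 * rho) ^+ n.+1.
have c00 : 0 < c0 by rewrite mulr_gt0 ?invr_gt0// exprn_gt0// mulr_gt0.
suff lb N : (0 < N)%N -> c0 <= \int[mu]_x (KT cos Phi x * (overlap N x / N%:R ^+ n.+1)).
  apply: (lt_le_trans c00).
  have cv : \int[mu]_x (KT cos Phi x * (overlap N x / N%:R ^+ n.+1)) @[N --> \oo] -->
     \int[mu]_x KT cos Phi x.
    apply: (@Rintegral_dominated _ _ (fun x => `|KT cos Phi x|)).
    - move=> N; apply: measurable_funM.
        by apply: measurable_continuous; apply: KT_continuous nP _; left.
      apply: measurable_funM => //.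
      exact: measurable_overlap.
    - move=> x; rewrite -[X in _ --> X]mulr1; apply: cvgM; first exact: cvg_cst.
      exact: overlap_cvg.
    - exact: integrable_norm iK.
    - move=> N x; rewrite normrM ler_piMr// ger0_norm; last first.
        by rewrite mulr_ge0 ?overlap_ge0// invr_ge0 exprn_ge0.
      have [->|N0] := eqVneq N 0%N; first by rewrite expr0n/= invr0 mulr0.
      by rewrite ler_pdivrMr ?mul1r ?overlap_le// exprn_gt0// ltr0n lt0n.
  rewrite -(cvg_lim _ cv)//; apply: limr_ge; first by apply/cvg_ex; eexists; exact: cv.
  by near=> N; apply: lb; near: N; exact: nbhs_infty_gt.
move=> N0.
have Nd0 : 0 < N%:R ^+ n.+1 :> R by rewrite exprn_gt0// ltr0n.
have tc : istrig (@cos R) by left.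
have cK : measurable_fun [set: V] (KT cos Phi).
  by apply: measurable_continuous; exact: KT_continuous nP tc.
pose I := {ffun 'I_n.+1 -> 'I_N}.
(* Each term of the weight is translated so that its indicator becomes that of the fixed unit cube;
   the lattice differences then sit inside the cosine, where [sum_cos_lattice] applies. *)
pose g (p : I * I) (x : W) := KT cos Phi x * \1_unit_cube (x + (pt p.2 - pt p.1)).
have ig p : mu.-integrable setT (EFin \o g p : V -> \bar R).
  apply: (@integrableP_bound _ _ _ (fun x => `|KT cos Phi x|)).
  - by apply: measurable_funM; [exact: cK|exact: measurable_indic_shift].
  - by move=> x; rewrite normrM ler_piMr// indicE; case: (_ \in _); rewrite ?normr1 ?normr0.
  - exact: integrable_norm iK.
pose g' (p : I * I) (x : W) := KT cos Phi (x + (pt p.1 - pt p.2)) * \1_unit_cube x.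
have g'E p : g' p = fun x => g p (1 *: x + (pt p.1 - pt p.2)).
  by apply/funext => x; rewrite /g' /g scale1r -[pt p.2 - _]opprB addrK.
have ig' p : mu.-integrable setT (EFin \o g' p : V -> \bar R).
  by rewrite g'E; exact: (integrable_affine _ ltr01 (ig p)).
have Ig p : \int[mu]_x g p x = \int[mu]_x g' p x.
  have := Rintegral_affine (pt p.1 - pt p.2) ltr01 (ig p); rewrite invr1 expr1n mul1r => <-.
  by apply: eq_Rintegral => x _; rewrite g'E.
have -> : \int[mu]_x (KT cos Phi x * (overlap N x / N%:R ^+ n.+1)) =
    (N%:R ^+ n.+1)^-1 * \int[mu]_x (\sum_(p : I * I) g' p x).
  rewrite (Rintegral_sum _ ig').2 -(eq_bigr _ (fun p _ => Ig p)) -(Rintegral_sum _ ig).2.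
  rewrite -RintegralZl//; last exact: (Rintegral_sum _ ig).1.
  apply: eq_Rintegral => x _; rewrite mulrA mulrC; congr (_ * _).
  rewrite -mulr_sumr; congr (_ * _).
  rewrite /overlap pair_big/=; apply: eq_bigr => p _.
  by rewrite -addrA [- _ + _]addrC.
rewrite ler_pdivlMl//.
pose S (s : W) := \sum_(p : I * I) KT cos Phi (s + (pt p.1 - pt p.2)).
have SE s : \sum_(p : I * I) g' p s = S s * \1_unit_cube s by rewrite mulr_suml.
have iS : mu.-integrable setT (fun x : V => (S x * \1_unit_cube x)%:E).
  by have := (Rintegral_sum (index_enum (I * I)%type) ig').1; under eq_fun do rewrite SE.
under eq_Rintegral do rewrite SE.
have mQ : measurable (unit_cube : set V) by exact: measurable_box.
have iQ : mu.-integrable setT (fun x : V => (\1_unit_cube x)%:E).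
  apply/integrableP; split; first exact/measurable_EFinP/measurable_indic.
  under eq_integral do rewrite /= ger0_norm//.
  by rewrite integral_indic// setIT lebV_box ltry.
have -> : N%:R ^+ n.+1 * c0 = \int[mu]_x (N%:R ^+ n.+1 * c0 * \1_unit_cube x).
  rewrite RintegralZl// /Rintegral integral_indic// setIT lebV_box /boxvol.
  rewrite big1 ?mulr1// => i _; by rewrite /rcoord !mxE subr0 max_l.
apply: le_Rintegral => //.
  by apply: eq_integrable (integrableZl measurableT (N%:R ^+ n.+1 * c0) iQ) => // x _; rewrite EFinM.
move=> s _; rewrite indicE; case: (boolP (_ \in _)); last by rewrite !mulr0.
rewrite inE !mulr1 => sQ.
pose A xi := \sum_(m : I) cos (2 * pi * dotp (pt m) xi).
pose B xi := \sum_(m : I) sin (2 * pi * dotp (pt m) xi).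
pose h (p : I * I) xi := Phi xi * cos (2 * pi * dotp (s + (pt p.1 - pt p.2)) xi).
have ih p : mu.-integrable setT (EFin \o h p : V -> \bar R).
  exact: nice_integrable nP tc.
have hE xi : \sum_p h p xi = Phi xi * (cos (2 * pi * dotp s xi) * (A xi ^+ 2 + B xi ^+ 2)).
  rewrite -mulr_sumr -(sum_cos_lattice (fun m : I => 2 * pi * dotp (pt m) xi)) pair_big/=.
  congr (_ * _); apply: eq_bigr => p _; congr cos.
  by rewrite dotpC dotpDr !(dotpC xi) dotpBl mulrDr mulrBr addrA.
have -> : S s = \int[mu]_xi (Phi xi * (cos (2 * pi * dotp s xi) * (A xi ^+ 2 + B xi ^+ 2))).
  by under eq_Rintegral do rewrite -hE; rewrite (Rintegral_sum _ ih).2.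
have r0 : 0 <= rho / N%:R by apply: divr_ge0 => //; exact: ltW.
(* A lower bound for the integrand on the cube [|xi_i| <= rho / N]: the outer cosine is at least
   [1 / 2], and so is each of the [N^d] cosines in [A]. Multiplied by the volume [(2 rho / N)^d] it
   is [N^d c0]. *)
pose a : R := 2^-1 * (N%:R ^+ n.+1 / 2) ^+ 2.
have -> : N%:R ^+ n.+1 * c0 = \int[mu]_(x in setT) (a * \1_(cube (rho / N%:R)) x).
  rewrite integral_cube// /a /c0.
  have -> : (2 * (rho / N%:R)) ^+ n.+1 = (2 * rho) ^+ n.+1 / N%:R ^+ n.+1 by rewrite mulrA expr_div_n.
  by field; rewrite gt_eqF.
apply: le_Rintegral => //.
- exact: integrable_cube.
- by have := (Rintegral_sum (index_enum (I * I)%type) ih).1; under eq_fun do rewrite hE.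
move=> xi _.
have rl : rho <= (8 * d)^-1.
  rewrite lef_pV2 ?posrE ?mulr_gt0 ?exprn_gt0//; nra.
have rN : rho / N%:R <= rho by rewrite ler_piMr ?(ltW rho0)// invf_le1 ?ltr0n// ler1n.
have [xiM|] := pselect (forall i, `|rcoord xi i| <= (8 * d)^-1); last first.
  move=> /existsNP[i /negP]; rewrite -ltNge => xiM.
  rewrite (nice_supp nP xiM) mul0r indicE memNset ?mulr0// => xc.
  move: xiM; apply/negP; rewrite -leNgt; apply: le_trans rl; apply: le_trans rN.
  have /andP[h1 h2] := xc i; move: h1 h2.
  by rewrite ler_norml [rcoord (const_mx _) _]mxE [rcoord (const_mx _) _]mxE => -> /ltW ->.
have s1 i : `|rcoord s i| <= 1.
  have /andP[h1 h2] := sQ i; move: h1 h2; rewrite [rcoord 0 _]mxE [rcoord (const_mx _) _]mxE => h1 h2.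
  by rewrite ger0_norm// ltW.
(* The support bound [1 / (8 d)] comes from here: [2 pi |s.xi| <= 8 d / (8 d) = 1] for [s] in the
   unit cube. *)
have cs : 2^-1 <= cos (2 * pi * dotp s xi).
  apply: cos_ge_half; rewrite normrM ger0_norm ?mulr_ge0 ?pi_ge0//.
  have := dotp_unit_le ler01 (le_trans (normr_ge0 _) (xiM ord0)) s1 xiM.
  rewrite -/d mul1r invfM mulrCA mulfV ?gt_eqF// mulr1 => h1.
  move: (pi_le4) (pi_ge0 R) (normr_ge0 (dotp s xi)) h1; clear.
  move: (`|dotp s xi|) (pi : R) => u p p4 p0 u0 u8; nra.
have AB0 : 0 <= A xi ^+ 2 + B xi ^+ 2 by rewrite addr_ge0 ?sqr_ge0.
have cs0 : 0 <= cos (2 * pi * dotp s xi) by apply: le_trans cs; rewrite invr_ge0.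
rewrite indicE; case: (boolP (_ \in _)); last by rewrite mulr0 !mulr_ge0.
rewrite inE mulr1 => xc.
have xr i : `|rcoord xi i| <= rho / N%:R.
  have /andP[h1 h2] := xc i; move: h1 h2.
  by rewrite ler_norml [rcoord (const_mx _) _]mxE [rcoord (const_mx _) _]mxE => -> /ltW ->.
rewrite P1 => [|i]; last exact: le_trans (xr i) rN.
rewrite mul1r /a; apply: ler_pM => //.
apply: (@le_trans _ _ (A xi ^+ 2)); last by rewrite lerDl sqr_ge0.
have Age : N%:R ^+ n.+1 / 2 <= A xi.
  have -> : N%:R ^+ n.+1 / 2 = \sum_(m : I) (2^-1 : R).
    by rewrite sumr_const card_ffun !card_ord -[RHS]mulr_natl natrX.
  apply: ler_sum => m _; apply: cos_ge_half; rewrite normrM ger0_norm ?mulr_ge0 ?pi_ge0//.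
  have mN i : `|rcoord (pt m) i| <= N%:R by rewrite /rcoord mxE normr_nat ler_nat ltnW.
  have := dotp_unit_le (ler0n R N) r0 mN xr.
  have -> : N%:R * (rho / N%:R) = rho by rewrite mulrCA mulfV ?mulr1// pnatr_eq0 -lt0n.
  rewrite -/d.
  have -> : d * rho = (16 * d)^-1 by rewrite /rho; field; rewrite gt_eqF.
  move=> h1; have h2 : (16 * d)^-1 <= 16^-1 by rewrite lef_pV2 ?posrE ?mulr_gt0// ler_peMr.
  move: (pi_le4) (pi_ge0 R) (normr_ge0 (dotp (pt m) xi)) (le_trans h1 h2); clear.
  move: (`|dotp _ xi|) (pi : R) => u p p4 p0 u0 u8; nra.
have ND0 : 0 <= N%:R ^+ n.+1 / 2 :> R by rewrite divr_ge0// exprn_ge0.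
by apply: lerXn2r => //; rewrite nnegrE// (le_trans ND0).
Unshelve. all: by end_near. Qed.

End lattice_positivity.

(** * A reproducing inequality for band-limited functions *)

Section reproducing.
Context {R : realType} {n : nat}.
Local Notation W := 'rV[R]_n.+1.
Local Notation V := (vec R n).
Local Notation mu := (@lebV R n).
Implicit Types (x y xi : W).

Definition sqn x : R := \sum_i rcoord x i ^+ 2.

Lemma sqn_enorm x : sqn x = enorm x ^+ 2.
Proof. by rewrite enorm_sqr. Qed.

Lemma sqnZ (a : R) x : sqn (a *: x) = a ^+ 2 * sqn x.
Proof. by rewrite /sqn mulr_sumr; apply: eq_bigr => i _; rewrite /rcoord mxE exprMn. Qed.

Lemma sqn_ge x i : rcoord x i ^+ 2 <= sqn x.
Proof. by rewrite /sqn (bigD1 i)//= lerDl sumr_ge0// => j _; exact: sqr_ge0. Qed.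

Lemma Alg_sqn : Alg (fun _ x => sqn x).
Proof.
apply: Alg_sum => i; under eq_fun do under eq_fun do rewrite expr2.
by apply: Alg_mul; exact: Alg_coord.
Qed.

Lemma continuous_sqn : continuous sqn.
Proof.
apply: continuous_sumr => i; apply: continuous_exprn; exact: continuous_rcoord.
Qed.

Let d : R := n.+1%:R.

Definition eps (k : nat) : R := k.+1%:R^-1.

Lemma eps_gt0 k : 0 < eps k. Proof. by rewrite invr_gt0. Qed.

Lemma eps_le1 k : eps k <= 1. Proof. by rewrite invf_le1// ler1n. Qed.

(** The value is 1 where [128 d^2 |x|^2 <= 1] and 0 where that product is at least 2, that is, for
    [|x| >= 1 / (8 d)]. This gives the plateau and the support that [integral_KT_gt0] asks for. *)
Definition Phi x : R := cutoff (128 * d ^+ 2 * sqn x - 1).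

Definition Psi (c1 : R) x : R := cutoff (sqn x - c1).

(* [Phi (eps k xi)] is split at [|xi|^2 ~ c1]: the high part is a test function that annihilates band-limited
   functions, and the low part has a transform that decays rapidly, uniformly in [k]. *)
Definition low (c1 : R) (k : nat) x : R := Phi (eps k *: x) * Psi c1 x.

Definition high (c1 : R) (k : nat) x : R := Phi (eps k *: x) * (1 - Psi c1 x).

Lemma d_ge1 : 1 <= d. Proof. by rewrite ler1n. Qed.

Lemma Phi_ge0 x : 0 <= Phi x. Proof. exact: cutoff_ge0. Qed.

Lemma Phi_supp x i : (8 * d)^-1 < `|rcoord x i| -> Phi x = 0.
Proof.
move=> xi; apply: cutoff0; rewrite lerBrDr.
have d1 := d_ge1; have d0 : 0 < d := lt_le_trans ltr01 d1.
have : (8 * d)^-1 ^+ 2 <= sqn x.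
  apply: le_trans (sqn_ge x i); rewrite -[leRHS]real_normK ?num_real//.
  by apply: lerXn2r; rewrite ?nnegrE ?(ltW xi)// invr_ge0 mulr_ge0// ltW.
rewrite -(ler_pM2l (_ : 0 < 128 * d ^+ 2)); last by rewrite mulr_gt0// exprn_gt0.
apply: le_trans; rewrite le_eqVlt; apply/orP; left; apply/eqP.
by field; rewrite gt_eqF.
Qed.

Lemma Phi_eq1 x : (forall i, `|rcoord x i| <= (16 * d ^+ 2)^-1) -> Phi x = 1.
Proof.
move=> xi; apply: cutoff1; rewrite subr_le0.
have d1 := d_ge1; have d0 : 0 < d := lt_le_trans ltr01 d1.
have : sqn x <= d * (16 * d ^+ 2)^-1 ^+ 2.
  rewrite /sqn; apply: (@le_trans _ _ (\sum_(i < n.+1) (16 * d ^+ 2)^-1 ^+ 2)).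
    apply: ler_sum => i _; rewrite -[leLHS]real_normK ?num_real//.
    by apply: lerXn2r; rewrite ?nnegrE//; rewrite invr_ge0 mulr_ge0// exprn_ge0// ltW.
  by rewrite sumr_const card_ord /d [leRHS]mulr_natl.
have b0 : 0 < 128 * d ^+ 2 by rewrite mulr_gt0// exprn_gt0.
rewrite -(ler_pM2l b0 (sqn x)) => /le_trans; apply.
have -> : 128 * d ^+ 2 * (d * (16 * d ^+ 2)^-1 ^+ 2) = (2 * d)^-1 by field; rewrite gt_eqF.
by rewrite invf_le1 ?mulr_gt0//; lra.
Qed.

Lemma Alg_Phi_eps : Alg (fun k x => Phi (eps k *: x)).
Proof.
under eq_fun do under eq_fun do rewrite /Phi sqnZ.
apply: Alg_cutoff; apply: Alg_add; last exact: Alg_const.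
apply: Alg_mul; first exact: Alg_const.
apply: Alg_mul; last exact: Alg_sqn.
apply: (@Alg_cst _ _ _ 1) => k.
by rewrite ger0_norm ?sqr_ge0// exprn_ile1 ?eps_le1// ltW ?eps_gt0.
Qed.

Lemma Alg_Psi c1 : Alg (fun _ x => Psi c1 x).
Proof. by apply: Alg_cutoff; apply: Alg_add; [exact: Alg_sqn|exact: Alg_const]. Qed.

Lemma Alg_low c1 : Alg (low c1).
Proof. by apply: Alg_mul; [exact: Alg_Phi_eps|exact: Alg_Psi]. Qed.

Lemma Alg_high c1 : Alg (high c1).
Proof.
apply: Alg_mul; first exact: Alg_Phi_eps.
apply: Alg_add; first exact: Alg_const.
under eq_fun do under eq_fun do rewrite -mulN1r.
by apply: Alg_mul; [exact: Alg_const|exact: Alg_Psi].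
Qed.

Lemma low_supp c1 k x i : 0 <= c1 -> c1 + 1 < `|rcoord x i| -> low c1 k x = 0.
Proof.
move=> c0 xi; rewrite /low /Psi cutoff0 ?mulr0//.
have := sqn_ge x i; rewrite -[leLHS]real_normK ?num_real//.
move: (`|_|) xi => t xi h; nra.
Qed.

Lemma Phi_eps_supp k x i : k.+1%:R < `|rcoord x i| -> Phi (eps k *: x) = 0.
Proof.
move=> xi; apply: (@Phi_supp _ i).
have e0 := eps_gt0 k.
have -> : rcoord (eps k *: x) i = eps k * rcoord x i by rewrite /rcoord mxE.
rewrite normrM (gtr0_norm e0).
have d1 := d_ge1; have d0 : 0 < d := lt_le_trans ltr01 d1.
apply: (@le_lt_trans _ _ 1).
  by rewrite invf_le1 ?mulr_gt0//; lra.
by rewrite /eps mulrC ltr_pdivlMr// mul1r.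
Qed.

Lemma nice_of_Alg (F : nat -> W -> R) M k : Alg F -> 0 <= M ->
  (forall xi i, M < `|rcoord xi i| -> F k xi = 0) -> exists C, nice M C (F k).
Proof.
move=> AF M0 FM; have [C hC] := Alg_bounded M AF; exists `|C|; split => //.
- exact: Alg_continuous.
- move=> xi; have [xM|] := pselect (forall i, `|rcoord xi i| <= M).
    by rewrite (le_trans (hC k xi xM))// ler_norm.
  by move=> /existsNP[i /negP]; rewrite -ltNge => /FM ->; rewrite normr0.
Qed.

Lemma KT_scale c G (a : R) y : 0 < a -> istrig c ->
  (exists M C, nice M C G) ->
  KT c (fun x => G (a *: x)) y = a^-1 ^+ n.+1 * KT c G (a^-1 *: y).
Proof.
move=> a0 tc [M [C nG]]; rewrite /KT -(Rintegral_affine 0 a0 (nice_integrable (a^-1 *: y) nG tc)).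
apply: eq_Rintegral => x _; rewrite addr0; congr (_ * c _).
rewrite dotpZr (dotpC (a^-1 *: y)) dotpZr (dotpC x); field.
by rewrite gt_eqF.
Qed.

Lemma nice_Phi : exists C, nice (8 * d)^-1 C Phi.
Proof.
have AP : Alg (fun _ x => Phi x).
  apply: Alg_cutoff; apply: Alg_add; last exact: Alg_const.
  by apply: Alg_mul; [exact: Alg_const|exact: Alg_sqn].
apply: (@nice_of_Alg (fun _ => Phi) _ 0 AP).
  by rewrite invr_ge0 mulr_ge0// ltW// (lt_le_trans ltr01 d_ge1).
by move=> xi i; exact: Phi_supp.
Qed.

Lemma KT_high c1 k c y : 0 <= c1 -> istrig c ->
  KT c (high c1 k) y = (eps k)^-1 ^+ n.+1 * KT c Phi ((eps k)^-1 *: y) - KT c (low c1 k) y.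
Proof.
move=> c10 tc; have [C nP] := nice_Phi.
rewrite -KT_scale ?eps_gt0//; last by exists (8 * d)^-1, C.
have [C1 n1] := nice_of_Alg Alg_Phi_eps (ler0n R k.+1) (@Phi_eps_supp k).
have [C2 n2] := nice_of_Alg (k := k) (Alg_low c1) (addr_ge0 c10 ler01) (fun x i => @low_supp c1 k x i c10).
rewrite /KT -(RintegralB measurableT (nice_integrable y n1 tc) (nice_integrable y n2 tc)).
by apply: eq_Rintegral => x _; rewrite /high /low; ring.
Qed.

(** The [+ 1] in [4 A^2 + 1] puts the support strictly outside the closed ball of radius [2 A r],
    and the factor [Phi] makes it compact. The modulation by [x0] centres the Fourier transform at
    [x0]. *)
Lemma high_test (A r : R) k x0 : 0 < A -> 0 < r ->
  test_outside (A * r) (fun xi => Complex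
    (high (4 * A ^+ 2 + 1) k (r^-1 *: xi) * cos (2 * pi * dotp x0 xi))
    (high (4 * A ^+ 2 + 1) k (r^-1 *: xi) * sin (2 * pi * dotp x0 xi))).
Proof.
move=> A0 r0; set c1 := _ + 1.
have Ad : Alg (fun _ xi => 2 * pi * dotp x0 xi).
  apply: Alg_mul; first exact: Alg_const.
  by apply: Alg_sum => i; apply: Alg_mul; [exact: Alg_const|exact: Alg_coord].
have Ah := Alg_scale r^-1 (Alg_high c1).
split; first exact: (Alg_smooth k (Alg_mul Ah (Alg_comp Smooth1_cos Ad))).
split; first exact: (Alg_smooth k (Alg_mul Ah (Alg_comp Smooth1_sin Ad))).
exists [set xi | c1 * r ^+ 2 <= sqn xi <= (r * k.+1%:R) ^+ 2].
split.
  apply: bounded_closed_compact.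
    exists (r * k.+1%:R); split; first exact: num_real.
    move=> M rM xi /= /andP[_ h]; apply: (le_trans _ (ltW rM)).
    have rk0 : 0 < r * k.+1%:R by rewrite mulr_gt0.
    rewrite [leLHS]mx_normrE; apply/bigmax_leP; split; first exact: ltW.
    move=> [i j] _; rewrite (ord1 i) /=.
    rewrite -(@ler_pXn2r _ 2)// ?nnegrE ?(ltW rk0)// real_normK ?num_real//.
    exact: le_trans (sqn_ge xi j) h.
  have -> : [set xi | c1 * r ^+ 2 <= sqn xi <= (r * k.+1%:R) ^+ 2] =
     sqn @^-1` [set t | c1 * r ^+ 2 <= t] `&` sqn @^-1` [set t | t <= (r * k.+1%:R) ^+ 2].
    by apply/seteqP; split => xi /= => [/andP[]|[-> ->]].
  apply: closedI; apply: closed_comp.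
  - by move=> xi _; exact: continuous_sqn.
  - exact: closed_ge.
  - by move=> xi _; exact: continuous_sqn.
  - exact: closed_le.
split.
  move=> xi /= /andP[h _]; rewrite ltNge; apply/negP => h2.
  have : sqn xi <= (2 * (A * r)) ^+ 2.
    by rewrite sqn_enorm; apply: lerXn2r; rewrite ?nnegrE ?enorm_ge0// !mulr_ge0 ?ltW.
  move: h; rewrite /c1; have := exprn_gt0 2 r0; nra.
move=> xi h.
suff -> : high c1 k (r^-1 *: xi) = 0 by rewrite !mul0r.
move: h => /= /negP; rewrite negb_and -!ltNge => /orP[h|h].
  rewrite /high /Psi cutoff1 ?subrr ?mulr0// subr_le0 sqnZ exprVn.
  by rewrite ler_pdivrMl ?exprn_gt0// mulrC ltW.
rewrite /high /Phi cutoff0 ?mul0r// lerBrDr scalerA sqnZ.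
have : 1 <= (eps k * r^-1) ^+ 2 * sqn xi.
  rewrite /eps -invfM exprVn ler_pdivlMl ?exprn_gt0 ?mulr_gt0// mulr1.
  by rewrite mulrC; exact: ltW.
have := d_ge1; move: (_ * sqn xi) => t; nra.
Qed.

Lemma rint_scaled (G : W -> R) c (r : R) y : 0 < r -> istrig c -> (exists M C, nice M C G) ->
  rint (fun xi => G (r^-1 *: xi) * c (2 * pi * dotp y xi)) = r ^+ n.+1 * KT c G (r *: y).
Proof.
move=> r0 tc [M [C nG]]; have ri0 : 0 < r^-1 by rewrite invr_gt0.
have E xi : G (r^-1 *: xi) * c (2 * pi * dotp y xi) =
  (fun z => G z * c (2 * pi * dotp (r *: y) z)) (r^-1 *: xi + 0).
  rewrite addr0; congr (_ * c _).
  by rewrite dotpZr (dotpC (r *: y)) dotpZr (dotpC xi); field; rewrite gt_eqF.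
have ig := nice_integrable (r *: y) nG tc.
under eq_fun do rewrite E.
rewrite rintE; last exact: (integrable_affine 0 ri0 ig).
by rewrite (Rintegral_affine 0 ri0 ig) invrK.
Qed.

Lemma nice_high c1 k : exists M C, nice M C (high c1 k).
Proof.
exists k.+1%:R; apply: nice_of_Alg (Alg_high c1) _ _ => //.
by move=> xi i xiM; rewrite /high (Phi_eps_supp xiM) mul0r.
Qed.

Lemma fourier_high c1 k (r : R) x0 y : 0 < r ->
  fourier (fun xi => Complex
    (high c1 k (r^-1 *: xi) * cos (2 * pi * dotp x0 xi))
    (high c1 k (r^-1 *: xi) * sin (2 * pi * dotp x0 xi))) y =
  Complex (r ^+ n.+1 * KT cos (high c1 k) (r *: (y - x0)))
   (- (r ^+ n.+1 * KT sin (high c1 k) (r *: (y - x0)))).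
Proof.
move=> r0; rewrite /fourier /=.
rewrite -(@rint_scaled _ cos r (y - x0) r0 (or_introl erefl) (nice_high c1 k)).
have -> : - (r ^+ n.+1 * KT sin (high c1 k) (r *: (y - x0))) = r ^+ n.+1 * KT sin (high c1 k) (r *: (x0 - y)).
  rewrite -mulrN; congr (_ * _).
  have [M [C nh]] := nice_high c1 k.
  rewrite -mulN1r /KT -(RintegralZl (-1) measurableT (nice_integrable (r *: (y - x0)) nh (or_intror erefl))).
  apply: eq_Rintegral => xi _; rewrite mulN1r -mulrN -sinN; congr (_ * sin _).
  by rewrite -opprB -mulrN scalerN -[- (r *: _)]scaleN1r (dotpC _ xi) dotpZr (dotpC xi) mulN1r opprK.
rewrite -(@rint_scaled _ sin r (x0 - y) r0 (or_intror erefl) (nice_high c1 k)).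
f_equal; f_equal; apply/funext => xi.
  by rewrite dotpBl mulrBr cosB; ring.
by rewrite dotpBl mulrBr sinB; ring.
Qed.

End reproducing.

Lemma continuous_comp_affine (K : realType) (X : normedModType K) (u : X -> K) (a : K) (v : X) :
  continuous u -> continuous (fun z => u (a *: z + v)).
Proof.
move=> cu z; apply: (@continuous_comp _ _ _ (fun z => a *: z + v) u); last exact: cu.
exact: continuous_affine.
Qed.

Section reproducing_inequality.
Context {R : realType} {n : nat}.
Local Notation W := 'rV[R]_n.+1.
Local Notation V := (vec R n).
Local Notation mu := (@lebV R n).
Implicit Types (x y z xi : W) (p q F : W -> R).

Lemma growth_shift (C : R) N0 F (r : R) x0 : 0 < r ->
  (forall x, F x <= C * (1 + enorm x) ^+ N0) ->
  exists2 C1 : R, 0 <= C1 & forall y, F y <= C1 * (1 + enorm (r *: (y - x0))) ^+ N0.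
Proof.
move=> r0 FC; have ri0 : 0 < r^-1 by rewrite invr_gt0.
have x00 := enorm_ge0 x0.
exists (`|C| * ((1 + enorm x0) * (1 + r^-1)) ^+ N0).
  by rewrite mulr_ge0// exprn_ge0// mulr_ge0// addr_ge0// ltW.
move=> y; apply: le_trans (FC y) _.
apply: (@le_trans _ _ (`|C| * (1 + enorm y) ^+ N0)).
  by apply: ler_wpM2r; [rewrite exprn_ge0// addr_ge0 ?enorm_ge0|exact: ler_norm].
rewrite -mulrA -exprMn; apply: ler_wpM2l => //.
have e0 := enorm_ge0 (y - x0).
apply: lerXn2r; rewrite ?nnegrE ?mulr_ge0 ?addr_ge0 ?enorm_ge0 ?(ltW ri0)//.
rewrite enormZ ?(ltW r0)//.
have : enorm y <= enorm x0 + enorm (y - x0) by rewrite -{1}(subrK x0 y) addrC; exact: enormD.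
have : r^-1 * (r * enorm (y - x0)) = enorm (y - x0) by rewrite mulrA mulVf ?mul1r// gt_eqF.
move: (r * _) (mulr_ge0 (ltW r0) e0) => s s0 rs h.
have h2 : 1 + enorm y <= (1 + enorm x0) * (1 + enorm (y - x0)).
  by have := mulr_ge0 x00 e0; lra.
apply: (le_trans h2); rewrite -[leRHS]mulrA; apply: ler_wpM2l; first by rewrite addr_ge0.
by rewrite -rs; have := ltW ri0; nra.
Qed.

Lemma integrable_wgt s : n.+1%:R < s -> mu.-integrable setT (fun x : V => (wgt s x)%:E).
Proof.
move=> ns; apply/integrableP; split.
  apply/measurable_EFinP/measurable_continuous => x.
  by have := @continuous_wgt R n s 1 0 x; under eq_fun do rewrite scale1r addr0.
by under eq_integral do rewrite /= ger0_norm ?wgt_ge0//; exact: integral_wgt_lty.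
Qed.

Lemma growth_wgt N0 (x : W) : (1 + enorm x) ^+ N0 * wgt (N0 + n.+2)%:R x = wgt n.+2%:R x.
Proof.
by rewrite !wgt_nat exprD invfM mulrA mulfV ?mul1r// expf_neq0// gt_eqF// wgt_base_gt0.
Qed.

Definition PhiC : R := \int[mu]_x KT cos (@Phi R n) x.
Definition PhiS : R := \int[mu]_x KT sin (@Phi R n) x.

Lemma KT_Phi_decay N : exists2 C : R, 0 < C & forall c x, istrig c -> `|KT c (@Phi R n) x| <= C * wgt N%:R x.
Proof.
have [C0 nP] := @nice_Phi R n.
have AP : Alg (fun _ : nat => @Phi R n).
  apply: Alg_cutoff; apply: Alg_add; last exact: Alg_const.
  by apply: Alg_mul; [exact: Alg_const|exact: Alg_sqn].
have [C Cp hC] := @KT_decay R n (fun _ => @Phi R n) _ N AP (nice_M nP) (fun _ xi i h => nice_supp nP h).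
by exists C => // c x tc; exact: (hC 0%N).
Qed.

Lemma KT_Phi_continuous c : istrig c -> continuous (KT c (@Phi R n)).
Proof. by move=> tc; have [C0 nP] := @nice_Phi R n; exact: KT_continuous nP tc. Qed.

Lemma PhiC_gt0 : 0 < PhiC.
Proof.
have [C nP] := @nice_Phi R n.
apply: (integral_KT_gt0 nP); [exact: Phi_ge0|exact: Phi_eq1|].
have [C1 C10 h] := KT_Phi_decay n.+2.
apply: (@integrableP_bound _ _ _ (fun x => C1 * wgt n.+2%:R x)).
- by apply: measurable_continuous; apply: KT_Phi_continuous; left.
- by move=> x; apply: h; left.
have := integrableZl measurableT C1 (@integrable_wgt n.+2%:R (ltac:(by rewrite ltr_nat))).
by apply: eq_integrable => // x _; rewrite /= EFinM.
Qed.

Lemma cabs_continuous (r : R) (f : W -> R[i]) : inEr r f -> continuous (fun y => cabs (f y)).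
Proof.
move=> [ca [cb _]].
apply: (@continuous_o _ _ _ Num.sqrt (fun x => complex.Re (f x) ^+ 2 + complex.Im (f x) ^+ 2)).
  by apply: continuous_add; exact: continuous_exprn.
by move=> x; exact: sqrt_continuous.
Qed.

Lemma cabs_ge0 (z : R[i]) : 0 <= cabs z. Proof. exact: sqrtr_ge0. Qed.

(* As [k] grows, the rescaled transforms of [Phi (eps k .)] are an approximate identity up to the factor [PhiC]. *)
Section bound.
Variables (A r CN : R) (x0 : W) (N : nat).
Hypothesis r0 : 0 < r.
Let c1 : R := 4 * A ^+ 2 + 1.
Hypothesis lowN : forall k c y, istrig c -> `|KT c (@low R n c1 k) y| <= CN * wgt N%:R y.

Let c10 : 0 <= c1. Proof. by rewrite addr_ge0// mulr_ge0// sqr_ge0. Qed.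

Let phase (a : R) y : W := a *: (y - x0).

Lemma continuous_KT_low c k : istrig c -> continuous (KT c (@low R n c1 k)).
Proof.
move=> tc; have [C nl] := nice_of_Alg (k := k) (Alg_low c1) (addr_ge0 c10 ler01) (fun x i => @low_supp R n c1 k x i c10).
exact: KT_continuous nl tc.
Qed.

(** Here [p] and [q] stand for the real and imaginary parts of [f], or of a multiple of [f]. The
    pairing with the full transform tends to [p x0 * PhiC + q x0 * PhiS] by dominated convergence;
    at each [k] the high part contributes 0, and the low part obeys a bound free of [k]. *)
Lemma reproducing_bound p q F (C : R) N0 :
  continuous p -> continuous q -> continuous F ->
  (forall x, `|p x| <= F x) -> (forall x, `|q x| <= F x) ->
  (forall x, F x <= C * (1 + enorm x) ^+ N0) ->
  (forall k, rint (fun y => p y * (r ^+ n.+1 * KT cos (@high R n c1 k) (phase r y)) +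
                            q y * (r ^+ n.+1 * KT sin (@high R n c1 k) (phase r y))) = 0) ->
  mu.-integrable setT (fun y : V => (F y * wgt N%:R (phase r y))%:E) ->
  `|p x0 * PhiC + q x0 * PhiS| <=
     2 * CN * r ^+ n.+1 * \int[mu]_y (F y * wgt N%:R (phase r y)).
Proof.
move=> cp cq cF pF qF FC hk iF.
have tcos : istrig (@cos R) by left.
have tsin : istrig (@sin R) by right.
have [C1 C10 FC1] := growth_shift x0 r0 FC.
(* The exponent [N0] absorbs the growth of [F]; what remains exceeds the dimension [n.+1] and is
   integrable. *)
have [D D0 hD] := KT_Phi_decay (N0 + n.+2).
have iw := @integrable_wgt n.+2%:R (ltac:(by rewrite ltr_nat)).
pose g z : R := 2 * C1 * D * wgt n.+2%:R z.
have ig : mu.-integrable setT (EFin \o g : V -> \bar R).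
  by apply: eq_integrable (integrableZl measurableT (2 * C1 * D) iw) => // x _; rewrite /= EFinM.
(* After the substitution [y = (eps k / r) z + x0] the kernel is fixed and the scale sits in the
   argument of [p] and [q], where continuity at [x0] applies. *)
pose H k z : R := p ((eps k : R) / r *: z + x0) * KT cos (@Phi R n) z + q ((eps k : R) / r *: z + x0) * KT sin (@Phi R n) z.
have e0 k : 0 < (eps k : R) / r by rewrite divr_gt0// eps_gt0.
have cpa (u : W -> R) k : continuous u -> continuous (fun z => u ((eps k : R) / r *: z + x0)).
  exact: continuous_comp_affine.
have cH k : continuous (H k).
  by apply: continuous_add; apply: continuous_mul; (exact: cpa || exact: KT_Phi_continuous).
have Fe k z : F ((eps k : R) / r *: z + x0) <= C1 * (1 + enorm z) ^+ N0.
  apply: le_trans (FC1 _) _; apply: ler_wpM2l => //.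
  apply: lerXn2r; rewrite ?nnegrE ?addr_ge0 ?enorm_ge0// lerD2l addrK scalerA mulrC mulfVK ?gt_eqF//.
  by rewrite enormZ ?ler_piMl ?enorm_ge0 ?eps_le1// ltW// eps_gt0.
have uK k u c z : (forall x, `|u x| <= F x) -> istrig c ->
    `|u ((eps k : R) / r *: z + x0) * KT c (@Phi R n) z| <= C1 * D * wgt n.+2%:R z.
  move=> uF tc; rewrite normrM -(growth_wgt N0) mulrACA; apply: ler_pM => //.
    exact: le_trans (uF _) (Fe k z).
  exact: hD.
have Hg k z : `|H k z| <= g z.
  apply: le_trans (ler_normD _ _) _.
  rewrite /g -!mulrA mulr_natl mulr2n !mulrA; apply: lerD; exact: uK.
have iH k : mu.-integrable setT (EFin \o H k : V -> \bar R).
  by apply: (@integrableP_bound _ _ _ g) => //; apply: measurable_continuous.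
have cvH : \int[mu]_z H k z @[k --> \oo] --> p x0 * PhiC + q x0 * PhiS.
  have -> : p x0 * PhiC + q x0 * PhiS = \int[mu]_z (p x0 * KT cos (@Phi R n) z + q x0 * KT sin (@Phi R n) z).
    have iP c : istrig c -> mu.-integrable setT (fun z : V => (KT c (@Phi R n) z)%:E).
      move=> tc; have [D' D'0 hD'] := KT_Phi_decay n.+2.
      apply: (@integrableP_bound _ _ _ (fun x => D' * wgt n.+2%:R x)).
      - by apply: measurable_continuous; exact: KT_Phi_continuous.
      - by move=> x; exact: hD'.
      by apply: eq_integrable (integrableZl measurableT D' iw) => // x _; rewrite /= EFinM.
    rewrite RintegralD//; last 2 first.
    - by apply: eq_integrable (integrableZl measurableT (p x0) (iP _ tcos)) => // x _; rewrite /= EFinM.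
    - by apply: eq_integrable (integrableZl measurableT (q x0) (iP _ tsin)) => // x _; rewrite /= EFinM.
    rewrite RintegralZl//; last exact: iP.
    by rewrite RintegralZl//; exact: iP.
  apply: (@Rintegral_dominated _ _ _ _ g); [|move=> z|exact: ig|exact: Hg].
    by move=> k; exact: measurable_continuous.
  have ce : ((eps k : R) / r *: z + x0) @[k --> \oo] --> x0.
    rewrite -[X in _ --> X]add0r -(scale0r z) -(mul0r r^-1).
    apply: cvgD; last exact: cvg_cst.
    apply: cvgZl; apply: cvgM; last exact: cvg_cst.
    exact: cvg_harmonic.
  have cu (u : W -> R) : continuous u -> u ((eps k : R) / r *: z + x0) @[k --> \oo] --> u x0.
    by move=> cu; apply: (cvg_comp (fun k : nat => (eps k : R) / r *: z + x0) u ce); exact: cu.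
  by apply: cvgD; apply: cvgM; (exact: cvg_cst || exact: cu).
suff bnd k : `|\int[mu]_z H k z| <= 2 * CN * r ^+ n.+1 * \int[mu]_y (F y * wgt N%:R (phase r y)).
  rewrite ler_norml; apply/andP; split.
    rewrite -(cvg_lim _ cvH)//; apply: limr_ge; first by apply/cvg_ex; eexists; exact: cvH.
    by apply: nearW => k; have := bnd k; rewrite ler_norml => /andP[].
  rewrite -(cvg_lim _ cvH)//; apply: limr_le; first by apply/cvg_ex; eexists; exact: cvH.
  by apply: nearW => k; have := bnd k; rewrite ler_norml => /andP[].
pose rd : R := r ^+ n.+1.
have rd0 : 0 < rd by exact: exprn_gt0.
pose a : R := r / eps k.
have a0 : 0 < a by rewrite divr_gt0// eps_gt0.
have aE y : H k (a *: y + (- a *: x0)) = p y * KT cos (@Phi R n) (phase a y) + q y * KT sin (@Phi R n) (phase a y).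
  have -> : a *: y + (- a *: x0) = phase a y by rewrite /phase scalerBr scaleNr.
  rewrite /H (_ : (eps k : R) / r *: phase a y + x0 = y)// /phase scalerA /a.
  rewrite (_ : (eps k : R) / r * (r / eps k) = 1) ?scale1r ?subrK//.
  by field; rewrite !gt_eqF ?eps_gt0.
pose Hi y : R := p y * (rd * KT cos (@high R n c1 k) (phase r y)) + q y * (rd * KT sin (@high R n c1 k) (phase r y)).
pose Lo y : R := rd * (p y * KT cos (@low R n c1 k) (phase r y) + q y * KT sin (@low R n c1 k) (phase r y)).
have HE y : a ^+ n.+1 * H k (a *: y + (- a *: x0)) = Hi y + Lo y.
  rewrite aE /Hi /Lo !KT_high// /phase !scalerA -/(phase _ y).
  rewrite [(eps k)^-1 * r]mulrC -/a /a expr_div_n -/rd exprVn; ring.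
have iHa : mu.-integrable setT (fun y : V => (a ^+ n.+1 * H k (a *: y + (- a *: x0)))%:E).
  by apply: eq_integrable (integrableZl measurableT (a ^+ n.+1) (integrable_affine (- a *: x0) a0 (iH k))) => // x _; rewrite /= EFinM.
have cph (u : W -> R) b : continuous u -> continuous (fun y => u (phase b y)).
  move=> cu; rewrite /phase; under eq_fun do rewrite scalerBr -scalerN.
  exact: continuous_comp_affine.
have Lob y : `|Lo y| <= 2 * CN * rd * (F y * wgt N%:R (phase r y)).
  rewrite /Lo normrM (gtr0_norm rd0).
  have E c u : (forall x, `|u x| <= F x) -> istrig c ->
      `|u y * KT c (@low R n c1 k) (phase r y)| <= F y * (CN * wgt N%:R (phase r y)).
    by move=> uF tc; rewrite normrM; apply: ler_pM => //; exact: lowN.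
  apply: (@le_trans _ _ (rd * (F y * (CN * wgt N%:R (phase r y)) + F y * (CN * wgt N%:R (phase r y))))).
    apply: ler_wpM2l; first exact: ltW.
    by apply: le_trans (ler_normD _ _) _; apply: lerD; exact: E.
  by rewrite le_eqVlt; apply/orP; left; apply/eqP; ring.
have iB : mu.-integrable setT (fun y : V => (2 * CN * rd * (F y * wgt N%:R (phase r y)))%:E).
  by apply: eq_integrable (integrableZl measurableT (2 * CN * rd) iF) => // x _; rewrite /= EFinM.
have iLo : mu.-integrable setT (EFin \o Lo : V -> \bar R).
  apply: (@integrableP_bound _ _ _ _ _ Lob iB); apply: measurable_continuous.
  apply: continuous_mul; first exact: continuous_cst.
  by apply: continuous_add; apply: continuous_mul => //; apply: cph; exact: continuous_KT_low.
have iHi : mu.-integrable setT (EFin \o Hi : V -> \bar R).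
  apply: eq_integrable (integrableB measurableT iHa iLo) => // y _.
  by rewrite HE /= -EFinB addrK.
have Hi0 : \int[mu]_y Hi y = 0 by rewrite -rintE// -[RHS](hk k).
have -> : \int[mu]_z H k z = \int[mu]_y Lo y.
  have := Rintegral_affine (- a *: x0) a0 (iH k) => E.
  have -> : \int[mu]_z H k z = a ^+ n.+1 * \int[mu]_x H k (a *: x + (- a *: x0)).
    by rewrite E mulrA -exprMn mulfV ?gt_eqF// expr1n mul1r.
  rewrite -(RintegralZl (a ^+ n.+1) measurableT (integrable_affine (- a *: x0) a0 (iH k))).
  transitivity (\int[mu]_x (Hi x + Lo x)).
    by apply: eq_Rintegral => x _; rewrite HE.
  by rewrite RintegralD// Hi0 add0r.
apply: le_trans (le_normr_Rintegral measurableT iLo) _.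
rewrite -RintegralZl//; by apply: le_Rintegral => //; exact: integrable_norm iLo.
Qed.

End bound.

(** The low part involves neither [f] nor [r] and decays uniformly in [k], whence a constant free of
    the growth order of [f]. The polynomial growth serves only for dominated convergence. *)
Lemma reproducing (A : R) N : 0 < A -> exists2 C : R, 0 < C & forall (r : R) (f : W -> R[i]),
  0 < r -> inEr (A * r) f -> forall x0,
  ((cabs (f x0))%:E <= (C * r ^+ n.+1)%:E * \int[mu]_y (cabs (f y) * wgt N%:R (r *: (y - x0)))%:E)%E.
Proof.
move=> A0; pose c1 : R := 4 * A ^+ 2 + 1.
have c10 : 0 <= c1 by rewrite addr_ge0// mulr_ge0// sqr_ge0.
have [CN CN0 hCN] := KT_decay N (Alg_low c1) (addr_ge0 c10 ler01) (fun k x i => @low_supp R n c1 k x i c10).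
have P0 := PhiC_gt0.
exists (4 * CN / PhiC); first by rewrite divr_gt0// mulr_gt0.
move=> r f r0 Ef x0; have [ca [cb [[C [N0 FC]] hf]]] := Ef.
pose a x := complex.Re (f x); pose b x := complex.Im (f x).
pose F x := cabs (f x).
have F0 x : 0 <= F x by exact: cabs_ge0.
have aF x : `|a x| <= F x.
  rewrite -(@ler_pXn2r _ 2)// ?nnegrE// real_normK ?num_real// sqr_sqrtr ?addr_ge0 ?sqr_ge0//.
  by rewrite lerDl sqr_ge0.
have bF x : `|b x| <= F x.
  rewrite -(@ler_pXn2r _ 2)// ?nnegrE// real_normK ?num_real// sqr_sqrtr ?addr_ge0 ?sqr_ge0//.
  by rewrite lerDr sqr_ge0.
have cF : continuous F by exact: cabs_continuous Ef.
pose g (y : V) := (F y * wgt N%:R (r *: (y - x0)))%:E.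
have g0 y : (0 <= g y)%E by rewrite lee_fin mulr_ge0// wgt_ge0.
have K0 : 0 < 4 * CN / PhiC * r ^+ n.+1 by rewrite mulr_gt0 ?exprn_gt0// divr_gt0// mulr_gt0.
have mg : measurable_fun [set: V] (fun y => F y * wgt N%:R (r *: (y - x0))).
  apply: measurable_continuous; apply: continuous_mul => //.
  under eq_fun do rewrite scalerBr -scalerN.
  exact: continuous_wgt.
have [ioo|] := eqVneq (\int[mu]_y g y)%E +oo%E.
  by rewrite ioo gt0_muley ?lte_fin// leey.
rewrite -ltey => ify.
have ig : mu.-integrable setT g.
  apply/integrableP; split; first exact/measurable_EFinP.
  by under eq_integral do rewrite gee0_abs//.
have h k := hf _ (high_test k x0 A0 r0).
have hE k := funext (fun y => @fourier_high R n c1 k r x0 y r0).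
pose E := 2 * CN * r ^+ n.+1 * \int[mu]_y (F y * wgt N%:R (r *: (y - x0))).
(* The real part of the vanishing pairing. The imaginary part, used next, amounts to replacing [f]
   by [- i f], whose parts are [b] and [- a]. *)
have B1 : `|a x0 * PhiC + b x0 * PhiS| <= E.
  apply: (reproducing_bound r0 hCN ca cb cF aF bF FC _ ig) => k.
  have := congr1 (@complex.Re R) (h k); rewrite -/c1 hE /pairing /=.
  by move=> <-; congr rint; apply/funext => y; rewrite mulrN opprK.
have B2 : `|b x0 * PhiC + (- a x0) * PhiS| <= E.
  have cN : continuous (fun x => - a x) by exact: continuous_opp.
  have aNF x : `|- a x| <= F x by rewrite normrN.
  apply: (reproducing_bound r0 hCN cb cN cF bF aNF FC _ ig) => k.
  have := congr1 (@complex.Im R) (h k); rewrite -/c1 hE /pairing /=.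
  move=> <-; congr rint; apply/funext => y.
  by rewrite /a /b; ring.
have -> : (\int[mu]_y g y = (\int[mu]_y (F y * wgt N%:R (r *: (y - x0))))%:E)%E.
  by rewrite /Rintegral fineK//; exact: integrable_fin_num.
rewrite -EFinM lee_fin -/(F x0).
have -> : 4 * CN / PhiC * r ^+ n.+1 * \int[mu]_x (F x * wgt N%:R (r *: (x - x0))) = 2 * E / PhiC.
  by rewrite /E; field; rewrite gt_eqF.
have E0 : 0 <= E := le_trans (normr_ge0 _) B1.
have Fab : F x0 ^+ 2 = a x0 ^+ 2 + b x0 ^+ 2 by rewrite /F sqr_sqrtr// addr_ge0 ?sqr_ge0.
clearbody E.
rewrite ler_pdivlMr// -(@ler_pXn2r _ 2)// ?nnegrE; [|exact: mulr_ge0 (F0 x0) (ltW P0)|exact: mulr_ge0].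
have S2 (u : R) : `|u| <= E -> u ^+ 2 <= E ^+ 2.
  by move=> uE; rewrite -(real_normK (num_real u)); apply: lerXn2r; rewrite ?nnegrE.
move: (S2 _ B1) (S2 _ B2) => h1 h2.
rewrite exprMn Fab.
(* The two squares add up to [|f|^2 (PhiC^2 + PhiS^2)], so [|f|^2 PhiC^2 <= 2 E^2] whatever the
   value of [PhiS]. *)
have -> : (a x0 ^+ 2 + b x0 ^+ 2) * PhiC ^+ 2 =
  (a x0 * PhiC + b x0 * PhiS) ^+ 2 + (b x0 * PhiC + - a x0 * PhiS) ^+ 2 - (a x0 ^+ 2 + b x0 ^+ 2) * PhiS ^+ 2 by ring.
have : 0 <= (a x0 ^+ 2 + b x0 ^+ 2) * PhiS ^+ 2 by rewrite mulr_ge0 ?addr_ge0 ?sqr_ge0.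
move: (_ * PhiS ^+ 2) h1 h2 => u; move: (sqr_ge0 E); rewrite exprMn; set e := E ^+ 2; set v := _ ^+ 2; set w := _ ^+ 2; clear; lra.
Qed.

End reproducing_inequality.

(** * Peetre maximal functions *)

(** The choice [s = m^(1 / p)] makes [s^(1 - p) m] equal to [s]; for [m = 0], letting [s] tend to 0
    gives [u = 0]. With [le_interpolation] this yields Hoelder's inequality in the form used
    below. *)
Lemma powR_le_of_interpolation (R : realType) (p u a m : R) : 1 <= p -> 0 <= u -> 0 <= a -> 0 <= m ->
  (forall s, 0 < s -> u <= s * a + s `^ (1 - p) * m) -> u `^ p <= (a + 1) `^ p * m.
Proof.
move=> p1 u0 a0 m0 h; have p0 : 0 < p by exact: lt_le_trans p1.
have [m00|mn0] := eqVneq m 0.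
  suff -> : u = 0 by rewrite powR0 ?gt_eqF// m00 mulr0.
  apply/eqP; rewrite eq_le u0 andbT; apply/ler_addgt0Pr => e e0; rewrite add0r.
  have ea : 0 < e / (a + 1) by rewrite divr_gt0// ltr_wpDl.
  apply: le_trans (h _ ea) _; rewrite m00 mulr0 addr0.
  by rewrite mulrAC ler_pdivrMr ?ltr_wpDl// mulrDr mulr1 lerDl ltW.
have mp : 0 < m by rewrite lt_def mn0.
have sp : 0 < m `^ p^-1 by exact: powR_gt0.
have := h _ sp.
have E : (m `^ p^-1) `^ (1 - p) * m = m `^ p^-1.
  rewrite -powRrM -[X in _ * X]powRr1// -powRD ?(gt_eqF mp) ?implybT//.
  by congr (_ `^ _); field; rewrite gt_eqF.
rewrite E -[X in _ + X]mulr1 -mulrDr => h1.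
apply: (@le_trans _ _ ((m `^ p^-1 * (a + 1)) `^ p)).
  by apply: ge0_ler_powR; rewrite ?nnegrE ?(ltW p0)// mulr_ge0 ?addr_ge0// ltW.
by rewrite powRM ?addr_ge0 ?(ltW sp)// -powRrM mulVf ?gt_eqF// powRr1// mulrC.
Qed.

(** Either [u <= s], or [u = u^(1 - p) u^p] with [u^(1 - p) <= s^(1 - p)]. *)
Lemma le_interpolation (R : realType) (p u s : R) : 1 <= p -> 0 <= u -> 0 < s ->
  u <= s + s `^ (1 - p) * u `^ p.
Proof.
move=> p1 u0 s0; have [us|su] := leP u s.
  by apply: (le_trans us); rewrite lerDl mulr_ge0 ?powR_ge0.
have up : 0 < u := lt_trans s0 su.
apply: (@le_trans _ _ (s `^ (1 - p) * u `^ p)); last by rewrite lerDr ltW.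
have uE : u = u `^ (1 - p) * u `^ p.
  by rewrite -powRD ?(gt_eqF up) ?implybT// subrK powRr1// ltW.
rewrite [leLHS]uE; apply: ler_wpM2r; first exact: powR_ge0.
rewrite -(opprB p) !powRN lef_pV2 ?posrE ?powR_gt0//.
by apply: ge0_ler_powR; rewrite ?nnegrE ?subr_ge0 ?(ltW s0) ?(ltW su) ?(ltW up).
Qed.

Lemma mulVKe (R : realType) (a : R) (X : \bar R) : a != 0 -> (a%:E * (a^-1%:E * X) = X)%E.
Proof. by move=> a0; rewrite muleA -EFinM mulfV// mul1e. Qed.

Section maximal.
Context {R : realType} {n : nat}.
Local Notation W := 'rV[R]_n.+1.
Local Notation V := (vec R n).
Local Notation mu := (@lebV R n).
Implicit Types (x y z : W) (F : W -> R) (r s t L K : R).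

Lemma wgtD (a b : R) x : wgt (a + b) x = wgt a x * wgt b x.
Proof. by rewrite /wgt opprD powRD// (gt_eqF (wgt_base_gt0 x)) implybT. Qed.

Lemma wgt_powR (a b : R) x : wgt a x `^ b = wgt (a * b) x.
Proof. by rewrite /wgt -powRrM mulNr. Qed.

Lemma wgt_split s x y z : 0 <= s -> wgt s (z - y) <= wgt (- s) (y - x) * wgt s (z - x).
Proof.
move=> s0; have h := wgtD_le (z - y) (y - x) s0.
have E : wgt (- s) (y - x) * wgt s (y - x) = 1 by rewrite -wgtD addNr /wgt oppr0 powRr0.
have E2 (a b c e : R) : a * b = 1 -> 0 <= a -> c * b <= e -> c <= a * e.
  by move=> ab a0 cb; rewrite -[c]mulr1 -ab mulrCA; exact: ler_wpM2l.
apply: (E2 _ _ _ _ E (wgt_ge0 _ _)).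
by rewrite (_ : z - x = z - y + (y - x))// addrA subrK.
Qed.

Lemma measurable_wgt s (c : R) v : measurable_fun [set: V] (fun x => wgt s (c *: (x - v))).
Proof.
apply: measurable_continuous; under eq_fun do rewrite scalerBr -scalerN.
exact: continuous_wgt.
Qed.

Lemma le_ge0_integralZl (c : R) (g h : V -> R) : 0 <= c ->
  measurable_fun [set: V] g -> measurable_fun [set: V] h ->
  (forall y, 0 <= g y) -> (forall y, 0 <= h y) -> (forall y, g y <= c * h y) ->
  (\int[mu]_y (g y)%:E <= c%:E * \int[mu]_y (h y)%:E)%E.
Proof.
move=> c0 mg mh g0 h0 gh.
rewrite -ge0_integralZl; first last.
- by rewrite lee_fin.
- by move=> y _; rewrite lee_fin.
- exact/measurable_EFinP.
- exact: measurableT.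
apply: ge0_le_integral; first exact: measurableT.
- by move=> y _; rewrite lee_fin.
- exact/measurable_EFinP.
- by apply/measurable_EFinP; exact: measurable_funM.
- by move=> y _; rewrite -EFinM lee_fin.
Qed.

(** The [M_k] of the overview, with the exponent [s] of the weight no longer tied to [sigma t], so
    that different exponents can be compared. *)
Definition Mav F r s t x : \bar R :=
  ((r ^+ n.+1)%:E * \int[mu]_y (F y `^ t * wgt s (r *: (y - x)))%:E)%E.

Lemma Mav_ge0 F r s t x : 0 < r -> (0 <= Mav F r s t x)%E.
Proof.
move=> r0; apply: mule_ge0; first by rewrite lee_fin exprn_ge0// ltW.
by apply: integral_ge0 => y _; rewrite lee_fin mulr_ge0 ?powR_ge0 ?wgt_ge0.
Qed.

Lemma measurable_Mav_integrand F r s t x : continuous F ->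
  measurable_fun [set: V] (fun y => F y `^ t * wgt s (r *: (y - x))).
Proof.
move=> cF; apply: measurable_funM; last exact: measurable_wgt.
by apply: (measurableT_comp (measurable_powR _)); exact: measurable_continuous.
Qed.

Lemma Mav_shift F r s t x y : continuous F -> 0 < r -> 0 <= s ->
  (Mav F r s t y <= (wgt (- s) (r *: (y - x)))%:E * Mav F r s t x)%E.
Proof.
move=> cF r0 s0; rewrite /Mav muleCA; apply: lee_wpmul2l.
  by rewrite lee_fin exprn_ge0// ltW.
apply: le_ge0_integralZl; [exact: wgt_ge0|exact: measurable_Mav_integrand|exact: measurable_Mav_integrand|..].
- by move=> z; rewrite mulr_ge0 ?powR_ge0 ?wgt_ge0.
- by move=> z; rewrite mulr_ge0 ?powR_ge0 ?wgt_ge0.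
move=> z; rewrite mulrCA; apply: ler_wpM2l; first exact: powR_ge0.
by rewrite !scalerBr; exact: wgt_split.
Qed.

Lemma Mav_le F r s s' t x : continuous F -> 0 < r -> s' <= s ->
  (Mav F r s t x <= Mav F r s' t x)%E.
Proof.
move=> cF r0 ss; apply: lee_wpmul2l.
  by rewrite lee_fin exprn_ge0// ltW.
rewrite -[leRHS]mul1e.
apply: le_ge0_integralZl; [by []|exact: measurable_Mav_integrand|exact: measurable_Mav_integrand|..].
- by move=> z; rewrite mulr_ge0 ?powR_ge0 ?wgt_ge0.
- by move=> z; rewrite mulr_ge0 ?powR_ge0 ?wgt_ge0.
by move=> z; rewrite mul1r; apply: ler_wpM2l; [exact: powR_ge0|exact: wgt_le].
Qed.

(* The supremum [B] of [F y * wgt L (r (y - x))] satisfies [B <= K B^(1-t) m], and it is finite by assumption. *)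
Lemma Mav_bootstrap F r x L N t K (m : R) : continuous F -> (forall y, 0 <= F y) ->
  0 < r -> 0 < t -> t <= 1 -> 0 < L -> L <= N%:R -> 0 <= K ->
  (forall y, (F y)%:E <= (K * r ^+ n.+1)%:E * \int[mu]_z (F z * wgt N%:R (r *: (z - y)))%:E)%E ->
  (exists B, forall y, F y * wgt L (r *: (y - x)) <= B) ->
  Mav F r (L * t) t x = m%:E -> F x `^ t <= K * m.
Proof.
move=> cF F0 r0 t0 t1 L0 LN K0 hF [B' hB'] Mm.
have m0 : 0 <= m by rewrite -lee_fin -Mm Mav_ge0.
pose E := range (fun y => F y * wgt L (r *: (y - x))).
have Esup : has_sup E.
  split; first by exists (F x * wgt L (r *: (x - x))), x.
  by exists B' => _ [y _ <-].
pose B := sup E.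
have BE y : F y * wgt L (r *: (y - x)) <= B by apply: sup_upper_bound => //; exists y.
have FxB : F x <= B.
  have := BE x; rewrite subrr scaler0 /wgt /enorm big1 ?sqrtr0 ?addr0 ?powR1 ?mulr1// => i _.
  by rewrite /rcoord mxE expr0n.
have B0 : 0 <= B := le_trans (F0 x) FxB.
have FB z : F z <= B * wgt (- L) (r *: (z - x)).
  have h := wgt_gt0 L (r *: (z - x)).
  by rewrite /wgt powRN ler_pdivlMr.
have key y : F y * wgt L (r *: (y - x)) <= K * B `^ (1 - t) * m.
  have wE : wgt (- L) (r *: (y - x)) * wgt L (r *: (y - x)) = 1 by rewrite -wgtD addNr /wgt oppr0 powRr0.
  suff h : F y <= K * (B `^ (1 - t) * wgt (- L) (r *: (y - x))) * m.
    apply: le_trans (ler_wpM2r (wgt_ge0 _ _) h) _.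
    rewrite le_eqVlt; apply/orP; left; apply/eqP.
    have -> : K * B `^ (1 - t) * m = K * B `^ (1 - t) * m * (wgt (- L) (r *: (y - x)) * wgt L (r *: (y - x))) by rewrite wE mulr1.
    ring.
  rewrite -lee_fin; apply: le_trans (hF y) _.
  rewrite [in leRHS]EFinM -Mm /Mav 2!EFinM -muleA -[leRHS]muleA; apply: lee_wpmul2l; first by rewrite lee_fin.
  rewrite [leRHS]muleCA; apply: lee_wpmul2l; first by rewrite lee_fin exprn_ge0// ltW.
  apply: le_ge0_integralZl.
  - by rewrite mulr_ge0 ?powR_ge0 ?wgt_ge0.
  - by apply: measurable_funM; [exact: measurable_continuous|exact: measurable_wgt].
  - exact: measurable_Mav_integrand.
  - by move=> z; rewrite mulr_ge0 ?wgt_ge0.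
  - by move=> z; rewrite mulr_ge0 ?powR_ge0 ?wgt_ge0.
  move=> z.
  (* Only [F z ^ (1 - t)] is estimated by the supremum [B]. The growth exponent [L (1 - t)] that
     this costs, taken off [L], leaves the exponent [L t] of [Mav]. *)
  have -> : F z * wgt N%:R (r *: (z - y)) = F z `^ t * (F z `^ (1 - t) * wgt N%:R (r *: (z - y))).
    rewrite mulrA -powRD addrCA subrr addr0; first by rewrite powRr1.
    by rewrite oner_eq0.
  rewrite [leRHS]mulrCA; apply: ler_wpM2l; first exact: powR_ge0.
  have h1 : F z `^ (1 - t) <= B `^ (1 - t) * wgt (- L * (1 - t)) (r *: (z - x)).
    rewrite -wgt_powR -powRM ?wgt_ge0//.
    by apply: ge0_ler_powR; rewrite ?nnegrE ?subr_ge0 ?mulr_ge0 ?wgt_ge0.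
  have h2 : wgt N%:R (r *: (z - y)) <= wgt (- L) (r *: (y - x)) * wgt L (r *: (z - x)).
    apply: le_trans (wgt_le _ LN) _.
    by rewrite !scalerBr; exact: wgt_split (ltW L0).
  apply: le_trans (ler_pM (powR_ge0 _ _) (wgt_ge0 _ _) h1 h2) _.
  rewrite (_ : L * t = - L * (1 - t) + L); last by ring.
  have aux (b u v w : R) : b * u * (v * w) <= b * v * (u * w).
    by rewrite le_eqVlt; apply/orP; left; apply/eqP; ring.
  by rewrite wgtD; exact: aux.
have BK : B <= K * B `^ (1 - t) * m.
  by apply: ge_sup => [|_ [y _ <-]]; [case: Esup|exact: key].
have [Fx0|Fx0] := eqVneq (F x) 0; first by rewrite Fx0 powR0 ?gt_eqF// mulr_ge0.
have Bp : 0 < B by apply: lt_le_trans FxB; rewrite lt_def Fx0 F0.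
apply: (@le_trans _ _ (B `^ t)); first by apply: ge0_ler_powR; rewrite ?nnegrE// ltW.
have P0 : 0 < B `^ (1 - t) by exact: powR_gt0.
rewrite -(ler_pM2l P0) -powRD; last by rewrite (gt_eqF Bp) implybT.
by rewrite subrK powRr1// (le_trans BK)// le_eqVlt; apply/orP; left; apply/eqP; ring.
Qed.

Definition wgt_mass b : R := \int[mu]_x wgt b x.

Lemma integral_wgt b (r : R) x : n.+1%:R < b -> 0 < r ->
  ((r ^+ n.+1)%:E * \int[mu]_y (wgt b (r *: (y - x)))%:E)%E = (wgt_mass b)%:E.
Proof.
move=> nb r0; have ib := integrable_wgt nb.
have w0 z : (0 <= (wgt b z)%:E)%E by rewrite lee_fin wgt_ge0.
have h := ge0_integral_affine (- (r *: x)) r0 (measurable_int mu ib) w0.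
under eq_integral do rewrite scalerBr.
rewrite [in LHS]h.
rewrite exprVn.
rewrite mulVKe; last by rewrite expf_neq0// gt_eqF.
by rewrite /wgt_mass /Rintegral fineK//; exact: integrable_fin_num.
Qed.

Lemma wgt_mass_ge0 b : 0 <= wgt_mass b.
Proof. by apply: Rintegral_ge0 => x _; exact: wgt_ge0. Qed.

Lemma Mav_interpolation F r b t p s x : continuous F -> 0 < r -> n.+1%:R < b -> 1 <= p -> 0 < s ->
  (Mav F r b t x <= (s * wgt_mass b)%:E + (s `^ (1 - p))%:E * Mav F r b (t * p) x)%E.
Proof.
move=> cF r0 nb p1 s0.
have rd0 : (0 <= (r ^+ n.+1)%:E)%E by rewrite lee_fin exprn_ge0// ltW.
rewrite EFinM -(integral_wgt x nb r0) /Mav muleCA [X in (_ + X)%E]muleCA -ge0_muleDr//; last 2 first.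
- by apply: mule_ge0; [rewrite lee_fin ltW|apply: integral_ge0 => y _; rewrite lee_fin wgt_ge0].
- apply: mule_ge0; first by rewrite lee_fin powR_ge0.
  by apply: integral_ge0 => y _; rewrite lee_fin mulr_ge0 ?powR_ge0 ?wgt_ge0.
apply: lee_wpmul2l => //.
have mw := @measurable_wgt b r x; have mF := measurable_Mav_integrand r b (t * p) x cF.
have mw' : measurable_fun [set: V] (fun y => (wgt b (r *: (y - x)))%:E) by exact/measurable_EFinP.
have mF' : measurable_fun [set: V] (fun y => (F y `^ (t * p) * wgt b (r *: (y - x)))%:E) by exact/measurable_EFinP.
rewrite -ge0_integralZl//; [|by move=> y _; rewrite lee_fin wgt_ge0|by rewrite lee_fin ltW].
rewrite -ge0_integralZl//; [|by move=> y _; rewrite lee_fin mulr_ge0 ?powR_ge0 ?wgt_ge0|by rewrite lee_fin powR_ge0].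
have mw2 : measurable_fun [set: V] (fun y => s%:E * (wgt b (r *: (y - x)))%:E)%E.
  by apply/measurable_EFinP; exact: measurable_funM.
have mF2 : measurable_fun [set: V] (fun y => (s `^ (1 - p))%:E * (F y `^ (t * p) * wgt b (r *: (y - x)))%:E)%E.
  by apply/measurable_EFinP; exact: measurable_funM.
rewrite -ge0_integralD//; [|by move=> y _; rewrite -EFinM lee_fin mulr_ge0 ?wgt_ge0// ltW|
  by move=> y _; rewrite -EFinM lee_fin !mulr_ge0 ?powR_ge0 ?wgt_ge0].
apply: ge0_le_integral.
- exact: measurableT.
- by move=> y _; rewrite lee_fin mulr_ge0 ?powR_ge0 ?wgt_ge0.
- by apply/measurable_EFinP; exact: measurable_Mav_integrand.
- exact: emeasurable_funD.
move=> y _; rewrite -!EFinM -EFinD lee_fin mulrA -mulrDl; apply: ler_wpM2r; first exact: wgt_ge0.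
by rewrite powRrM; apply: le_interpolation => //; exact: powR_ge0.
Qed.

(** Hoelder's inequality for a measure of mass [wgt_mass b], obtained by integrating a pointwise
    interpolation for every [s] and choosing [s] afterwards. *)
Lemma Mav_power F r b t p x : continuous F -> 0 < r -> n.+1%:R < b -> 1 <= p ->
  (Mav F r b t x `^ p <= ((wgt_mass b + 1) `^ p)%:E * Mav F r b (t * p) x)%E.
Proof.
move=> cF r0 nb p1; have C0 : 0 < (wgt_mass b + 1) `^ p by rewrite powR_gt0// ltr_wpDl// wgt_mass_ge0.
have := Mav_interpolation t x cF r0 nb p1; have := Mav_ge0 F b t x r0; have := Mav_ge0 F b (t * p) x r0.
case: (Mav F r b (t * p) x) => [m|_ _ _|//]; last by rewrite gt0_muley ?lte_fin// leey.
rewrite lee_fin => m0; case: (Mav F r b t x) => [u|_ /(_ 1 ltr01)//|//].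
rewrite lee_fin => u0 h; rewrite poweR_EFin -EFinM lee_fin.
apply: powR_le_of_interpolation => //; first exact: wgt_mass_ge0.
Qed.

(* The bootstrap with an exponent exceeding the growth order of [F] makes the supremum for [sigma] finite;
   the bootstrap with [sigma] itself then removes the dependence of the constant on that growth order. *)
Lemma Mav_pointwise_le1 F r N0 (C0 : R) N t sigma (K : nat -> R) : continuous F -> (forall y, 0 <= F y) ->
  (forall x, F x <= C0 * (1 + enorm x) ^+ N0) ->
  0 < r -> 0 < t -> t <= 1 -> 0 < sigma -> sigma <= N%:R -> (forall N, 0 < K N) ->
  (forall N y, (F y)%:E <= (K N * r ^+ n.+1)%:E * \int[mu]_z (F z * wgt N%:R (r *: (z - y)))%:E)%E ->
  forall x, ((F x `^ t)%:E <= (K N)%:E * Mav F r (sigma * t) t x)%E.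
Proof.
move=> cF F0 FC r0 t0 t1 s0 sN K0 hF x.
have := Mav_ge0 F (sigma * t) t x r0.
case Mm : (Mav F r (sigma * t) t x) => [m||]; [|by move=> _; rewrite gt0_muley ?lte_fin// leey|by []].
rewrite lee_fin => m0; rewrite -EFinM lee_fin.
apply: (Mav_bootstrap cF F0 r0 t0 t1 s0 sN (ltW (K0 N)) (hF N) _ Mm).
pose N1 := (N + N0)%N.
have N1s : sigma <= N1%:R by apply: (le_trans sN); rewrite ler_nat leq_addr.
have N10 : 0 < N1%:R :> R := lt_le_trans s0 N1s.
have st0 : 0 <= sigma * t by rewrite mulr_ge0 ?ltW.
have Ft y : F y `^ t <= K N1 * (wgt (- (sigma * t)) (r *: (y - x)) * m).
  have h1 : (Mav F r (N1%:R * t) t y <= (wgt (- (sigma * t)) (r *: (y - x)) * m)%:E)%E.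
    apply: (@le_trans _ _ (Mav F r (sigma * t) t y)); first by apply: Mav_le => //; rewrite ler_pM2r.
    by rewrite EFinM -Mm; exact: Mav_shift.
  have := Mav_ge0 F (N1%:R * t) t y r0.
  case Mm1 : (Mav F r (N1%:R * t) t y) h1 => [m1||]//; rewrite lee_fin => h1 _.
  apply: (@le_trans _ _ (K N1 * m1)); last by rewrite ler_pM2l.
  apply: (Mav_bootstrap cF F0 r0 t0 t1 N10 (lexx _) (ltW (K0 N1)) (hF N1) _ Mm1).
  have [C1 C10 hC1] := growth_shift y r0 FC.
  exists C1 => z; rewrite wgt_nat.
  rewrite ler_pdivrMr ?exprn_gt0 ?wgt_base_gt0//; apply: le_trans (hC1 z) _.
  by apply: ler_wpM2l => //; apply: ler_weXn2l; [exact: wgt_base|exact: leq_addl].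
exists ((K N1 * m) `^ t^-1) => y.
have tn0 : t != 0 by rewrite gt_eqF.
have Fy : F y = (F y `^ t) `^ t^-1 by rewrite -powRrM mulfV// powRr1.
have wy : wgt sigma (r *: (y - x)) = (wgt (sigma * t) (r *: (y - x))) `^ t^-1 by rewrite wgt_powR mulfK.
rewrite Fy wy -powRM ?powR_ge0 ?wgt_ge0//.
apply: ge0_ler_powR; rewrite ?invr_ge0 ?(ltW t0) ?nnegrE ?mulr_ge0 ?powR_ge0 ?wgt_ge0 ?(ltW (K0 _))//.
apply: le_trans (ler_wpM2r (wgt_ge0 _ _) (Ft y)) _.
have E : wgt (- (sigma * t)) (r *: (y - x)) * wgt (sigma * t) (r *: (y - x)) = 1.
  by rewrite -wgtD addNr /wgt oppr0 powRr0.
have aux (a b c e : R) : b * e = 1 -> a * (b * c) * e <= a * c.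
  move=> be; have -> : a * (b * c) * e = a * c * (b * e) by ring.
  by rewrite be mulr1.
exact: aux.
Qed.

(** For [t <= 1] this is the bootstrap. For [t > 1] the reproducing inequality is raised to the
    power [t] by Hoelder's inequality; [N] exceeds the dimension, to have finite mass, and
    [sigma t], to dominate the kernel by the required weight. *)
Lemma Mav_pointwise (A t sigma : R) : 0 < A -> 0 < t -> 0 < sigma ->
  exists2 C : R, 0 < C & forall (r : R) (f : W -> R[i]), 0 < r -> inEr (A * r) f ->
  forall x, ((cabs (f x) `^ t)%:E <= C%:E * Mav (fun y => cabs (f y)) r (sigma * t) t x)%E.
Proof.
move=> A0 t0 s0.
have [K hK] : exists K : nat -> R, forall N, 0 < K N /\ forall (r : R) (f : W -> R[i]),
  0 < r -> inEr (A * r) f -> forall x0,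
  ((cabs (f x0))%:E <= (K N * r ^+ n.+1)%:E * \int[mu]_y (cabs (f y) * wgt N%:R (r *: (y - x0)))%:E)%E.
  suff /choice : forall N, exists C, 0 < C /\ forall (r : R) (f : W -> R[i]),
    0 < r -> inEr (A * r) f -> forall x0,
    ((cabs (f x0))%:E <= (C * r ^+ n.+1)%:E * \int[mu]_y (cabs (f y) * wgt N%:R (r *: (y - x0)))%:E)%E.
    by case=> K hK; exists K.
  by move=> N; have [C C0 hC] := @reproducing R n A N A0; exists C.
have K0 N : 0 < K N by have [] := hK N.
have [t1|t1] := leP t 1.
  pose N := (Num.trunc sigma).+1.
  exists (K N) => // r f r0 Ef x; have cF := cabs_continuous Ef.
  have [_ [_ [[C0 [N0 FC]] _]]] := Ef.
  apply: (Mav_pointwise_le1 cF _ FC r0 t0 t1 s0 _ K0).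
  - by move=> y; exact: sqrtr_ge0.
  - by have /andP[_ /ltW] := truncn_itv (ltW s0).
  - by move=> M; have [_] := hK M; exact.
pose b := sigma * t + n.+1%:R.
have b0 : 0 <= b by rewrite addr_ge0 ?mulr_ge0 ?ltW.
pose N := (Num.trunc b).+1.
have bN : b < N%:R by have /andP[] := truncn_itv b0.
have st0 : 0 < sigma * t by exact: mulr_gt0.
have nN : n.+1%:R < N%:R :> R by apply: lt_trans bN; rewrite ltrDr.
have sN : sigma * t <= N%:R by apply: le_trans (ltW bN); rewrite lerDl.
exists (K N `^ t * (wgt_mass N%:R + 1) `^ t).
  by rewrite mulr_gt0 ?powR_gt0// ltr_wpDl// wgt_mass_ge0.
move=> r f r0 Ef x; have cF := cabs_continuous Ef; set F := fun y => cabs (f y).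
have F0 y : 0 <= F y by exact: sqrtr_ge0.
have h1 : ((F x)%:E <= (K N)%:E * Mav F r N%:R 1 x)%E.
  have [_ /(_ r f r0 Ef x) h] := hK N; apply: (le_trans h).
  rewrite EFinM -muleA /Mav le_eqVlt; apply/orP; left; apply/eqP; congr (_ * (_ * _))%E.
  by apply: eq_integral => y _; rewrite powRr1.
have M0 := Mav_ge0 F N%:R 1 x r0.
have h2 : ((F x `^ t)%:E <= ((K N)%:E * Mav F r N%:R 1 x) `^ t)%E.
  rewrite -poweR_EFin; apply: gt0_ler_poweR; rewrite ?(ltW t0)// ?in_itv/= ?lee_fin ?F0 ?leey//.
  by rewrite mule_ge0// lee_fin ltW.
have KN0 : (0 <= (K N)%:E)%E by rewrite lee_fin ltW.
apply: (le_trans h2); rewrite (poweRM t KN0 M0) poweR_EFin.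
rewrite EFinM -muleA; apply: lee_wpmul2l; first by rewrite lee_fin powR_ge0.
have := Mav_power 1 x cF r0 nN (ltW t1); rewrite mul1r => h; apply: (le_trans h).
apply: lee_wpmul2l; first by rewrite lee_fin powR_ge0.
exact: Mav_le.
Qed.

End maximal.

(** * Peetre maximal functions and their infima over dyadic cubes *)

Section dyadic_peetre.
Context {R : realType} {n : nat}.
Local Notation W := 'rV[R]_n.+1.
Local Notation V := (vec R n).
Local Notation mu := (@lebV R n).
Implicit Types (x y z : W) (j k : int).

Lemma flo_dist k x y : flo k x = flo k y -> enorm ((2 : R) ^ k *: (x - y)) <= n.+1%:R.
Proof.
move=> xy; rewrite -[leRHS]mulr1; apply: enorm_le_coord => i.
have := congr1 (fun m : 'rV[int]_n.+1 => m ord0 i) xy; rewrite !mxE => E.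
rewrite /rcoord !mxE mulrBr -/(rcoord x i) -/(rcoord y i).
have := floor_itv ((2 : R) ^ k * rcoord x i); have := floor_itv ((2 : R) ^ k * rcoord y i).
rewrite E rmorphD /= rmorph1 => /andP[h1 h2] /andP[h3 h4].
by move: (_%:~R) h1 h2 h3 h4 => a h1 h2 h3 h4; rewrite ler_norml; lra.
Qed.

(** Nesting of dyadic cubes, by the identity [floor (floor (a v) / a) = floor v] for a positive
    integer [a], here a power of 2. *)
Lemma flo_corner_flo j k x : j <= k -> flo j (corner k (flo k x) : W) = flo j x.
Proof.
move=> jk; have [N ->] : exists N : nat, k = j + N%:Z.
  by exists `|k - j|%N; rewrite gez0_abs ?subr_ge0//; ring.
apply/rowP => i; rewrite !mxE; set u := rcoord x i.
have aE : (2 : R) ^ (j + N%:Z) = (2 ^ N)%N%:R * (2 : R) ^ j by rewrite expfzDr ?pnatr_eq0// -exprnP natrX mulrC.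
rewrite /rcoord !mxE -/u.
have j0 := (two_gt0 j : 0 < (2 : R) ^ j).
set a : R := (2 ^ N)%N%:R.
have a0 : 0 < a by rewrite ltr0n expn_gt0.
have E : (2 : R) ^ j * ((2 : R) ^ (- (j + N%:Z)) * (Num.floor ((2 : R) ^ (j + N%:Z) * u))%:~R) =
   a^-1 * (Num.floor (a * ((2 : R) ^ j * u)))%:~R.
  rewrite -invr_expz aE -/a mulrA -(mulrA a); congr (_ * _).
  by field; rewrite !gt_eqF.
rewrite E; set v := 2 ^ j * u.
have /andP[h1 h2] := floor_itv v.
apply: floor_def; rewrite ler_pdivlMl// ltr_pdivrMl//; apply/andP; split.
  have -> : a * (Num.floor v)%:~R = ((2 ^ N)%N%:Z * Num.floor v)%:~R :> R by rewrite rmorphM.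
  by rewrite ler_int floor_ge_int rmorphM /= ler_pM2l.
apply: (@le_lt_trans _ _ (a * v)); first exact: floor_le.
by rewrite ltr_pM2l.
Qed.

Section peetre.
Variables (t sigma : R).
Hypotheses (t0 : 0 < t) (s0 : 0 < sigma).
Let s := sigma * t.

Lemma peetreE k (f : W -> R[i]) x : continuous (fun y => cabs (f y)) ->
  peetre t%:E sigma k f x = (Mav (fun y => cabs (f y)) ((2 : R) ^ k) s t x `^ t^-1)%E.
Proof.
move=> cf; have r0 := (two_gt0 k : 0 < (2 : R) ^ k).
rewrite /peetre /Mav div1r poweRM; last 2 first.
- by rewrite lee_fin exprn_ge0// ltW.
- by apply: integral_ge0 => y _; rewrite lee_fin mulr_ge0 ?powR_ge0 ?wgt_ge0.
have -> : (((2 : R) `^ (k%:~R * n.+1%:R / t))%R%:E = (((2 : R) ^ k) ^+ n.+1)%R%:E `^ t^-1)%E.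
  rewrite poweR_EFin; congr EFin; rewrite powRrM; congr (_ `^ _).
  by rewrite powRrM powR_intmul// powR_mulrn// ltW.
congr (_ * (_ `^ _))%E.
pose g y : \bar R := (cabs (f y) `^ t * wgt s ((2 : R) ^ k *: (y - x)))%:E.
have mg : measurable_fun [set: V] g by apply/measurable_EFinP; exact: measurable_Mav_integrand.
have g0 y : (0 <= g y)%E by rewrite lee_fin mulr_ge0 ?powR_ge0 ?wgt_ge0.
have mg' : measurable_fun [set: V] (fun y : V => g (1 *: y + x)%R).
  exact: (measurableT_comp mg (measurable_affine x ltr01)).
have E y : (((cabs (f (x - y)) * (1 + (2 : R) ^ k * enorm y) `^ (- sigma)) `^ t)%:E = g (1 *: (- y) + x)%R)%E.
  rewrite /g scale1r addrK addrC; congr EFin.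
  rewrite powRM ?powR_ge0 ?cabs_ge0//; congr (_ * _).
  by rewrite -powRrM /wgt scalerN enormN enormZ ?(ltW r0)// mulNr.
rewrite lintE; first last.
- by move=> y; rewrite lee_fin powR_ge0.
- under eq_fun do rewrite E.
  exact: (measurableT_comp mg' measurable_oppV).
under eq_integral do rewrite E.
have h1 := ge0_integral_opp mg' (fun y => g0 _).
have h2 := ge0_integral_affine x ltr01 mg g0.
have e1 : ((1 : R)^-1 ^+ n.+1)%:E = 1%E by rewrite invr1 expr1n.
rewrite e1 mul1e in h2.
by apply: (etrans h1); exact: h2.
Qed.

Lemma peetre_ge0 k (f : W -> R[i]) x : (0 <= peetre t%:E sigma k f x)%E.
Proof.
by rewrite /peetre mule_ge0 ?poweR_ge0// lee_fin powR_ge0.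
Qed.

Definition peetre_inf k (f : W -> R[i]) m : \bar R :=
  ereal_inf [set peetre t%:E sigma k f y | y in dcube k m].

Lemma peetre_inf_ge0 k f m : (0 <= peetre_inf k f m)%E.
Proof. by apply: le_ereal_inf_tmp => _ [y _ <-]; exact: peetre_ge0. Qed.

(** Two points of a cube of level [k] are at distance at most [n.+1] after scaling by [2^k], so
    [Mav_shift] passes from [x] to any point of the cube at the cost of [(1 + n.+1)^s]. *)
Lemma peetre_inf_lower (A : R) : 0 < A -> exists2 C : R, 0 < C & forall k (f : W -> R[i]),
  inEr (A * (2 : R) ^ k) f -> forall x, ((cabs (f x))%:E <= C%:E * peetre_inf k f (flo k x))%E.
Proof.
move=> A0; have [C C0 hC] := @Mav_pointwise R n A t sigma A0 t0 s0.
have ss0 : 0 <= s by rewrite mulr_ge0// ltW.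
pose C' := C * (1 + n.+1%:R) `^ s.
have C'0 : 0 < C' by rewrite mulr_gt0 ?powR_gt0.
exists (C' `^ t^-1); first by rewrite powR_gt0.
move=> k f Ef x; have cf := cabs_continuous Ef; have r0 := (two_gt0 k : 0 < (2 : R) ^ k).
have D0 : 0 < C' `^ t^-1 by rewrite powR_gt0.
rewrite muleC -lee_pdivrMr//; apply: le_ereal_inf_tmp => _ [y /dcubeE xy <-].
rewrite lee_pdivrMr// muleC peetreE//.
set M := Mav _ _ _ _ _; have M0 : (0 <= M)%E by exact: Mav_ge0.
rewrite -poweR_EFin -poweRM// ?lee_fin ?(ltW C'0)//.
have -> : (cabs (f x))%:E = ((cabs (f x) `^ t)%:E `^ t^-1)%E.
  by rewrite poweR_EFin -powRrM mulfV ?gt_eqF// powRr1// cabs_ge0.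
have h : ((cabs (f x) `^ t)%:E <= C'%:E * M)%E.
  apply: le_trans (hC _ f r0 Ef x) _; rewrite EFinM -muleA; apply: lee_wpmul2l; first by rewrite lee_fin ltW.
  apply: le_trans (Mav_shift _ y x cf r0 ss0) _; apply: lee_wpmul2r => //.
  rewrite lee_fin /wgt opprK; apply: ge0_ler_powR; rewrite ?nnegrE ?addr_ge0 ?enorm_ge0//.
  by rewrite lerD2l; apply: flo_dist; rewrite xy.
apply: gt0_ler_poweR; rewrite ?invr_ge0 ?(ltW t0)// ?in_itv/= ?leey ?andbT//.
  by rewrite lee_fin powR_ge0.
by apply: mule_ge0 => //; rewrite lee_fin ltW.
Qed.

(** The infimum is at most the value at [x], and [Mav_power] with exponent [q / t >= 1] raises the
    integrability from [t] to [q]. *)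
Lemma peetre_inf_upper (q : R) k (f : W -> R[i]) x : continuous (fun y => cabs (f y)) ->
  n.+1%:R < s -> t <= q ->
  (peetre_inf k f (flo k x) `^ q <=
     ((@wgt_mass R n s + 1) `^ (q / t))%:E * Mav (fun y => cabs (f y)) ((2 : R) ^ k) s q x)%E.
Proof.
move=> cf ns tq; have r0 := (two_gt0 k : 0 < (2 : R) ^ k); have q0 : 0 < q := lt_le_trans t0 tq.
have p1 : 1 <= q / t by rewrite ler_pdivlMr// mul1r.
have tq' : t * (q / t) = q by rewrite mulrCA mulfV ?mulr1// gt_eqF.
have := Mav_power t x cf r0 ns p1; rewrite tq'; apply: le_trans.
rewrite mulrC poweRrM -peetreE//; apply: gt0_ler_poweR; first exact: ltW.
- by rewrite in_itv/= leey andbT peetre_inf_ge0.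
- by rewrite in_itv/= leey andbT peetre_ge0.
by apply: ereal_inf_lbound; exists x => //; exact/dcubeE.
Qed.

End peetre.
End dyadic_peetre.

(** * Averages over dyadic cubes *)

Section averaging.
Context {R : realType} {n : nat}.
Local Notation W := 'rV[R]_n.+1.
Local Notation V := (vec R n).
Local Notation mu := (@lebV R n).
Local Notation ind j m x := ((\1_(dcube j m : set V) x)%:E).
Implicit Types (x y z : W) (j k : int) (F : W -> R) (H : V -> \bar R).

Lemma measurable_flo_prod k d (T : measurableType d) (G : 'rV[int]_n.+1 -> V -> T) :
  (forall m, measurable_fun [set: V] (G m)) ->
  measurable_fun [set: V * V] (fun p => G (flo k p.1) p.2).
Proof.
move=> mG _ B mB; rewrite setTI.
rewrite (_ : _ @^-1` B = \bigcup_m ((dcube k m : set V) `*` (G m @^-1` B))).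
  apply: countable_bigcupT_measurable; first exact: countableP.
  move=> m; apply: measurableX; first exact: measurable_dcube.
  by rewrite -[X in measurable X]setTI; exact: mG.
apply/seteqP; split => -[x y] /=.
  by move=> Bx; exists (flo k x) => //; split => //=; exact/dcubeE.
by move=> [m _ [/= /dcubeE ->]].
Qed.

(** The sigma-algebra is the product one, so [measurable_continuous] does not apply directly. With
    the first variable replaced by a dyadic corner, the function depends on the second variable
    alone over each cube. *)
Lemma measurable_difference (u : W -> R) : continuous u ->
  measurable_fun [set: V * V] (fun p => u ((p.2 : W) - p.1)).
Proof.
move=> cu.
apply: (@measurable_fun_cvg _ _ R setT (fun (k : nat) (p : V * V) => u ((p.2 : W) - corner k%:Z (flo k%:Z p.1)))).
  move=> k; apply: (@measurable_flo_prod k%:Z _ (measurableTypeR R) (fun m y => u ((y : W) - corner k%:Z m))) => m.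
  apply: measurable_continuous.
  have := @continuous_comp_affine _ _ u 1 (- corner k%:Z m) cu.
  by under eq_fun do rewrite scale1r.
move=> [x y] _ /=.
have cv : ((y : W) - corner k%:Z (flo k%:Z x)) @[k --> \oo] --> (y : W) - x.
  by apply: cvgB; [exact: cvg_cst|exact: corner_flo_cvg].
by apply: (cvg_comp (fun k : nat => (y : W) - corner k%:Z (flo k%:Z x)) u cv); exact: cu.
Qed.

Lemma lebV_integralZl (c : \bar R) H : (0 <= c)%E -> (forall y, 0 <= H y)%E ->
  measurable_fun [set: V] H -> (\int[mu]_y (c * H y) = c * \int[mu]_y H y)%E.
Proof. by move=> c0 H0 mH; apply: ge0_integralZl => //; exact: measurableT. Qed.

Lemma lebV_le_integral H H' : (forall y, 0 <= H y)%E -> measurable_fun [set: V] H ->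
  measurable_fun [set: V] H' -> (forall y, H y <= H' y)%E -> (\int[mu]_y H y <= \int[mu]_y H' y)%E.
Proof. by move=> H0 mH mH' HH'; apply: ge0_le_integral => //; exact: measurableT. Qed.

Lemma measurable_mulE H H' : measurable_fun [set: V] H -> measurable_fun [set: V] H' ->
  measurable_fun [set: V] (fun y => H y * H' y)%E.
Proof. by move=> mH mH'; exact: emeasurable_funM. Qed.

Definition cube_avg k H m : \bar R :=
  ((((2 : R) ^ k) ^+ n.+1)%:E * \int[mu]_y (ind k m y * H y))%E.

Lemma measurable_indic_mul (D : set V) H : measurable D -> measurable_fun [set: V] H ->
  measurable_fun [set: V] (fun y => (\1_D y)%:E * H y)%E.
Proof.
by move=> mD mH; apply: emeasurable_funM => //; apply/measurable_EFinP; exact: measurable_indic.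
Qed.

Lemma indic_ge0 (D : set V) H y : (forall y, 0 <= H y)%E -> (0 <= (\1_D y)%:E * H y)%E.
Proof. by move=> H0; apply: mule_ge0 => //; rewrite lee_fin. Qed.

Lemma cube_avg_ge0 k H m : (forall y, 0 <= H y)%E -> (0 <= cube_avg k H m)%E.
Proof.
move=> H0; apply: mule_ge0; first by rewrite lee_fin exprn_ge0// ltW// two_gt0.
by apply: integral_ge0 => y _; exact: indic_ge0.
Qed.

(* Tonelli for the symmetric kernel "[x] and [y] are in the same cube of level [k]". *)
Lemma flo_average k (G : 'rV[int]_n.+1 -> \bar R) H :
  (forall m, 0 <= G m)%E -> (forall y, 0 <= H y)%E -> measurable_fun [set: V] H ->
  (\int[mu]_x (G (flo k x) * cube_avg k H (flo k x)) = \int[mu]_y (G (flo k y) * H y))%E.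
Proof.
move=> G0 H0 mH; set rd : R := ((2 : R) ^ k) ^+ n.+1.
have rd0 : 0 < rd by rewrite exprn_gt0// two_gt0.
have rd0' : (0 <= rd%:E)%E by rewrite lee_fin ltW.
pose h (p : V * V) : \bar R := (G (flo k p.1) * (rd%:E * ((\1_(dcube k (flo k p.1) : set V) p.2)%:E * H p.2)))%E.
have mi m := measurable_indic_mul (@measurable_dcube R n k m) mH.
have h0 p : (0 <= h p)%E by rewrite mule_ge0// mule_ge0//; exact: indic_ge0.
have mh : measurable_fun [set: V * V] h.
  apply: (@measurable_flo_prod k _ (\bar R) (fun m y => G m * (rd%:E * (ind k m y * H y)))%E) => m.
  apply: measurable_mulE; first exact: measurable_cst.
  by apply: measurable_mulE; [exact: measurable_cst|exact: mi].
transitivity (\int[mu]_x \int[mu]_y h (x, y))%E.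
  apply: eq_integral => x _; rewrite /h /cube_avg /=.
  have i0 y : (0 <= (\1_(dcube k (flo k x) : set V) y)%:E * H y)%E by exact: indic_ge0.
  rewrite lebV_integralZl; first rewrite lebV_integralZl; first by [].
  - exact: rd0'.
  - exact: i0.
  - exact: mi.
  - exact: G0.
  - by move=> y; apply: mule_ge0; [exact: rd0'|exact: i0].
  - by apply: measurable_mulE; [exact: measurable_cst|exact: mi].
rewrite (fubini_tonelli (m1 := @lebV R n) (m2 := @lebV R n) h mh h0).
apply: eq_integral => y _.
have E x : h (x, y) = (G (flo k y) * (rd%:E * H y) * (\1_(dcube k (flo k y) : set V) x)%:E)%E.
  rewrite /h /= !indicE.
  have [xy|xy] := eqVneq (flo k x) (flo k y).
    by rewrite !mem_set ?mul1e ?mule1 ?xy//; exact/dcubeE.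
  by rewrite !memNset ?mul0e ?mule0//; move/dcubeE/esym/eqP; rewrite ?(negPf xy)// eq_sym (negPf xy).
under eq_integral do rewrite E.
rewrite lebV_integralZl; first last.
- by apply/measurable_EFinP; apply: measurable_indic; exact: measurable_dcube.
- by move=> x; rewrite lee_fin.
- by rewrite mule_ge0// mule_ge0.
rewrite integral_indic ?setIT//; last exact: measurable_dcube.
rewrite [X in (_ * X)%E](_ : _ = (dlen k ^+ n.+1)%:E); last exact: lebo_dcube.
rewrite -muleA; congr (_ * _)%E; rewrite muleAC -EFinM.
have -> : rd * dlen k ^+ n.+1 = 1.
  by rewrite /rd /dlen -invr_expz -exprMn mulfV ?expr1n// gt_eqF// two_gt0.
by rewrite mul1e.
Qed.

Lemma wgt_near (s r : R) x y z (D : R) : 0 <= s -> enorm (r *: (y - x)) <= D ->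
  wgt s (r *: (z - y)) <= (1 + D) `^ s * wgt s (r *: (z - x)).
Proof.
move=> s0 D0; have e0 := enorm_ge0 (r *: (y - x)).
apply: (@le_trans _ _ (wgt (- s) (r *: (y - x)) * wgt s (r *: (z - x)))).
  by rewrite !scalerBr; exact: wgt_split.
apply: ler_wpM2r; first exact: wgt_ge0.
by rewrite /wgt opprK; apply: ge0_ler_powR; rewrite ?nnegrE ?addr_ge0 ?lerD2l//; exact: le_trans D0.
Qed.

(** At scale [2^k] the weight is nearly constant on each cube of level [k]. Freezing it at the
    corners allows [H] to be replaced by its averages, bounded by [X]; freezing and unfreezing cost
    [(1 + n.+1)^s] each. *)
Lemma wgt_cube_avg (s : R) k H (X : \bar R) x0 : n.+1%:R < s ->
  (forall y, 0 <= H y)%E -> measurable_fun [set: V] H ->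
  (forall m, cube_avg k H m <= X)%E ->
  ((((2 : R) ^ k) ^+ n.+1)%:E * \int[mu]_y ((wgt s ((2 : R) ^ k *: (y - x0)))%:E * H y) <=
     ((1 + n.+1%:R) `^ s * (1 + n.+1%:R) `^ s * @wgt_mass R n s)%:E * X)%E.
Proof.
move=> ns H0 mH HX; set r : R := 2 ^ k; set D : R := (1 + n.+1%:R) `^ s.
have r0 : 0 < r by exact: two_gt0.
have D0 : 0 <= D by exact: powR_ge0.
have s0 : 0 <= s by apply: le_trans (ltW ns).
have X0 : (0 <= X)%E by apply: le_trans (HX 0); exact: cube_avg_ge0.
pose G m : \bar R := (wgt s (r *: (corner k m - x0)))%:E.
have G0 m : (0 <= G m)%E by rewrite lee_fin wgt_ge0.
have cE x : flo k (corner k (flo k x) : W) = flo k x by exact: flo_corner_flo.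
have mG : measurable_fun [set: V] (fun y => G (flo k y)) by exact: measurable_flo.
have mw : measurable_fun [set: V] (fun y => (wgt s (r *: (y - x0)))%:E).
  by apply/measurable_EFinP; exact: measurable_wgt.
have wN (u v : W) : wgt s (r *: (u - v)) = wgt s (r *: (v - u)) by rewrite -wgtN -scalerN opprB.
have h1 : (\int[mu]_y ((wgt s (r *: (y - x0)))%:E * H y) <= D%:E * \int[mu]_y (G (flo k y) * H y))%E.
  have mGH : measurable_fun [set: V] (fun y => G (flo k y) * H y)%E by apply: measurable_mulE.
  rewrite -lebV_integralZl; [|by rewrite lee_fin|by move=> y; exact: mule_ge0|exact: mGH].
  apply: lebV_le_integral.
  - by move=> y; rewrite mule_ge0// lee_fin wgt_ge0.
  - exact: measurable_mulE mw mH.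
  - by apply: measurable_mulE mGH; exact: measurable_cst.
  move=> y; rewrite muleA; apply: lee_wpmul2r => //; rewrite -EFinM lee_fin.
  rewrite wN [X in _ <= _ * X]wN; apply: wgt_near => //.
  by apply: flo_dist; rewrite cE.
have h2 : (\int[mu]_x (G (flo k x) * cube_avg k H (flo k x)) <= \int[mu]_x ((wgt s (r *: (x - x0)))%:E * (D%:E * X)))%E.
  apply: lebV_le_integral.
  - by move=> x; rewrite mule_ge0// cube_avg_ge0.
  - by apply: measurable_mulE mG _; exact: (@measurable_flo R n k _ (\bar R) (cube_avg k H)).
  - by apply: measurable_mulE mw _; exact: measurable_cst.
  move=> x; rewrite [leRHS]muleA; apply: lee_pmul; [exact: G0|exact: cube_avg_ge0| |exact: HX].
  rewrite -EFinM lee_fin mulrC wN [X in _ <= _ * X]wN; apply: wgt_near => //.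
  by apply: flo_dist; rewrite cE.
rewrite flo_average// in h2.
rewrite ge0_integralZr// in h2; first last.
- by rewrite mule_ge0.
- by move=> y _; rewrite lee_fin wgt_ge0.
have rd0 : (0 <= (r ^+ n.+1)%:E)%E by rewrite lee_fin exprn_ge0// ltW.
apply: le_trans (lee_wpmul2l rd0 (le_trans h1 (lee_wpmul2l _ h2))) _; first by rewrite lee_fin.
rewrite muleCA [X in (_ * X)%E]muleA (integral_wgt x0 ns r0).
by rewrite !EFinM le_eqVlt; apply/orP; left; apply/eqP; rewrite !muleA [(D%:E * _ * _)%E]muleAC.
Qed.

(** The two summands come from points near the cube and far from it in [wgt_spread]. *)
Definition spread_const (s : R) : R := @wgt_mass R n s * (1 + 2 * n.+1%:R) `^ s + 4 `^ s.

(** Near the cube, the whole mass of the kernel is a sufficient bound. Far from it, all points of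
    the cube are at comparable distance from [y], and the fine scale [2^(- k)] can be exchanged for
    the scale of the cube. *)
Lemma wgt_spread (s : R) j k m y : j <= k -> n.+1%:R < s ->
  ((((2 : R) ^ k) ^+ n.+1)%:E *
     \int[mu]_x (ind j m x * (wgt s ((2 : R) ^ k *: (y - x)))%:E) <=
   (spread_const s * wgt s ((2 : R) ^ j *: (y - corner j m)))%:E)%E.
Proof.
move=> jk ns; set r : R := 2 ^ k; set r' : R := 2 ^ j; set xP : W := corner j m.
have r0 : 0 < r by exact: two_gt0. have r'0 : 0 < r' by exact: two_gt0.
have s0 : 0 < s by apply: le_lt_trans ns.
set D : R := n.+1%:R; have D1 : 1 <= D by rewrite ler1n.
pose a := r / r'.
have aN : exists N : nat, a = (2 ^ N)%N%:R.
  exists `|k - j|%N; rewrite natrX exprnP.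
  by rewrite gez0_abs ?subr_ge0// expfzDr ?pnatr_eq0// /a /r /r' invr_expz.
have a1 : 1 <= a by have [N ->] := aN; rewrite ler1n expn_gt0.
have a0 : 0 < a by exact: lt_le_trans a1.
have rE : r = a * r' by rewrite /a mulfVK// gt_eqF.
set v := enorm (r' *: (y - xP)); have v0 : 0 <= v := enorm_ge0 _.
have rd0 : (0 <= (r ^+ n.+1)%:E)%E by rewrite lee_fin exprn_ge0// ltW.
have wN (u w : W) : wgt s (r *: (u - w)) = wgt s (r *: (w - u)) by rewrite -wgtN -scalerN opprB.
have mw : measurable_fun [set: V] (fun x => (wgt s (r *: (y - x)))%:E).
  by under eq_fun do rewrite wN; apply/measurable_EFinP; exact: measurable_wgt.
have mP : measurable_fun [set: V] (fun x => ind j m x : \bar R).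
  by apply/measurable_EFinP; apply: measurable_indic; exact: measurable_dcube.
have w0 u : 0 <= wgt s u :> R := wgt_ge0 s u.
have ms0 := @wgt_mass_ge0 R n s.
have [vD|Dv] := leP v (2 * D).
  apply: (@le_trans _ _ (@wgt_mass R n s)%:E).
    rewrite -(integral_wgt y ns r0); apply: lee_wpmul2l => //.
    apply: ge0_le_integral.
    - exact: measurableT.
    - by move=> x _; rewrite mule_ge0// lee_fin.
    - exact: emeasurable_funM.
    - by apply/measurable_EFinP; exact: measurable_wgt.
    by move=> x _; rewrite wN -EFinM lee_fin ler_piMl// indicE; case: (_ \in _).
  rewrite lee_fin /spread_const mulrDl; apply: ler_wpDr; first by rewrite mulr_ge0 ?powR_ge0.
  rewrite -mulrA ler_peMr//.
  rewrite /wgt powRN -/v ler_pdivlMr ?powR_gt0 ?wgt_base_gt0 ?ltr_wpDr// mul1r.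
  by apply: ge0_ler_powR; rewrite ?nnegrE ?(ltW s0) ?addr_ge0 ?lerD2l// (le_trans v0).
have far x : dcube j m x -> wgt s (r *: (y - x)) <= (a ^+ n.+1)^-1 * (4 `^ s * wgt s (r' *: (y - xP))).
  move=> xP'.
  have dx : enorm (r' *: (x - xP)) <= D.
    apply: flo_dist; rewrite /xP; have <- := (dcubeE _ _ _).1 xP'.
    by rewrite flo_corner_flo.
  have e1 : v <= enorm (r' *: (y - x)) + enorm (r' *: (x - xP)).
    by rewrite /v (_ : r' *: (y - xP) = r' *: (y - x) + r' *: (x - xP)) ?enormD// -scalerDr addrA subrK.
  have e2 : enorm (r *: (y - x)) = a * enorm (r' *: (y - x)) by rewrite rE -scalerA enormZ// ltW.
  have e3 : a * ((1 + v) / 4) <= 1 + enorm (r *: (y - x)).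
    rewrite e2; move: (enorm _) e1 => w e1; move: (enorm _) dx e1 => w' dx e1.
    have : (1 + v) / 4 <= w by lra.
    by move/(ler_wpM2l (ltW a0)); lra.
  have p0 : 0 < a * ((1 + v) / 4) by rewrite mulr_gt0// divr_gt0// ltr_wpDr.
  apply: (@le_trans _ _ ((a * ((1 + v) / 4)) `^ (- s))).
    rewrite /wgt !powRN lef_pV2 ?posrE ?powR_gt0 ?wgt_base_gt0//.
    by apply: ge0_ler_powR; rewrite ?nnegrE ?(ltW s0) ?(ltW p0) ?(ltW (wgt_base_gt0 _)).
  rewrite powRM ?(ltW a0)//; last by rewrite divr_ge0// addr_ge0.
  apply: ler_pM; rewrite ?powR_ge0//.
    (* Here [s] exceeds the dimension: [a^(- s) <= a^(- n.+1)], a factor that later cancels the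
       volume of the cube measured at scale [2^(- k)]. *)
    rewrite powRN lef_pV2 ?posrE ?powR_gt0 ?exprn_gt0//.
    by rewrite -powR_mulrn ?(ltW a0)//; apply: ler_powR => //; exact: ltW.
  rewrite powRM ?invr_ge0 ?addr_ge0// mulrC /wgt -/v; apply: ler_wpM2r; first exact: powR_ge0.
  by rewrite -[4^-1]powR_inv1// -powRrM mulN1r opprK.
apply: (@le_trans _ _ ((r ^+ n.+1)%:E *
    \int[mu]_x ((((a ^+ n.+1)^-1 * (4 `^ s * wgt s (r' *: (y - xP)))))%:E * ind j m x))%E).
  apply: lee_wpmul2l => //; apply: ge0_le_integral.
  - exact: measurableT.
  - by move=> x _; rewrite mule_ge0// lee_fin.
  - exact: emeasurable_funM.
  - by apply: emeasurable_funM => //; exact: measurable_cst.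
  move=> x _; rewrite -!EFinM lee_fin indicE; case: (boolP (x \in _)); rewrite ?mul0r ?mulr0//.
  by rewrite inE mul1r mulr1; exact: far.
rewrite lebV_integralZl; first last.
- exact: mP.
- by move=> x; rewrite lee_fin.
- by rewrite lee_fin !mulr_ge0 ?invr_ge0 ?exprn_ge0 ?powR_ge0 ?(ltW a0).
rewrite integral_indic ?setIT//; last exact: measurable_dcube.
rewrite [X in (_ * (_ * X))%E](_ : _ = (dlen j ^+ n.+1)%:E); last exact: lebo_dcube.
rewrite -!EFinM lee_fin /spread_const.
have -> : r ^+ n.+1 * ((a ^+ n.+1)^-1 * (4 `^ s * wgt s (r' *: (y - xP))) * dlen j ^+ n.+1) =
   4 `^ s * wgt s (r' *: (y - xP)) * (r ^+ n.+1 / a ^+ n.+1 * dlen j ^+ n.+1) by ring.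
have -> : r ^+ n.+1 / a ^+ n.+1 * dlen j ^+ n.+1 = 1.
  rewrite -expr_div_n -exprMn /dlen -invr_expz -/r' rE.
  by rewrite (mulrC a) mulfK ?gt_eqF// mulfV ?gt_eqF// expr1n.
by rewrite mulr1; apply: ler_wpM2r => //; rewrite lerDr mulr_ge0 ?powR_ge0.
Qed.

(** Integrating the kernel over the cube before integrating in [y] yields a weight free of [k], so
    that a sum over levels can be taken under the integral. *)
Lemma integral_Mav_cube F (s q : R) j k m : continuous F -> j <= k -> n.+1%:R < s ->
  (\int[mu]_x (ind j m x * Mav F ((2 : R) ^ k) s q x) <=
   (spread_const s)%:E * \int[mu]_y ((wgt s ((2 : R) ^ j *: (y - corner j m)))%:E * (F y `^ q)%:E))%E.
Proof.
move=> cF jk ns; set r : R := 2 ^ k; have r0 : 0 < r by exact: two_gt0.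
have rd0 : (0 <= (r ^+ n.+1)%:E)%E by rewrite lee_fin exprn_ge0// ltW.
have sc0 : 0 <= spread_const s by rewrite addr_ge0 ?mulr_ge0 ?powR_ge0 ?wgt_mass_ge0.
have mFq : measurable_fun [set: V] (fun y => F y `^ q).
  by apply: (measurableT_comp (measurable_powR _)); exact: measurable_continuous.
have mP : measurable_fun [set: V] (\1_(dcube j m : set V) : V -> R).
  by apply: measurable_indic; exact: measurable_dcube.
pose h (p : V * V) : \bar R :=
  (r ^+ n.+1 * (\1_(dcube j m : set V) p.1 * (F p.2 `^ q * wgt s (r *: ((p.2 : W) - p.1)))))%:E.
have h0 p : (0 <= h p)%E.
  by rewrite lee_fin mulr_ge0 ?exprn_ge0 ?(ltW r0)// mulr_ge0// mulr_ge0 ?powR_ge0 ?wgt_ge0.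
have mh : measurable_fun [set: V * V] h.
  apply/measurable_EFinP; apply: measurable_funM; first exact: measurable_cst.
  apply: measurable_funM; first exact: (measurableT_comp mP measurable_fst).
  apply: measurable_funM; first exact: (measurableT_comp mFq measurable_snd).
  apply: (@measurable_difference (fun u => wgt s (r *: u))).
  by have := @continuous_wgt R n s r 0; under eq_fun do rewrite addr0.
have mF y : measurable_fun [set: V] (fun x => wgt s (r *: ((y : W) - x))).
  have wN (u w : W) : wgt s (r *: (u - w)) = wgt s (r *: (w - u)) by rewrite -wgtN -scalerN opprB.
  by under eq_fun do rewrite wN; exact: measurable_wgt.
rewrite (_ : (\int[mu]_x _)%E = \int[mu]_x \int[mu]_y h (x, y))%E; last first.
  apply: eq_integral => x _; rewrite /Mav muleCA /h /=.
  under [RHS]eq_integral do rewrite 2!EFinM.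
  have m1 := measurable_Mav_integrand r s q x cF.
  rewrite lebV_integralZl; first rewrite lebV_integralZl; first by [].
  - by rewrite lee_fin.
  - by move=> y; rewrite lee_fin mulr_ge0 ?powR_ge0 ?wgt_ge0.
  - exact/measurable_EFinP.
  - exact: rd0.
  - by move=> y; rewrite -EFinM lee_fin mulr_ge0// mulr_ge0 ?powR_ge0 ?wgt_ge0.
  - by apply: measurable_mulE; [exact: measurable_cst|exact/measurable_EFinP].
rewrite (fubini_tonelli (m1 := @lebV R n) (m2 := @lebV R n) h mh h0).
have mwF : measurable_fun [set: V] (fun y => (wgt s ((2 : R) ^ j *: (y - corner j m)))%:E * (F y `^ q)%:E)%E.
  by apply: measurable_mulE; apply/measurable_EFinP; [exact: measurable_wgt|exact: mFq].
rewrite -lebV_integralZl; [|by rewrite lee_fin|by move=> y; rewrite -EFinM lee_fin mulr_ge0 ?powR_ge0 ?wgt_ge0|exact: mwF].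
apply: ge0_le_integral.
- exact: measurableT.
- by move=> y _; apply: integral_ge0 => x _; exact: h0.
- by have := @measurable_fun_fubini_tonelli_G _ _ _ _ _ (@lebV R n) h mh h0.
- by apply: emeasurable_funM => //; exact: measurable_cst.
move=> y _; rewrite /h /=.
have -> : (\int[mu]_x (r ^+ n.+1 * (\1_(dcube j m : set V) x * (F y `^ q * wgt s (r *: (y - x)))))%:E =
   (F y `^ q)%:E * ((r ^+ n.+1)%:E * \int[mu]_x (ind j m x * (wgt s (r *: (y - x)))%:E)))%E.
  have m1 : measurable_fun [set: V] (fun x => ind j m x * (wgt s (r *: (y - x)))%:E)%E.
    by apply: measurable_mulE; apply/measurable_EFinP; [exact: mP|exact: mF].
  have p1 x : (0 <= ind j m x * (wgt s (r *: (y - x)))%:E)%E.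
    by rewrite -EFinM lee_fin mulr_ge0// wgt_ge0.
  rewrite -(lebV_integralZl rd0 p1 m1) -lebV_integralZl; first last.
  - by apply: measurable_mulE m1; exact: measurable_cst.
  - by move=> x; apply: mule_ge0.
  - by rewrite lee_fin powR_ge0.
  by apply: eq_integral => x _; rewrite -!EFinM; congr EFin; ring.
apply: le_trans (lee_wpmul2l _ (wgt_spread m y jk ns)) _; first by rewrite lee_fin powR_ge0.
by rewrite -!EFinM lee_fin le_eqVlt; apply/orP; left; apply/eqP; ring.
Qed.

End averaging.

(** * The sparse sets *)

Lemma measurable_Mav (R : realType) (n : nat) (F : 'rV[R]_n.+1 -> R) (r s q : R) : continuous F ->
  measurable_fun [set: vec R n] (Mav F r s q).
Proof.
move=> cF; pose h (p : vec R n * vec R n) : \bar R :=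
  (F p.2 `^ q * wgt s (r *: ((p.2 : 'rV[R]_n.+1) - p.1)))%:E.
have mh : measurable_fun [set: vec R n * vec R n] h.
  apply/measurable_EFinP; apply: measurable_funM.
    apply: (measurableT_comp (f := fun y : vec R n => F y `^ q) _ measurable_snd).
    by apply: (measurableT_comp (measurable_powR _)); exact: measurable_continuous.
  apply: (@measurable_difference R n (fun u => wgt s (r *: u))).
  by have := @continuous_wgt R n s r 0; under eq_fun do rewrite addr0.
have h0 p : (0 <= h p)%E by rewrite lee_fin mulr_ge0 ?powR_ge0 ?wgt_ge0.
apply: measurable_mulE; first exact: measurable_cst.
exact: (@measurable_fun_fubini_tonelli_F _ _ _ _ _ (@lebV R n) h mh h0).
Qed.

Section sparse_selection.
Context {R : realType} {n : nat}.
Local Notation W := 'rV[R]_n.+1.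
Local Notation V := (vec R n).
Local Notation mu := (@lebV R n).
Local Notation ind j m x := ((\1_(dcube j m : set V) x)%:E).
Variables (q t sigma gamma A : R).
Hypotheses (t0 : 0 < t) (s0 : 0 < sigma) (tq : t < q) (ns : n.+1%:R < sigma * t).
Hypotheses (g0 : 0 < gamma) (g1 : gamma < 1) (A0 : 0 < A).
Let s := sigma * t.
Let q0 : 0 < q := lt_trans t0 tq.
Let qn0 : q != 0. Proof. by rewrite gt_eqF. Qed.
Implicit Types (x y : W) (j k : int) (f : int -> W -> R[i]).

(** Spelled as the left-hand side of the theorem; [carlesonE] restates it with averages over
    cubes. *)
Definition carleson f (l : int) : \bar R :=
  ereal_sup [set v | exists (j : int) (m : 'rV[int]_n.+1), (l <= j)%R /\
            v = ((dlen j ^+ n.+1)^-1%:E *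
                 lint (fun x => (\1_(dcube j m) x)%:E *
                         \sum_(n <oo) ((cabs (f (j + n%:Z) x)) `^ q)%:E)) `^ (1 / q)]%E.

Definition pow_sum f k x : \bar R := (\sum_(i <oo) ((cabs (f (k + i%:Z)%R x)) `^ q)%:E)%E.

Definition peetre_pow f k x : \bar R := (peetre_inf t sigma k (f k) (flo k x) `^ q)%E.

Definition peetre_tail f k x : \bar R := (\sum_(i <oo) peetre_pow f (k + i%:Z)%R x)%E.

Lemma peetre_pow_ge0 f k x : (0 <= peetre_pow f k x)%E. Proof. exact: poweR_ge0. Qed.

Lemma peetre_tail_ge0 f k x : (0 <= peetre_tail f k x)%E.
Proof. by apply: nneseries_ge0 => i _ _; exact: peetre_pow_ge0. Qed.

Lemma measurable_peetre_pow f k : measurable_fun [set: V] (peetre_pow f k).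
Proof. exact: (@measurable_flo R n k _ (\bar R) (fun m => peetre_inf t sigma k (f k) m `^ q)%E). Qed.

Lemma measurable_peetre_tail f k : measurable_fun [set: V] (peetre_tail f k).
Proof.
apply: measurable_nneseries => [i x _|i]; first exact: peetre_pow_ge0.
exact: measurable_peetre_pow.
Qed.

Lemma pow_sum_ge0 f k x : (0 <= pow_sum f k x)%E.
Proof. by apply: nneseries_ge0 => i _ _; rewrite lee_fin powR_ge0. Qed.

Let adm f := forall k : int, inEr (A * (2 : R) ^ k) (f k).

Lemma measurable_pow f k : adm f -> measurable_fun [set: V] (fun x => (cabs (f k x) `^ q)%:E).
Proof.
move=> hf; apply/measurable_EFinP; apply: (measurableT_comp (measurable_powR _)).
by apply: measurable_continuous; exact: cabs_continuous (hf k).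
Qed.

Lemma measurable_pow_sum f k : adm f -> measurable_fun [set: V] (pow_sum f k).
Proof.
move=> hf; apply: measurable_nneseries => [i x _|i]; first by rewrite lee_fin powR_ge0.
exact: measurable_pow.
Qed.

Lemma carlesonE f l : adm f ->
  carleson f l = ereal_sup [set v | exists (j : int) (m : 'rV[int]_n.+1), (l <= j)%R /\
            v = (cube_avg j (pow_sum f j) m `^ q^-1)%E].
Proof.
move=> hf; congr ereal_sup; apply/seteqP.
have E j m : ((dlen j ^+ n.+1)^-1%:E *
                 lint (fun x => (\1_(dcube j m) x)%:E *
                         \sum_(n <oo) ((cabs (f (j + n%:Z)%R x)) `^ q)%:E) = cube_avg j (pow_sum f j) m)%E.
  rewrite /cube_avg -exprVn /dlen invr_expz opprK lintE; first by [].
    by apply: measurable_indic_mul; [exact: measurable_dcube|exact: measurable_pow_sum].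
  by move=> x; apply: mule_ge0; [rewrite lee_fin|exact: pow_sum_ge0].
by split => v [j [m [lj ->]]]; exists j, m; rewrite E div1r.
Qed.

Lemma carleson_ge0 f l : adm f -> (0 <= carleson f l)%E.
Proof.
move=> hf; rewrite carlesonE//.
apply: (@le_trans _ _ (cube_avg l (pow_sum f l) 0 `^ q^-1)%E); first exact: poweR_ge0.
by apply: ereal_sup_ubound; exists l, 0.
Qed.

Lemma le_carleson f k l : l <= k -> (carleson f k <= carleson f l)%E.
Proof.
by move=> lk; apply: ereal_sup_le => v [j [m [kj ->]]]; exists j, m; split => //; exact: le_trans kj.
Qed.

Lemma le_poweR (a b : \bar R) (p : R) : 0 < p -> (0 <= a)%E -> (a <= b)%E -> (a `^ p <= b `^ p)%E.
Proof.
move=> p0 a0 ab; apply: gt0_ler_poweR => //; first exact: ltW.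
  by rewrite in_itv/= a0 leey.
by rewrite in_itv/= leey andbT; exact: le_trans ab.
Qed.

Lemma cube_avg_carleson f j m : adm f -> (cube_avg j (pow_sum f j) m <= carleson f j `^ q)%E.
Proof.
move=> hf; have a0 : (0 <= cube_avg j (pow_sum f j) m)%E by apply: cube_avg_ge0 => x; exact: pow_sum_ge0.
have -> : cube_avg j (pow_sum f j) m = ((cube_avg j (pow_sum f j) m `^ q^-1) `^ q)%E.
  by rewrite -poweRrM mulVf// poweRe1.
apply: le_poweR => //; first exact: poweR_ge0.
by rewrite carlesonE//; apply: ereal_sup_ubound; exists j, m.
Qed.

(** The product of the constants of [peetre_inf_upper], [integral_Mav_cube] and [wgt_cube_avg]; the
    final 1 makes it positive. *)
Definition tail_const : R :=
  (@wgt_mass R n s + 1) `^ (q / t) * @spread_const R n s *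
    ((1 + n.+1%:R) `^ s * (1 + n.+1%:R) `^ s * @wgt_mass R n s) + 1.

Lemma spread_const_ge0 : 0 <= @spread_const R n s.
Proof. by rewrite addr_ge0 ?mulr_ge0 ?powR_ge0 ?wgt_mass_ge0. Qed.

Lemma tail_const_gt0 : 0 < tail_const.
Proof. by rewrite ltr_wpDl// !mulr_ge0 ?powR_ge0 ?wgt_mass_ge0 ?spread_const_ge0. Qed.

(** Every level is first reduced to the same weight at scale [2^(- j)]. The levels are then summed
    under one integral, which [wgt_cube_avg] bounds by averages over cubes of level [j]. *)
Lemma integral_peetre_tail f j m : adm f ->
  (\int[mu]_x (ind j m x * peetre_tail f j x) <=
     (tail_const * dlen j ^+ n.+1)%:E * carleson f j `^ q)%E.
Proof.
move=> hf; set c2 := (@wgt_mass R n s + 1) `^ (q / t); have c20 : 0 <= c2 by exact: powR_ge0.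
have sc0 := spread_const_ge0.
have mD : measurable (dcube j m : set V) by exact: measurable_dcube.
have mT k := @measurable_indic_mul R n _ _ mD (@measurable_peetre_pow f k).
pose w y : \bar R := (wgt s ((2 : R) ^ j *: (y - corner j m)))%:E.
have w0 y : (0 <= w y)%E by rewrite lee_fin wgt_ge0.
have mw : measurable_fun [set: V] w by apply/measurable_EFinP; exact: measurable_wgt.
have step (i : nat) : (\int[mu]_x (ind j m x * peetre_pow f (j + i%:Z)%R x) <=
    (c2 * @spread_const R n s)%:E * \int[mu]_y (w y * (cabs (f (j + i%:Z)%R y) `^ q)%:E))%E.
  have jk : j <= j + i%:Z by rewrite lerDl.
  have cf := cabs_continuous (hf (j + i%:Z)).
  rewrite EFinM -muleA.
  apply: le_trans (lee_wpmul2l _ (@integral_Mav_cube R n _ s q j (j + i%:Z) m cf jk ns)); last by rewrite lee_fin.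
  have M0 x := Mav_ge0 (fun y => cabs (f (j + i%:Z) y)) s q x (two_gt0 (j + i%:Z) : 0 < (2 : R) ^ (j + i%:Z)).
  have mM := @measurable_indic_mul R n _ _ mD (measurable_Mav ((2 : R) ^ (j + i%:Z)) s q cf).
  rewrite -lebV_integralZl; [|by rewrite lee_fin|by move=> y; exact: indic_ge0|exact: mM].
  apply: lebV_le_integral.
  - by move=> y; apply: indic_ge0 => z; exact: peetre_pow_ge0.
  - exact: mT.
  - by apply: measurable_mulE mM; exact: measurable_cst.
  move=> y; rewrite muleCA; apply: lee_wpmul2l; first by rewrite lee_fin.
  exact: (peetre_inf_upper t0 _ y cf ns (ltW tq)).
have -> : (\int[mu]_x (ind j m x * peetre_tail f j x) =
   \sum_(i <oo) \int[mu]_x (ind j m x * peetre_pow f (j + i%:Z)%R x))%E.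
  rewrite -integral_nneseries; [|exact: measurableT|by move=> i; exact: mT|
    by move=> i x _; apply: indic_ge0 => z; exact: peetre_pow_ge0].
  by apply: eq_integral => x _; rewrite nneseriesZl// => i _; exact: peetre_pow_ge0.
apply: (@le_trans _ _ ((c2 * @spread_const R n s)%:E * \int[mu]_y (w y * pow_sum f j y))%E).
  have mwf i : measurable_fun [set: V] (fun y => w y * (cabs (f (j + i%:Z)%R y) `^ q)%:E)%E.
    by apply: measurable_mulE mw _; exact: measurable_pow.
  have wf0 i y : (0 <= w y * (cabs (f (j + i%:Z)%R y) `^ q)%:E)%E by rewrite mule_ge0// lee_fin powR_ge0.
  have -> : (\int[mu]_y (w y * pow_sum f j y) = \sum_(i <oo) \int[mu]_y (w y * (cabs (f (j + i%:Z)%R y) `^ q)%:E))%E.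
    rewrite -integral_nneseries; [|exact: measurableT|exact: mwf|by move=> i x _; exact: wf0].
    by apply: eq_integral => x _; rewrite nneseriesZl// => i _; rewrite lee_fin powR_ge0.
  rewrite -nneseriesZl; last by move=> i _; apply: integral_ge0 => y _; exact: wf0.
  apply: lee_nneseries => [i _ _|i _]; last exact: step.
  by apply: integral_ge0 => x _; apply: indic_ge0 => z; exact: peetre_pow_ge0.
have X0 : (0 <= carleson f j `^ q)%E by exact: poweR_ge0.
set D := (1 + n.+1%:R) `^ s * (1 + n.+1%:R) `^ s * @wgt_mass R n s.
have D0 : 0 <= D by rewrite !mulr_ge0 ?powR_ge0 ?wgt_mass_ge0.
have l0 : 0 < dlen j ^+ n.+1 :> R by rewrite exprn_gt0// two_gt0.
have h : (\int[mu]_y (w y * pow_sum f j y) <= (dlen j ^+ n.+1)%:E * (D%:E * carleson f j `^ q))%E.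
  have := @wgt_cube_avg R n s j _ (carleson f j `^ q)%E (corner j m) ns (pow_sum_ge0 f j)
     (measurable_pow_sum j hf) (fun m => cube_avg_carleson j m hf).
  move=> /(lee_wpmul2l (_ : (0 <= (dlen j ^+ n.+1)%:E)%E)); rewrite lee_fin => /(_ (ltW l0)).
  rewrite muleA -EFinM -exprMn /dlen -invr_expz mulVf ?gt_eqF ?two_gt0// expr1n mul1e.
  exact.
apply: le_trans (lee_wpmul2l _ h) _; first by rewrite lee_fin mulr_ge0.
rewrite !muleA -!EFinM; apply: lee_wpmul2r => //; rewrite lee_fin.
rewrite /tail_const -/D -/c2 mulrAC [X in _ <= X]mulrDl mul1r lerDl; exact: ltW.
Qed.

(** Chosen for [2^skip > skip > 4 / gamma], so that a subcube [skip] levels down fills less than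
    [gamma / 4] of its cube. *)
Definition skip : nat := (Num.trunc (4 / gamma)).+1.

Lemma skip_lt : (2 : R)^-1 ^+ skip < gamma / 4.
Proof.
rewrite exprVn -[gamma / 4]invrK ltf_pV2 ?posrE ?exprn_gt0 ?invr_gt0 ?divr_gt0// invf_div.
have g40 : 0 <= 4 / gamma by rewrite divr_ge0// ltW.
have /andP[_ h] := truncn_itv g40; apply: (lt_trans h); rewrite -/skip.
by rewrite -natrX ltr_nat; exact: ltn_expl.
Qed.

(** With this value Chebyshev's inequality leaves at most the fraction [gamma / 2] of a cube as
    bad. *)
Definition level_const : R := 2 * tail_const / gamma.

Definition good_level f k x : Prop := (peetre_tail f k x <= level_const%:E * carleson f k `^ q)%E.

(* Removing a small subcube makes [Sset] a proper subset. *)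
Definition removed_corner k (m : 'rV[int]_n.+1) : set W :=
  dcube (k + skip%:Z) (flo (k + skip%:Z) (corner k m : W)).

Definition Sset f k m : set W := [set x | [/\ dcube k m x, ~ removed_corner k m x & good_level f k x]].

Lemma level_const_gt0 : 0 < level_const.
Proof. by rewrite divr_gt0// mulr_gt0// tail_const_gt0. Qed.

Lemma measurable_good_level f k : measurable ([set x | good_level f k x] : set V).
Proof.
have h := measurable_fun_lee (measurable_peetre_tail f k) (measurable_cst (level_const%:E * carleson f k `^ q)%E).
by have := h measurableT [set true] (ltac:(by [])); rewrite setTI.
Qed.

Lemma SsetE f k m : Sset f k m = (dcube k m `\` removed_corner k m) `&` [set x | good_level f k x].
Proof. by apply/seteqP; split => x /= => [[? ? ?]|[[? ?] ?]]. Qed.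

Lemma measurable_Sset f k m : measurable (Sset f k m : set V).
Proof.
rewrite SsetE; apply: measurableI; last exact: measurable_good_level.
by apply: measurableD; exact: measurable_dcube.
Qed.

(** Chebyshev's inequality when the Carleson supremum is positive and finite. If it is 0, the tail
    has integral 0 over the cube and vanishes almost everywhere there; if it is infinite, every
    point is good. *)
Lemma lebo_bad f k m : adm f ->
  (lebo (dcube k m `&` [set x | ~ good_level f k x]) <= (gamma / 2 * dlen k ^+ n.+1)%:E)%E.
Proof.
move=> hf; set bad := _ `&` _.
have l0 : 0 < dlen k ^+ n.+1 :> R by rewrite exprn_gt0// two_gt0.
have mbad : measurable (bad : set V).
  apply: measurableI; first exact: measurable_dcube.
  exact: measurableC (measurable_good_level f k).
have X0 := carleson_ge0 k hf.
have := integral_peetre_tail k m hf; have : (0 <= carleson f k `^ q)%E by exact: poweR_ge0.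
have B0 := level_const_gt0.
have badP x : bad x -> dcube k m x /\ (level_const%:E * carleson f k `^ q < peetre_tail f k x)%E.
  by move=> [? /= /negP]; rewrite -ltNge.
move: badP; case: (carleson f k `^ q)%E => [u||] badP u0 hI; last by [].
- have [u00|un0] := eqVneq u 0.
    have mT := measurable_indic_mul (measurable_dcube k m) (measurable_peetre_tail f k).
    have T0 y : (0 <= ind k m y * peetre_tail f k y)%E.
      by apply: indic_ge0 => z; exact: peetre_tail_ge0.
    have I0 : (\int[mu]_(x in setT) `|ind k m x * peetre_tail f k x| = 0)%E.
      under eq_integral do rewrite gee0_abs//.
      by apply/eqP; rewrite eq_le integral_ge0 ?andbT//; move: hI; rewrite u00 mule0.
    have := (ae_eq_integral_abs mu measurableT mT).1 I0.
    move=> aeT; suff -> : lebo bad = 0%E by rewrite lee_fin mulr_ge0 ?divr_ge0 ?ltW.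
    apply: (@measure_negligible _ _ _ mu); first exact: mbad.
    apply: negligibleS aeT => x /badP[xm lt0] /= /(_ I) E.
    move: lt0; rewrite u00 mule0 ltNge; apply/negP/negPn.
    by rewrite -E indicE mem_set// mul1e.
  have up : 0 < u by rewrite lt_def un0 -lee_fin.
  have h : ((level_const * u)%:E * mu bad <= (tail_const * dlen k ^+ n.+1)%:E * u%:E)%E.
    apply: le_trans hI; rewrite -[X in (_ * mu X)%E]setIT -integral_indic//.
    rewrite -lebV_integralZl; first last.
    - by apply/measurable_EFinP; exact: measurable_indic.
    - by move=> y; rewrite lee_fin.
    - by rewrite lee_fin mulr_ge0// ltW.
    apply: lebV_le_integral.
    - by move=> y; rewrite -EFinM lee_fin; apply: mulr_ge0 => //; exact: ltW (mulr_gt0 B0 up).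
    - by apply: measurable_mulE; [exact: measurable_cst|apply/measurable_EFinP; exact: measurable_indic].
    - by apply: measurable_indic_mul; [exact: measurable_dcube|exact: measurable_peetre_tail].
    move=> y; rewrite indicE; case: (boolP (y \in _)); last first.
      by move=> _; rewrite mule0; apply: indic_ge0 => z; exact: peetre_tail_ge0.
    rewrite inE => /badP[ym /ltW]; rewrite mule1 indicE mem_set// mul1e.
    by rewrite EFinM.
  move: h; rewrite -[mu bad]/(lebo bad).
  have Bu : 0 < level_const * u by rewrite mulr_gt0.
  rewrite muleC -lee_pdivlMr// => h; apply: (le_trans h).
  rewrite -!EFinM lee_fin /level_const le_eqVlt; apply/orP; left; apply/eqP.
  by field; rewrite !gt_eqF// tail_const_gt0.
- suff -> : bad = set0 by rewrite lebo0 lee_fin mulr_ge0 ?divr_ge0 ?ltW.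
  by apply/seteqP; split => // x /badP[_]; rewrite gt0_muley ?lte_fin// ltNge leey.
Qed.

(** The bad part and the removed subcube together take at most [gamma / 2 + gamma / 4] of the cube,
    which leaves room for the strict inequality. *)
Lemma lebo_Sset f k m : adm f -> (((1 - gamma) * dlen k ^+ n.+1)%:E < lebo (Sset f k m))%E.
Proof.
move=> hf; have l0 : 0 < dlen k ^+ n.+1 :> R by rewrite exprn_gt0// two_gt0.
have h : (lebo (dcube k m) <= lebo (Sset f k m) + (lebo (removed_corner k m) +
   lebo (dcube k m `&` [set x | ~ good_level f k x])))%E.
  apply: (@le_trans _ _ (lebo (Sset f k m `|` (removed_corner k m `|` (dcube k m `&` [set x | ~ good_level f k x]))))).
    apply: le_lebo => x xm; have [gx|gx] := pselect (good_level f k x); last by right; right.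
    by have [rx|rx] := pselect (removed_corner k m x); [right; left|left].
  apply: le_trans (outer_measureU2 (@lebo R n.+1) _ _) _; apply: leeD2l.
  exact: outer_measureU2.
have hb := lebo_bad k m hf.
have hr : (lebo (removed_corner k m) <= (gamma / 4 * dlen k ^+ n.+1)%:E)%E.
  rewrite /removed_corner lebo_dcube lee_fin /dlen opprD expfzDr ?pnatr_eq0// exprMn mulrC.
  apply: ler_wpM2r; first exact: ltW.
  apply: le_trans (ltW skip_lt); rewrite -invr_expz -exprnP -exprVn exprSr.
  rewrite ler_piMl ?exprn_ge0 ?invr_ge0//.
  by rewrite -exprM exprn_ile1 ?invr_ge0// invf_le1// ler1n.
move: h; rewrite lebo_dcube => /le_trans /(_ (leeD2l _ (leeD hr hb))).
have := lebo_ge0 (Sset f k m); case: (lebo (Sset f k m)) => [u||]//=; last by rewrite ltry.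
rewrite !lee_fin lte_fin => u0; move: (dlen k ^+ n.+1) l0 => l l0.
have := mulr_gt0 g0 l0; nra.
Qed.

Lemma Sset_sub f k m : Sset f k m `<=` dcube k m.
Proof. by move=> x []. Qed.

Lemma Sset_proper f k m : Sset f k m <> dcube k m.
Proof.
move=> E; have : dcube k m (corner k m : W).
  move=> i; rewrite /rcoord mxE lexx /= ltr_pM2l ?ltrDl//; exact: two_gt0.
by rewrite -E => -[_ + _]; apply; exact/dcubeE.
Qed.

Lemma lebo_measurable_Sset f k m : lebo_measurable (Sset f k m).
Proof. exact: measurable_Sset. Qed.

Definition Sunion f k : set V := [set x | Sset f k (flo k x) x].

Lemma measurable_Sunion f k : measurable (Sunion f k).
Proof.
rewrite (_ : Sunion f k = \bigcup_m (Sset f k m : set V)).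
  by apply: countable_bigcupT_measurable; [exact: countableP|exact: measurable_Sset].
apply/seteqP; split => x /=; first by exists (flo k x).
by move=> [m _ xm]; have [/dcubeE xE _ _] := xm; rewrite /Sunion /= xE.
Qed.

Definition sel f k x : \bar R := (peetre_inf t sigma k (f k) (flo k x) * (\1_(Sunion f k) x)%:E)%E.

(** Cubes of one level are disjoint, so only the cube that contains [x] can contribute. *)
Lemma selE f k x : (\esum_(m in [set: 'rV[int]_n.+1])
   (ereal_inf [set peetre t%:E sigma k (f k) y | y in dcube k m] * (\1_(Sset f k m) x)%:E) = sel f k x)%E.
Proof.
have a0 := peetre_inf_ge0 t sigma k (f k).
rewrite -[RHS](esum_set1 (t := flo k x) (a := fun m => peetre_inf t sigma k (f k) m * (\1_(Sset f k m) x)%:E)%E); last first.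
  by rewrite mule_ge0// lee_fin.
rewrite [RHS]esum_mkcond; apply: eq_esum => m _.
case: ifPn => //; rewrite notin_setE /= => mx.
rewrite indicE memNset ?mule0// => /Sset_sub /dcubeE; exact/nesym.
Qed.

Lemma sel_powE f k x : (sel f k x `^ q = peetre_pow f k x * (\1_(Sunion f k) x)%:E)%E.
Proof.
rewrite /sel indicE; case: (_ \in _); first by rewrite !mule1.
by rewrite !mule0 poweR0r// gt_eqF.
Qed.

Lemma measurable_sel_pow f k : measurable_fun [set: V] (fun x => sel f k x `^ q)%E.
Proof.
under eq_fun do rewrite sel_powE.
apply: measurable_mulE; first exact: measurable_peetre_pow.
by apply/measurable_EFinP; apply: measurable_indic; exact: measurable_Sunion.
Qed.

Definition sel_sum f l x : \bar R := (\sum_(i <oo) (sel f (l + i%:Z)%R x `^ q))%E.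

Lemma sel_sum_ge0 f l x : (0 <= sel_sum f l x)%E.
Proof. by apply: nneseries_ge0 => i _ _; exact: poweR_ge0. Qed.

Lemma measurable_sel_sum f k : measurable_fun [set: V] (sel_sum f k).
Proof. by apply: measurable_nneseries => [i x _|i]; [exact: poweR_ge0|exact: measurable_sel_pow]. Qed.

Lemma sel_sum_shift f l (N : nat) x : (forall i, (i < N)%N -> sel f (l + i%:Z) x = 0%E) ->
  sel_sum f l x = sel_sum f (l + N%:Z) x.
Proof.
move=> z; rewrite /sel_sum (nneseries_split 0 N); last by move=> i _; exact: poweR_ge0.
rewrite add0n big_nat big1 ?add0r => [|i /andP[_ iN]]; last by rewrite z// poweR0r.
rewrite -nneseries_addn; last by move=> i; exact: poweR_ge0.
by apply: eq_eseriesr => i _; rewrite -addrA -PoszD addnC.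
Qed.

(* If [N] is the first level at which [x] is selected, the previous terms vanish and [good_level] at [N] bounds the rest. *)
Lemma sel_sum_le f l x : adm f -> (sel_sum f l x <= level_const%:E * carleson f l `^ q)%E.
Proof.
move=> hf; have B0 := level_const_gt0.
have X0 k : (0 <= level_const%:E * carleson f k `^ q)%E by rewrite mule_ge0 ?poweR_ge0// lee_fin ltW.
have [[i0 hi0]|no] := pselect (exists i : nat, Sunion f (l + i%:Z) x); last first.
  rewrite /sel_sum eseries0// => i _ _.
  rewrite /sel indicE memNset ?mule0 ?poweR0r//.
  by move=> xi; apply: no; exists i.
have exN : exists i, `[< Sunion f (l + i%:Z) x >] by exists i0; exact/asboolP.
have [N /asboolP SN minN] := ex_minnP exN.
rewrite (@sel_sum_shift f l N x); last first.
  move=> i iN; rewrite /sel indicE memNset ?mule0// => /asboolP/minN.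
  by rewrite leqNgt iN.
apply: (@le_trans _ _ (peetre_tail f (l + N%:Z) x)).
  apply: lee_nneseries => [i _ _|i _]; first exact: poweR_ge0.
  rewrite sel_powE -[leRHS]mule1; apply: lee_wpmul2l; first exact: peetre_pow_ge0.
  by rewrite lee_fin indicE; case: (_ \in _).
case: SN => _ _ gx; apply: (le_trans gx); apply: lee_wpmul2l; first by rewrite lee_fin ltW.
by apply: le_poweR => //; [exact: carleson_ge0|apply: le_carleson; rewrite lerDl].
Qed.

Lemma integral_sel f j k m : adm f -> j <= k ->
  (\int[mu]_x (ind j m x * peetre_pow f k x) <=
    (1 - gamma)^-1%:E * \int[mu]_x (ind j m x * sel f k x `^ q))%E.
Proof.
move=> hf jk; have og : 0 < 1 - gamma by rewrite subr_gt0.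
(* As [j <= k], the indicator of the cube of level [j] is constant on cubes of level [k] and can be
   read off their corners. Then [flo_average] replaces the indicator of [Sunion] by its averages,
   which are at least [1 - gamma]. *)
pose G p : \bar R := ((\1_(dcube j m : set W) (corner k p))%:E * peetre_inf t sigma k (f k) p `^ q)%E.
have G0 p : (0 <= G p)%E by rewrite mule_ge0 ?poweR_ge0// lee_fin.
have GE x : G (flo k x) = (ind j m x * peetre_pow f k x)%E.
  rewrite /G; congr (_ * _)%E; congr EFin; rewrite !indicE; congr (_ %:R); congr nat_of_bool.
  by apply: asbool_equiv_eq; split => /dcubeE; rewrite ?(flo_corner_flo x jk) => xm; apply/dcubeE; rewrite ?(flo_corner_flo x jk).
pose H y : \bar R := (\1_(Sunion f k) y)%:E.
have H0 y : (0 <= H y)%E by rewrite lee_fin.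
have mH : measurable_fun [set: V] H.
  by apply/measurable_EFinP; apply: measurable_indic; exact: measurable_Sunion.
have -> : (\int[mu]_x (ind j m x * sel f k x `^ q) = \int[mu]_y (G (flo k y) * H y))%E.
  by apply: eq_integral => x _; rewrite GE sel_powE muleA.
rewrite -(flo_average k G0 H0 mH).
have mG : measurable_fun [set: V] (fun x => G (flo k x)) by exact: measurable_flo.
have mA : measurable_fun [set: V] (fun x => G (flo k x) * cube_avg k H (flo k x))%E.
  by apply: measurable_mulE mG _; exact: (@measurable_flo R n k _ (\bar R) (cube_avg k H)).
rewrite -lebV_integralZl; [|by rewrite lee_fin invr_ge0 ltW|by move=> y; rewrite mule_ge0// cube_avg_ge0|exact: mA].
apply: lebV_le_integral.
- by move=> x; apply: indic_ge0 => z; exact: peetre_pow_ge0.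
- by apply: measurable_indic_mul; [exact: measurable_dcube|exact: measurable_peetre_pow].
- by apply: measurable_mulE mA; exact: measurable_cst.
move=> x; rewrite -GE muleCA -[leLHS]mule1; apply: lee_wpmul2l => //.
have h : ((1 - gamma)%:E <= cube_avg k H (flo k x))%E.
  have -> : cube_avg k H (flo k x) = ((((2 : R) ^ k) ^+ n.+1)%:E * lebo (Sset f k (flo k x)))%E.
    rewrite /cube_avg; congr (_ * _)%E.
    transitivity (\int[mu]_y (\1_(Sset f k (flo k x) : set V) y)%:E)%E.
      apply: eq_integral => y _; rewrite /H -EFinM; congr EFin; rewrite !indicE.
      have [yx|yx] := boolP (y \in (dcube k (flo k x) : set V)).
        rewrite mul1r; congr (_ %:R); congr nat_of_bool; apply: asbool_equiv_eq.
        by rewrite /Sunion /=; move: yx; rewrite inE => /dcubeE ->.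
      by rewrite mul0r memNset// => /Sset_sub ym; move: yx; rewrite notin_setE; exact.
    by rewrite integral_indic ?setIT//; exact: measurable_Sset.
  have r0 : 0 < ((2 : R) ^ k) ^+ n.+1 by rewrite exprn_gt0// two_gt0.
  have := lee_wpmul2l (_ : (0 <= (((2 : R) ^ k) ^+ n.+1)%:E)%E) (ltW (lebo_Sset k (flo k x) hf)).
  rewrite lee_fin => /(_ (ltW r0)); apply: le_trans.
  rewrite -EFinM lee_fin mulrCA /dlen -invr_expz -exprMn mulfV ?expr1n ?mulr1//.
  by rewrite gt_eqF// two_gt0.
have := lee_wpmul2l (_ : (0 <= (1 - gamma)^-1%:E)%E) h; rewrite lee_fin invr_ge0 => /(_ (ltW og)).
by rewrite -EFinM mulVf// gt_eqF.
Qed.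

Lemma lebo_dcube_gt0 j m : (0 < lebo (dcube j m : set W))%E.
Proof. by rewrite lebo_dcube lte_fin exprn_gt0// two_gt0. Qed.

Lemma esssup_sel_le f l : adm f ->
  (esssup (fun x => sel_sum f l x `^ q^-1) <= (level_const `^ q^-1)%:E * carleson f l)%E.
Proof.
move=> hf; apply: ereal_inf_lbound; rewrite /= -(lebo0 (n := n)); congr lebo.
apply/seteqP; split => // x /=; apply/negP; rewrite -leNgt.
have B0 := level_const_gt0; have C0 := carleson_ge0 l hf.
have -> : ((level_const `^ q^-1)%:E * carleson f l = (level_const%:E * carleson f l `^ q) `^ q^-1)%E.
  rewrite poweRM ?poweR_ge0 ?lee_fin ?(ltW B0)// poweR_EFin -poweRrM mulfV//.
  by rewrite poweRe1.
by apply: le_poweR; [rewrite invr_gt0|exact: sel_sum_ge0|exact: sel_sum_le].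
Qed.

(** A sum that starts at the later level [j] is at most the one from [l], which is at most [b^q]
    outside a null set. A negative [b] is impossible, since the exceptional set would then contain a
    cube. *)
Lemma integral_sel_sum_le f l j m (b : \bar R) : l <= j ->
  lebo [set x | (b < sel_sum f l x `^ q^-1)%E] = 0%E ->
  (\int[mu]_x (ind j m x * sel_sum f j x) <= (dlen j ^+ n.+1)%:E * b `^ q)%E
  /\ (0 <= b)%E.
Proof.
move=> lj b0.
have bge0 : (0 <= b)%E.
  rewrite leNgt; apply/negP => blt.
  have := lebo_dcube_gt0 j m; rewrite -b0 ltNge => /negP; apply; apply: le_lebo => x _ /=.
  by apply: (lt_le_trans blt); exact: poweR_ge0.
split => //.
have mD := measurable_indic (measurable_dcube j m : measurable (_ : set V)).
have -> : ((dlen j ^+ n.+1)%:E * b `^ q = \int[mu]_x (b `^ q * ind j m x))%E.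
  rewrite lebV_integralZl; first last.
  - exact/measurable_EFinP.
  - by move=> y; rewrite lee_fin.
  - exact: poweR_ge0.
  rewrite integral_indic ?setIT//; last exact: measurable_dcube.
  by rewrite [X in (_ = _ * X)%E](_ : _ = (dlen j ^+ n.+1)%:E) 1?muleC//; exact: lebo_dcube.
apply: ae_ge0_le_integral.
- exact: measurableT.
- by move=> x _; apply: indic_ge0 => z; exact: sel_sum_ge0.
- by apply: measurable_indic_mul; [exact: measurable_dcube|exact: measurable_sel_sum].
- by move=> x _; rewrite mule_ge0 ?poweR_ge0// lee_fin.
- by apply: measurable_mulE; [exact: measurable_cst|exact/measurable_EFinP].
exists [set x | (b < sel_sum f l x `^ q^-1)%E]; split; last first.
- move=> x /= h; have [xb|//] := leP (sel_sum f l x `^ q^-1)%E b; exfalso; apply: h => _.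
  rewrite muleC; apply: lee_wpmul2r; first by rewrite lee_fin.
  apply: (@le_trans _ _ (sel_sum f l x)).
    have [N ->] : exists N : nat, j = l + N%:Z.
      by exists `|j - l|%N; rewrite gez0_abs ?subr_ge0//; ring.
    rewrite [leRHS]/sel_sum (nneseries_split 0 N); last by move=> i _; exact: poweR_ge0.
    rewrite -[leLHS]add0e add0n; apply: leeD; first by apply: sume_ge0 => i _; exact: poweR_ge0.
    rewrite -nneseries_addn; last by move=> i; exact: poweR_ge0.
    rewrite le_eqVlt; apply/orP; left; apply/eqP.
    by apply: eq_eseriesr => i _; rewrite -addrA -PoszD addnC.
  have -> : sel_sum f l x = ((sel_sum f l x `^ q^-1) `^ q)%E by rewrite -poweRrM mulVf// poweRe1// sel_sum_ge0.
  by apply: le_poweR => //; exact: poweR_ge0.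
- exact: b0.
have h := measurable_fun_lte (measurable_cst b) (measurableT_comp (measurable_poweR q^-1) (measurable_sel_sum f l)).
by have := h measurableT [set true] (ltac:(by [])); rewrite setTI.
Qed.

Lemma carleson_le : exists2 C : R, 0 < C & forall f l, adm f ->
  (carleson f l <= C%:E * esssup (fun x => sel_sum f l x `^ q^-1))%E.
Proof.
have [C1 C10 hC1] := peetre_inf_lower t0 s0 A0 (n := n).
have og : 0 < 1 - gamma by rewrite subr_gt0.
pose D := C1 `^ q / (1 - gamma).
have D0 : 0 < D by rewrite divr_gt0 ?powR_gt0.
exists (D `^ q^-1); first by rewrite powR_gt0.
move=> f l hf; rewrite muleC -lee_pdivrMr ?powR_gt0//.
(* Since [esssup] is an infimum, the estimate is proved for each essential upper bound [b]. *)
apply: le_ereal_inf_tmp => b /= b0; rewrite lee_pdivrMr ?powR_gt0// muleC.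
rewrite carlesonE//; apply: ge_ereal_sup => _ [j [m [lj ->]]].
have [hb bge0] := integral_sel_sum_le m lj b0.
have l0 : 0 < dlen j ^+ n.+1 :> R by rewrite exprn_gt0// two_gt0.
have mD : measurable (dcube j m : set V) by exact: measurable_dcube.
suff h : (cube_avg j (pow_sum f j) m <= D%:E * b `^ q)%E.
  have -> : ((D `^ q^-1)%:E * b = (D%:E * b `^ q) `^ q^-1)%E.
    by rewrite poweRM ?poweR_ge0 ?lee_fin ?(ltW D0)// poweR_EFin -poweRrM mulfV// poweRe1.
  apply: le_poweR h; first by rewrite invr_gt0.
  by apply: cube_avg_ge0 => x; exact: pow_sum_ge0.
have mP k := measurable_indic_mul mD (measurable_peetre_pow f k).
have P0 k x : (0 <= ind j m x * peetre_pow f k x)%E.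
  by apply: indic_ge0 => z; exact: peetre_pow_ge0.
have mS k := measurable_indic_mul mD (measurable_sel_pow f k).
have S0 k x : (0 <= ind j m x * sel f k x `^ q)%E.
  by apply: mule_ge0; [rewrite lee_fin|exact: poweR_ge0].
have mT := measurable_indic_mul mD (measurable_peetre_tail f j).
have T0 x : (0 <= ind j m x * peetre_tail f j x)%E.
  by apply: indic_ge0 => z; exact: peetre_tail_ge0.
have h1 : (\int[mu]_x (ind j m x * pow_sum f j x) <=
    (C1 `^ q)%:E * \int[mu]_x (ind j m x * peetre_tail f j x))%E.
  rewrite -lebV_integralZl; [|by rewrite lee_fin powR_ge0|exact: T0|exact: mT].
  apply: lebV_le_integral.
  - by move=> x; apply: indic_ge0 => z; exact: pow_sum_ge0.
  - by apply: measurable_indic_mul; [exact: measurable_dcube|exact: measurable_pow_sum].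
  - by apply: measurable_mulE mT; exact: measurable_cst.
  move=> x; rewrite muleCA; apply: lee_wpmul2l; first by rewrite lee_fin.
  rewrite -nneseriesZl; last by move=> i _; exact: peetre_pow_ge0.
  apply: lee_nneseries => [i _ _|i _]; first by rewrite lee_fin powR_ge0.
  rewrite -!poweR_EFin /peetre_pow -poweRM ?lee_fin ?(ltW C10) ?peetre_inf_ge0//.
  by apply: le_poweR => //; [rewrite lee_fin cabs_ge0|exact: hC1 (hf _) x].
have h2 : (\int[mu]_x (ind j m x * peetre_tail f j x) <=
    (1 - gamma)^-1%:E * \int[mu]_x (ind j m x * sel_sum f j x))%E.
  have -> : (\int[mu]_x (ind j m x * peetre_tail f j x) =
     \sum_(i <oo) \int[mu]_x (ind j m x * peetre_pow f (j + i%:Z)%R x))%E.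
    rewrite -integral_nneseries; [|exact: measurableT|by move=> i; exact: mP|by move=> i x _; exact: P0].
    by apply: eq_integral => x _; rewrite nneseriesZl// => i _; exact: peetre_pow_ge0.
  have -> : (\int[mu]_x (ind j m x * sel_sum f j x) =
     \sum_(i <oo) \int[mu]_x (ind j m x * sel f (j + i%:Z)%R x `^ q))%E.
    rewrite -integral_nneseries; [|exact: measurableT|by move=> i; exact: mS|by move=> i x _; exact: S0].
    by apply: eq_integral => x _; rewrite nneseriesZl// => i _; exact: poweR_ge0.
  rewrite -nneseriesZl; last by move=> i _; apply: integral_ge0 => y _; exact: S0.
  apply: lee_nneseries => [i _ _|i _]; first by apply: integral_ge0 => x _; exact: P0.
  by apply: integral_sel => //; rewrite lerDl.
have r0 : 0 < ((2 : R) ^ j) ^+ n.+1 by rewrite exprn_gt0// two_gt0.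
have og0 : (0 <= (1 - gamma)^-1%:E)%E by rewrite lee_fin invr_ge0 ltW.
have C1q0 : (0 <= (C1 `^ q)%:E)%E by rewrite lee_fin powR_ge0.
have h3 := le_trans h1 (lee_wpmul2l C1q0 (le_trans h2 (lee_wpmul2l og0 hb))).
apply: le_trans (lee_wpmul2l (_ : 0 <= (((2 : R) ^ j) ^+ n.+1)%:E)%E h3) _; first by rewrite lee_fin ltW.
rewrite !muleA -!EFinM; apply: lee_wpmul2r; first exact: poweR_ge0.
rewrite lee_fin /D /dlen -invr_expz exprVn le_eqVlt; apply/orP; left; apply/eqP.
by field; rewrite !gt_eqF.
Qed.

End sparse_selection.

Theorem theorem1p1 (R : realType) (d : nat) (q : R) (t : \bar R) (sigma gamma A : R)
  (hq : 0 < q) (ht : (0 < t)%E) (hsig : dover d t < sigma) (htq : d%:R / q < dover d t)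
  (hg0 : 0 < gamma) (hg1 : gamma < 1) (hA : 0 < A) :
  exists C1 C2 : R, 0 < C1 /\ 0 < C2 /\
  forall f : int -> 'rV[R]_d -> R[i],
    (forall k : int, inEr (A * (2 : R) ^ k) (f k)) ->
    exists S : int -> 'rV[int]_d -> set 'rV[R]_d,
      (forall (k : int) (m : 'rV[int]_d),
          S k m `<=` dcube k m /\ S k m <> dcube k m /\ lebo_measurable (S k m) /\
          (((1 - gamma) * dlen k ^+ d)%:E < lebo (S k m))%E) /\
      forall mu : int,
        let lhs : \bar R :=
          ereal_sup [set v | exists (j : int) (m : 'rV[int]_d), (mu <= j)%R /\
            v = ((dlen j ^+ d)^-1%:E *
                 lint (fun x => (\1_(dcube j m) x)%:E *
                         \sum_(n <oo) ((cabs (f (j + n%:Z) x)) `^ q)%:E)) `^ (1 / q)]%E in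
        let g : int -> 'rV[R]_d -> \bar R := fun k x =>
          (\esum_(m in [set: 'rV[int]_d])
             (ereal_inf [set peetre t sigma k (f k) y | y in dcube k m] *
              (\1_(S k m) x)%:E))%E in
        let rhs : \bar R :=
          esssup (fun x => (\sum_(n <oo) (g (mu + n%:Z)%R x) `^ q) `^ (1 / q))%E in
        (C1%:E * rhs <= lhs)%E /\ (lhs <= C2%:E * rhs)%E.
Proof.
(* [dover d t] is [0] if [d = 0] or [t = +oo], so [htq] excludes both cases. *)
case: d hsig htq => [|n] hsig htq.
  by move: htq; rewrite mul0r; case: (t) => [t'||] /=; rewrite ?mul0r ltxx.
case: t ht hsig htq => [t||] //; last by move=> _ _; rewrite /dover ltNge divr_ge0// ltW.
rewrite lte_fin /dover => t0 hsig htq.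
have n0 : 0 < n.+1%:R :> R by [].
have tq : t < q by move: htq; rewrite ltr_pM2l// ltf_pV2 ?posrE.
have ns : n.+1%:R < sigma * t by rewrite -ltr_pdivrMr.
have s0 : 0 < sigma by apply: lt_trans hsig; exact: divr_gt0.
have [C2 C20 hC2] := carleson_le (n := n) t0 s0 tq ns hg0 hg1 hA.
have B0 : 0 < @level_const R n q t sigma gamma by exact: level_const_gt0.
exists ((@level_const R n q t sigma gamma `^ q^-1)^-1), C2.
split; first by rewrite invr_gt0 powR_gt0.
split => // f hf.
exists (Sset q t sigma gamma f); split => [k m|l].
  split; first exact: Sset_sub.
  split; first exact: Sset_proper.
  split; first exact: lebo_measurable_Sset.
  exact: (lebo_Sset t0 tq ns hg0 k m hf).
have E : esssup (fun x => (\sum_(i <oo) (\esum_(m in [set: 'rV[int]_n.+1])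
    (ereal_inf [set peetre t%:E sigma (l + i%:Z)%R (f (l + i%:Z)%R) y | y in dcube (l + i%:Z)%R m] *
      (\1_(Sset q t sigma gamma f (l + i%:Z)%R m) x)%:E)) `^ q) `^ (1 / q))%E =
    esssup (fun x => sel_sum q t sigma gamma f l x `^ q^-1)%E.
  rewrite div1r; congr esssup; apply/funext => x; congr (_ `^ _)%E.
  by apply: eq_eseriesr => i _; rewrite selE.
have := hC2 f l hf; rewrite -E => h2; split; last exact: h2.
rewrite E muleC lee_pdivrMr ?powR_gt0// muleC.
exact: (esssup_sel_le sigma t0 tq hg0 l hf).
Qed.
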